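(* Let $L$ be a reduced alternating link diagram and let $n\ge 1$. Then $$\tilde{J}_{n,L}\doteq_{4n}\Upsilon_L^{(n)}(s_-),$$ that is, the lowest $4n$ coefficients of the $n$-th unreduced colored Jones polynomial of $L$ agree, up to a common sign, with those of the $n$-colored $B$-state of $L$.
   Context: Skein module. $\mathcal{S}(S^2)$ is the Kauffman bracket skein module over $\mathbb{Q}(A)$: $\mathbb{Q}(A)$-linear combinations of link diagrams on $S^2$ modulo the Kauffman relations: (i) a crossing equals $A$ times its $A$-smoothing plus $A^{-1}$ times its $B$-smoothing (this fixes which smoothing is called $A$ and which $B$); (ii) $D\sqcup\bigcirc=-(A^2+A^{-2})D$. It is identified with $\mathbb{Q}(A)$ via the Kauffman bracket, the empty diagram being sent to $1$. Elements of $\mathbb{Q}(A)$ are expanded as Laurent series in $A$ with finitely many negative powers. Jones-Wenzl idempotent. $TL_n$ is the $n$-th Temperley-Lieb algebra (the relative skein module of a rectangle with $n$ points on top and $n$ on the bottom, loop value $-A^2-A^{-2}$), and $f^{(n)}\in TL_n$ is the Jones-Wenzl idempotent: the nonzero idempotent annihilated by every cap or cup joining two adjacent points ($f^{(0)}$ is the empty tangle, $f^{(1)}$ the identity strand). Colored Jones polynomial. For a link diagram $L$, $\tilde{J}_{n,L}(A)$ is the skein element obtained by replacing every component of $L$ by $n$ parallel (blackboard) copies with $f^{(n)}$ inserted, evaluated in $\mathbb{Q}(A)$. A change of framing only multiplies the result by $\pm A^{m}$, so the framing is irrelevant for the statements about coefficients. Colored states. Label the crossings of $L$ by $1,\dots,k$.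 An $n$-colored state is a function $s:\{1,\dots,k\}\to\{-1,+1\}$; $s_-$ is the constant function $-1$. The skein element $\Upsilon_L^{(n)}(s)$ is obtained from the $n$-cabled diagram of $L$ (with $f^{(n)}$ on the components) by replacing the cabled crossing at each crossing $i$ by its $n$-colored $A$-smoothing if $s(i)=+1$ and its $n$-colored $B$-smoothing if $s(i)=-1$. The $n$-colored $A$- (resp. $B$-) smoothing of a crossing is the following: $f^{(n)}$ is placed on each of the four ends of the crossing. At each end one of the $n$ strands is singled out, namely the outermost strand bordering the region, among the two regions at that end, that is not merged by the ordinary $A$- (resp. $B$-) smoothing. These four single strands are joined by two arcs in the pattern of the ordinary $A$- (resp. $B$-) smoothing, meeting nothing else. The remaining $n-1$ strands at each end form the $(n-1)$-parallel of the original crossing, lying between the two arcs. For $n=1$ these are the ordinary smoothings. $\Upsilon_L^{(n)}(s_-)$ is called the $n$-colored $B$-state. Notation $\doteq_m$. For nonzero Laurent series $P_1,P_2$ in $A$, $P_1\doteq_{m}P_2$ means that the first $m$ coefficients of $P_1$ and $P_2$ (those of $m$ consecutive powers of $A$, zeros included, starting from the respective minimum degree) coincide up to a common sign. Equivalently, after multiplying each by a suitable $\pm A^{r}$ so that it becomes a power series with nonzero constant term, the two agree modulo $A^{m}$. *)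

(* Defs.v *)
From HB Require Import structures.
From mathcomp Require Import all_boot all_order all_algebra.

Set Implicit Arguments.
Unset Strict Implicit.
Unset Printing Implicit Defensive.

Import GRing.Theory.
Local Open Scope ring_scope.

(** * Laurent series of rational functions *)

(** The field Q(A). *)
Notation QA := {fraction {poly rat}}.

Definition varA : QA := tofrac 'X.

(** The value of a circle. *)
Definition delta : QA := - (varA ^+ 2) - varA ^- 2.

(** [P] is the rational function whose expansion at [A = 0] is the power series
    [c 0 + c 1 A + c 2 A^2 + ...]; equivalently [q * c = p] as power series,
    where [P = p / q] and [q] does not vanish at 0. *)
Definition expands (P : QA) (c : nat -> rat) : Prop :=
  exists p q : {poly rat},
    [/\ q`_0 != 0, P = tofrac p / tofrac q &
        forall i, p`_i = \sum_(j < i.+1) q`_j * c (i - j)%N].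

Definition doteq (m : nat) (P1 P2 : QA) : Prop :=
  exists (r1 r2 : int) (c1 c2 : nat -> rat) (e : bool),
    [/\ expands (varA ^ r1 * P1) c1, expands (varA ^ r2 * P2) c2,
        c1 0%N != 0, c2 0%N != 0 &
        forall i, (i < m)%N -> c1 i = (-1) ^+ e * c2 i].

(** * Skein elements

    A crossingless diagram in a disc with set [B] of boundary points is, up to
    circles, determined by the way it pairs the points of [B]; circles are
    evaluated to [delta].  An element of the relative skein module of the disc is
    written in the basis of these diagrams, as a function sending a pairing to its
    coefficient.  Pairings are self-maps of [B]; self-maps that are not planar
    fixed-point-free involutions only ever get the coefficient 0. *)
Notation pairing B := {ffun B -> B}.
Notation skein B := {ffun pairing B -> QA}.

Definition basis (B : finType) (m : pairing B) : skein B :=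
  [ffun m' => (m' == m)%:R].

(** Disjoint unions of skein elements. *)
Definition juxt_pairing (B C : finType) (m : pairing B) (m' : pairing C) :
    pairing (B + C)%type :=
  [ffun z => match z with inl x => inl (m x) | inr y => inr (m' y) end].

Definition juxt (B C : finType) (x : skein B) (y : skein C) :
    skein (B + C)%type :=
  [ffun m => \sum_(u : pairing B * pairing C | juxt_pairing u.1 u.2 == m)
               x u.1 * y u.2].

Definition family_pairing (T B : finType) (mu : {ffun T -> pairing B}) :
    pairing (T * B)%type :=
  [ffun z => (z.1, mu z.1 z.2)].

Definition family (T B : finType) (x : T -> skein B) : skein (T * B)%type :=
  [ffun m => \sum_(mu : {ffun T -> pairing B} | family_pairing mu == m)
               \prod_t x t (mu t)].

(** Gluing: the points of [I] are the boundary points of inner discs, the points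
    of [O] those of an outer disc, and [w] tells which pairs of points are joined
    by an arc lying between the inner discs and the outer one ([w] need only hold
    for one of the two orders of the pair).  Once the inner discs are filled in
    according to [m], the components of the graph on [I + O] are the arcs with
    end points in [O] and the circles, which do not meet [O]. *)
Section Glue.

Variables (I O : finType) (w : rel (I + O)%type).

Definition glue_rel (m : pairing I) : rel (I + O)%type :=
  [rel u v | [|| w u v, w v u |
    match u, v with inl x, inl y => m x == y | _, _ => false end]].

Definition glue_pairing (m : pairing I) : pairing O :=
  [ffun o => odflt o
     [pick o' | (o' != o) && connect (glue_rel m) (inr o) (inr o')]].

Definition glue_circles (m : pairing I) : nat :=
  n_comp (glue_rel m)
    [pred u | [forall o, ~~ connect (glue_rel m) u (inr o)]].

Definition glue (x : skein I) : skein O :=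
  [ffun m' => \sum_(m : pairing I | glue_pairing m == m')
                x m * delta ^+ glue_circles m].

End Glue.

(** Gluing with nothing outside, the empty diagram being sent to 1. *)
Definition bracket (I : finType) (w : rel (I + void)%type) (x : skein I) : QA :=
  glue w x [ffun v => v].

(** * Temperley-Lieb algebra and Jones-Wenzl idempotent

    [inl i] is the [i]-th point on top and [inr i] the [i]-th point on the bottom
    of a rectangle, both counted from the left. *)
Notation tl_points n := ('I_n + 'I_n)%type.

(** Position on the boundary, clockwise from the top left corner. *)
Definition tl_pos (n : nat) (u : tl_points n) : nat :=
  match u with inl i => i | inr j => (n + n - j.+1)%N end.

Definition tl_diagram (n : nat) (m : pairing (tl_points n)) : Prop :=
  [/\ involutive m, forall u, m u != u &
      forall u v, ~~ [&& tl_pos u < tl_pos v, tl_pos v < tl_pos (m u) &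
                         tl_pos (m u) < tl_pos (m v)]%N].

Definition in_TL (n : nat) (x : skein (tl_points n)) : Prop :=
  forall m, x m != 0 -> tl_diagram m.

Definition tl_id (n : nat) : skein (tl_points n) :=
  basis [ffun u => match u with inl i => inr i | inr i => inl i end].

(** [tl_mul x y] is [x] stacked on top of [y]. *)
Definition tl_mul_wire (n : nat) :
    rel (tl_points n + tl_points n + tl_points n)%type := fun u v =>
  match u, v with
  | inr (inl p), inl (inl (inl q)) => p == q
  | inl (inl (inr p)), inl (inr (inl q)) => p == q
  | inl (inr (inr p)), inr (inr q) => p == q
  | _, _ => false
  end.

Definition tl_mul (n : nat) (x y : skein (tl_points n)) : skein (tl_points n) :=
  glue (@tl_mul_wire n) (juxt x y).

(** Joining the boundary points [a] and [b] by an arc. *)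
Definition cap_wire (B : finType) (a b : B) :
    rel (B + {c : B | c \notin [:: a; b]})%type := fun u v =>
  match u, v with
  | inl x, inl y => (x == a) && (y == b)
  | inl x, inr c => x == val c
  | _, _ => false
  end.

Definition cap_off (B : finType) (a b : B) (x : skein B) :
    skein {c : B | c \notin [:: a; b]} :=
  glue (@cap_wire B a b) x.

Definition jones_wenzl (n : nat) (f : skein (tl_points n)) : Prop :=
  [/\ in_TL f, f != 0, tl_mul f f = f &
      forall a b : 'I_n, b = a.+1 :> nat ->
        cap_off (inl a) (inl b) f = 0 /\ cap_off (inr a) (inr b) f = 0].

Definition closure_wire (n : nat) : rel (tl_points n + void)%type := fun u v =>
  match u, v with inl (inl p), inl (inr q) => p == q | _, _ => false end.

Definition tl_closure (n : nat) (x : skein (tl_points n)) : QA :=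
  bracket (@closure_wire n) x.

(** * Link diagrams

    The four ends of a crossing are numbered counterclockwise by ['I_4]; ends 0
    and 2 belong to the lower strand, 1 and 3 to the upper one.  A diagram is
    given by the involution joining the ends of crossings along its edges,
    together with the number of its components without crossings.  (The position
    on the sphere of the connected components of the diagram relative to each
    other is not recorded: the bracket does not depend on it, nor does the
    property of being alternating or reduced.) *)
Definition dart (k : nat) : finType := ('I_k * 'I_4)%type.

Definition turn (k : nat) (d : dart k) : dart k := (d.1, d.2 + 1).
Definition across (k : nat) (d : dart k) : dart k := (d.1, d.2 + 1 + 1).

(** The orbits of [turn \o edge] are the faces: [d] stands for the region between
    [d] and the end preceding [d] at its crossing.  [diagram_planar] is Euler's
    formula, saying that each connected component lies on a sphere. *)
Record link_diagram := LinkDiagram {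
  crossings : nat;
  circles : nat;
  edge : dart crossings -> dart crossings;
  edgeK : involutive edge;
  edge_neq : forall d, edge d != d;
  diagram_planar :
    fcard (@turn crossings \o edge) predT =
    (crossings +
     2 * n_comp [rel d d' | (d' == edge d) || (d' == turn d)] predT)%N
}.

Definition alternating (L : link_diagram) : Prop :=
  forall d : dart (crossings L), odd (edge d).2 != odd d.2.

(** No crossing is nugatory, that is, no circle on the sphere meets the diagram
    only in a crossing, where it passes from a region to the opposite one. *)
Definition reduced (L : link_diagram) : Prop :=
  forall d : dart (crossings L),
    ~~ fconnect (@turn (crossings L) \o @edge L) d (across d).

(** Darts on the same link component (passing straight through crossings). *)
Definition component_rel (L : link_diagram) : rel (dart (crossings L)) :=
  [rel d d' | (d' == edge d) || (d' == across d)].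

(** * Cabled crossings and their colored smoothings

    A smoothing is [true] for A (+1) and [false] for B (-1).  The A-smoothing
    merges the two regions swept by the upper strand when it is turned
    counterclockwise, i.e. the ones between ends 1 and 2 and between 3 and 0.
    [follows s a] says that the region at [a] that is not merged by the smoothing
    [s] comes after [a] in counterclockwise order. *)
Definition follows (s : bool) (a : 'I_4) : bool := s == ~~ odd a.

Definition smoothing (s : bool) : pairing 'I_4 :=
  [ffun a => if follows s a then a + 1 else a - 1].

Definition crossing : skein 'I_4 :=
  [ffun m => varA * basis (smoothing true) m + varA^-1 * basis (smoothing false) m].

(** The [n]-parallel of a crossing: point [(a, p)] is the [p]-th strand at the end
    [a], the strands of an end being numbered counterclockwise.  Ends 0, 1, 2, 3
    are put in the south, east, north and west, and the crossing [(x, y)] of the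
    [n * n] grid is the one in column [x] (from the west) and row [y] (from the
    south). *)
Definition grid_wire (n : nat) :
    rel (('I_n * 'I_n) * 'I_4 + 'I_4 * 'I_n)%type := fun u v =>
  match u, v with
  | inl ((x, y), a), inl ((x', y'), b) =>
      [&& val a == 2, val b == 0, x == x' & val y' == y.+1]
   || [&& val a == 1, val b == 3, y == y' & val x' == x.+1]
  | inl ((x, y), a), inr (b, p) =>
      (a == b) &&
      match val a with
      | 0 => (x == p) && (val y == 0)
      | 1 => (y == p) && (x.+1 == n)
      | 2 => (x == rev_ord p) && (y.+1 == n)
      | _ => (y == rev_ord p) && (val x == 0)
      end
  | _, _ => false
  end%N.

Definition cabled_crossing (n : nat) : skein ('I_4 * 'I_n)%type :=
  glue (@grid_wire n) (family (fun _ : 'I_n * 'I_n => crossing)).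

(** The [n]-colored smoothing: [f] sits on each of the four ends, its bottom
    facing outwards; of the [n] strands of the end [a] the one with number
    [outer_strand n s a] follows the ordinary smoothing, the other ones form the
    [n.-1]-parallel of the crossing. *)
Definition outer_strand (n : nat) (s : bool) (a : 'I_4) : nat :=
  if follows s a then n.-1 else 0%N.

Definition colored_wire (n : nat) (s : bool) :
    rel ('I_4 + 'I_4 * 'I_n.-1 + 'I_4 * tl_points n + 'I_4 * 'I_n)%type :=
  fun u v => match u, v with
  | inr (a, p), inl (inr (b, inr q)) => (a == b) && (p == q)
  | inl (inr (a, inl p)), inl (inl (inl b)) =>
      (a == b) && (val p == outer_strand n s a)
  | inl (inr (a, inl p)), inl (inl (inr (b, q))) =>
      (a == b) && (val p == bump (outer_strand n s a) q)
  | _, _ => false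
  end.

Definition colored_smoothing (n : nat) (f : skein (tl_points n)) (s : bool) :
    skein ('I_4 * 'I_n)%type :=
  glue (@colored_wire n s)
    (juxt (juxt (basis (smoothing s)) (cabled_crossing n.-1))
          (family (fun _ : 'I_4 => f))).

(** * Colored Jones polynomial and colored states

    [cable_eval f x] is the value of the [n]-parallel of [L] with [f] inserted
    once on every component and with [x i] in place of the crossing [i].  Next to
    each dart there is a box, with its top facing the crossing; it is filled with
    [f] for one dart on each component and with the identity otherwise. *)
Section CableEval.

Variables (L : link_diagram) (n : nat) (f : skein (tl_points n)).

Definition cable_wire :
    rel ('I_(crossings L) * ('I_4 * 'I_n)
         + dart (crossings L) * tl_points n + void)%type := fun u v =>
  match u, v with
  | inl (inl (i, (a, p))), inl (inr (d, inl q)) => ((i, a) == d) && (p == q)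
  | inl (inr (d, inr p)), inl (inr (d', inr q)) =>
      (d' == edge d) && (q == rev_ord p)
  | _, _ => false
  end.

Definition cable_box (d : dart (crossings L)) : skein (tl_points n) :=
  if d \in roots (@component_rel L) then f else tl_id n.

Definition cable_eval (x : 'I_(crossings L) -> skein ('I_4 * 'I_n)%type) : QA :=
  bracket cable_wire (juxt (family x) (family cable_box))
  * tl_closure f ^+ circles L.

Definition colored_jones : QA := cable_eval (fun _ => cabled_crossing n).

Definition colored_state (s : 'I_(crossings L) -> bool) : QA :=
  cable_eval (fun i => colored_smoothing f (s i)).

Definition state_minus : 'I_(crossings L) -> bool := fun _ => false.

End CableEval.

Arguments state_minus L : clear implicits.

(* Main.v *)
(** The bracket of a cabled diagram is a sum over the smoothings of its crossings and
    over the diagrams filling its boxes, each state contributing a power of [delta]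
    given by the number of components of a graph.  Since [f] kills caps, it may be
    inserted at every end of every crossing of the cable; smoothing then the crossings
    of a grid one at a time along two of its sides, all the mixed states that come up
    contain a cap which slides through the rest of the grid and is killed by [f].
    Hence the cable is the sum, over the [2 ^ k] colored states, of a power of [A]
    times the colored state.

    The order of a colored state is bounded below by counting components.  The cap
    relations for [f] bound the order of the coefficients of [f] by the number of
    components they create, so only the state with identities in the boxes matters.
    In the all-B state no strand is nugatory, the diagram being alternating and
    reduced: the strands are told apart by the faces that they run along and by their
    depth.  Changing [p] crossings to A changes at least [(2n-1)p] smoothings, but,
    once the grids are collapsed, only [p] smoothings of the collapsed diagram, the first
    of which merges two components: the order increases by at least
    [2(2n-1)p - 2(p-2) >= 4n]. *)

From HB Require Import structures.
From mathcomp Require Import all_boot all_order all_algebra generic_quotient.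
From mathcomp Require Import zify ring.
Require Import Defs.

Set Implicit Arguments.
Unset Strict Implicit.
Unset Printing Implicit Defensive.

Import Order.TTheory GRing.Theory Num.Theory.

(** * Components of finite graphs *)

Section Linked.
Variable V : finType.
Implicit Type e : rel V.

(** No isotopy is performed. A state is a finite graph on the ends of crossings and boxes, a circle
    is a component, and skein relations become identities between numbers of components; a
    Reidemeister II move trades two crossings for the nonplanar pairing [straight], which a count of
    components does not notice. The colored states are realised inside the grids, by smoothing one
    row and one column, so the cable and its states share the wiring [cabled_wire]; only the all-B
    state is compared with the definition of the colored smoothing, since the others need only a
    bound on their order. The obstacle is the size of the coefficients of [f]: the cap relation may
    lead to diagrams with more circles than the one it starts from, so a plain induction does not
    terminate. Finiteness gives a crude common bound, and the relation improves it by one at a time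
    until it is sharp. The same estimate shows that the identity has coefficient 1 in [f]: it cannot
    vanish, and squaring [f] multiplies its trace, again nonzero, by this coefficient. *)

Definition symrel e : rel V := fun x y => e x y || e y x.
Arguments symrel e x y /.
Definition linked e : rel V := connect (symrel e).
Definition ncomp e : nat := n_comp (symrel e) predT.

Lemma symrel_sym e : connect_sym (symrel e).
Proof. by apply: sym_connect_sym => x y; apply: orbC. Qed.

Lemma linkedC e x y : linked e x y = linked e y x.
Proof. exact: symrel_sym. Qed.

Lemma linked0 e x : linked e x x. Proof. exact: connect0. Qed.

Lemma linked1 e x y : e x y -> linked e x y.
Proof. by move=> exy; apply: connect1; rewrite /= exy. Qed.

Lemma linked1r e x y : e y x -> linked e x y.
Proof. by rewrite linkedC; apply: linked1. Qed.

Lemma linked_trans e y x z : linked e x y -> linked e y z -> linked e x z.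
Proof. exact: connect_trans. Qed.

Lemma linked_ind e (P : V -> Prop) x :
  P x -> (forall y z, symrel e y z -> P y -> P z) -> forall y, linked e x y -> P y.
Proof.
move=> Px PS y /connectP[p e_p ->]; elim: p x Px e_p => //= z p IHp x Px.
by case/andP=> exz; apply/IHp/(PS _ _ exz).
Qed.

Lemma linked_inv e (A : Type) (f : V -> A) x y :
  (forall x y, e x y -> f x = f y) -> linked e x y -> f x = f y.
Proof.
move=> fe; move: y; apply: linked_ind => // y z /orP[/fe->|/fe<-] //.
Qed.

End Linked.
Arguments symrel [V] e x y /.
Arguments linked_trans {V e y x z}.
#[export] Hint Resolve linked0 : core.

Section LinkedMaps.
Variables V V' : finType.

Lemma linked_map (e : rel V) (e' : rel V') (h : V -> V') x y :
  (forall x y, e x y -> linked e' (h x) (h y)) ->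
  linked e x y -> linked e' (h x) (h y).
Proof.
move=> he; move: y; apply: linked_ind => // y z /orP[/he|/he]; last rewrite linkedC.
  by move=> h1 h2; apply: linked_trans h1.
by move=> h1 h2; apply: linked_trans h1.
Qed.

End LinkedMaps.

(** [h] induces a map from the components of [e'] to those of [e], and the first hypothesis makes it
    onto. Many equalities of component counts below come from two such maps in opposite directions,
    so that no bijection has to be built. *)
Lemma ncomp_le (V V' : finType) (e : rel V) (e' : rel V') (h : V' -> V) :
  (forall v, exists v', linked e v (h v')) ->
  (forall x y, e' x y -> linked e (h x) (h y)) -> ncomp e <= ncomp e'.
Proof.
move=> hs he; pose r := fingraph.root (symrel e); pose r' := fingraph.root (symrel e').
apply: leq_trans (leq_image_card (r \o h) _); apply/subset_leq_card/subsetP.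
move=> v /andP[/eqP rv _]; have [v' lv] := hs v.
apply/imageP; exists (r' v'); first by rewrite !inE /= roots_root //; apply: symrel_sym.
rewrite /= -rv; apply/(fingraph.rootP (@symrel_sym _ e)).
by apply: (linked_trans lv); apply: (linked_map he); apply: connect_root.
Qed.

Section AddEdge.
Variable V : finType.
Implicit Type e : rel V.

Lemma linked_sub e e' x y :
  (forall x y, e x y -> linked e' x y) -> linked e x y -> linked e' x y.
Proof. exact: (@linked_map _ _ e e' id). Qed.

Lemma ncomp_sub e e' : (forall x y, e x y -> linked e' x y) -> ncomp e' <= ncomp e.
Proof. by move=> ee'; apply: (@ncomp_le _ _ _ _ id) => // v; exists v. Qed.

Lemma eq_ncomp e e' : (forall x y, e x y -> linked e' x y) ->
  (forall x y, e' x y -> linked e x y) -> ncomp e = ncomp e'.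
Proof. by move=> h h'; apply/eqP; rewrite eqn_leq !ncomp_sub. Qed.

Definition add_edge e a b : rel V := fun x y => e x y || (x == a) && (y == b).
Arguments add_edge e a b x y /.

Lemma linked_add_edge e a b x y : linked e x y -> linked (add_edge e a b) x y.
Proof. by apply: linked_sub => u v euv; apply: linked1; rewrite /= euv. Qed.

Lemma linked_new_edge e a b : linked (add_edge e a b) a b.
Proof. by apply: linked1; rewrite /= !eqxx orbT. Qed.

Lemma linked_add_edgeP e a b x y : linked (add_edge e a b) x y ->
  [\/ linked e x y, linked e a x /\ linked e b y | linked e b x /\ linked e a y].
Proof.
have st u v : symrel (add_edge e a b) u v ->
    [\/ linked e u v, u = a /\ v = b | u = b /\ v = a].
  case/orP=> /orP[].
  - by move/linked1; constructor 1.
  - by case/andP=> /eqP-> /eqP->; constructor 2.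
  - by move/linked1r; constructor 1.
  - by case/andP=> /eqP-> /eqP->; constructor 3.
move: y; apply: linked_ind; first by constructor 1.
move=> y z /st yz IH.
case: yz IH => [yz [xy|[ax by_]|[bx ay]]|[-> ->] [xy|[ax by_]|[bx ay]]|[-> ->] [xy|[ax by_]|[bx ay]]].
- by constructor 1; apply: linked_trans xy yz.
- by constructor 2; split=> //; apply: linked_trans by_ yz.
- by constructor 3; split=> //; apply: linked_trans ay yz.
- by constructor 2; rewrite linkedC.
- by constructor 2.
- by constructor 1; rewrite linkedC.
- by constructor 3; rewrite linkedC.
- by constructor 1; rewrite linkedC.
- by constructor 3.
Qed.

(** Only the components of [a] and [b] are affected: on their union the count drops from two to one
    when they differ, and outside it the two graphs agree. *)
Lemma ncomp_add_edge e a b : ncomp (add_edge e a b) + ~~ linked e a b = ncomp e.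
Proof.
set e' := add_edge e a b.
have [lab|nlab] := boolP (linked e a b).
  rewrite addn0; apply: eq_ncomp => x y; last by move=> /linked1/(linked_add_edge a b).
  by case/orP=> [/linked1|/andP[/eqP-> /eqP->]].
pose C : pred V := closure (symrel e) (pred2 a b).
have inC x : (x \in C) = linked e x a || linked e x b.
  apply/pred0Pn/orP=> [[z /andP[/= lz /pred2P[]] E]|[lz|lz]].
  - by left; rewrite -E.
  - by right; rewrite -E.
  - by exists a; rewrite !inE eqxx andbT.
  - by exists b; rewrite !inE eqxx orbT andbT.
have inC' x : (x \in C) = (x \in closure (symrel e') (pred2 a b)).
  apply/idP/idP=> [|/pred0Pn[z /andP[/= lz zab]]].
    rewrite inC => lx; apply/pred0Pn.
    case/orP: lx => /(linked_add_edge a b) lx; [exists a|exists b];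
       rewrite !inE eqxx ?orbT ?andbT; exact: lx.
  rewrite inC; move: zab; rewrite !inE => zab.
  case: (linked_add_edgeP lz) => [lxz|[ax bz]|[bx az]].
  - by case/orP: zab lxz => /eqP-> ->; rewrite ?orbT.
  - by rewrite (linkedC e x) ax.
  - by rewrite (linkedC e x b) bx orbT.
have clC : closed (symrel e) C by apply/closure_closed/symrel_sym.
have clC' : closed (symrel e') C.
  by move=> x y exy; rewrite !inC'; apply: (closure_closed (@symrel_sym _ e')) exy.
rewrite /ncomp (n_compC C (symrel e)) (n_compC C (symrel e')).
have -> : n_comp (symrel e) C = 2.
  by rewrite (n_comp_closure2 (@symrel_sym _ e)) -/(linked e a b) (negbTE nlab).
have -> : n_comp (symrel e') C = 1.
  rewrite (eq_n_comp_r inC') (n_comp_closure2 (@symrel_sym _ e')).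
  by rewrite -/(linked e' a b) linked_new_edge.
have -> : n_comp (symrel e') [predC C] = n_comp (symrel e) [predC C].
  apply/esym/(adjunction_n_comp id (@symrel_sym _ e) (@symrel_sym _ e')).
    exact: predC_closed.
  split=> [x _|x y]; first by exists x.
  rewrite inE inC negb_or => /andP[nxa nxb].
  apply/idP/idP=> [/linked_add_edgeP[//|[ax _]|[bx _]]|/(linked_add_edge a b) //].
    by rewrite linkedC ax in nxa.
  by rewrite (linkedC e x b) bx in nxb.
by rewrite addnC addnA.
Qed.

Lemma ncomp_add_edge_ge e a b : ncomp e <= (ncomp (add_edge e a b)).+1.
Proof. by rewrite -(ncomp_add_edge e a b); case: linked; rewrite ?addn0 ?addn1. Qed.

(** Adding the edge from [a] to [b] to the graph on the left loses at most one component. It then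
    links [a], [b], [c] and [d], so the graph on the right has at least as many components. *)
Lemma ncomp_surgery e a b c d :
  ncomp (add_edge (add_edge e a c) b d) <= (ncomp (add_edge (add_edge e a b) c d)).+1.
Proof.
set e1 := add_edge (add_edge e a c) b d.
apply: leq_trans (ncomp_add_edge_ge e1 a b) _; rewrite ltnS.
apply: ncomp_sub => x y /= exy.
have lab : linked (add_edge e1 a b) a b by apply: linked_new_edge.
have lac : linked (add_edge e1 a b) a c.
  by do 2 apply: linked_add_edge; apply: linked_new_edge.
have lbd : linked (add_edge e1 a b) b d.
  by apply: linked_add_edge; apply: linked_new_edge.
case/orP: exy => [/orP[exy|/andP[/eqP-> /eqP->] //]|/andP[/eqP-> /eqP->]].
  by do 3 apply: linked_add_edge; apply: linked1.
by apply: linked_trans lbd; apply: linked_trans lab; rewrite linkedC.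
Qed.

(** The edges from [a] to [b] and from [c] to [d] are redundant, their ends being linked in [e]. Of
    the two edges that replace them one joins two components, and the other is then redundant. *)
Lemma ncomp_merge e a b c d : linked e a b -> linked e c d ->
  ~~ linked (add_edge (add_edge e a b) c d) a c ->
  (ncomp (add_edge (add_edge e a c) b d)).+1 = ncomp (add_edge (add_edge e a b) c d).
Proof.
move=> lab lcd nac; rewrite -(ncomp_add_edge (add_edge (add_edge e a b) c d) a c) nac addn1.
congr _.+1; apply: eq_ncomp => x y /=.
  case/orP=> [/orP[/linked1 exy|/andP[/eqP-> /eqP->]]|/andP[/eqP-> /eqP->]].
  - by do 3 apply: linked_add_edge.
  - exact: linked_new_edge.
  - rewrite linkedC; apply: (@linked_trans _ _ c).
      by rewrite linkedC; do 3 apply: linked_add_edge.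
    apply: (@linked_trans _ _ a); first by rewrite linkedC; apply: linked_new_edge.
    by do 3 apply: linked_add_edge.
case/orP=> [/orP[/orP[/linked1 exy|/andP[/eqP-> /eqP->]]|/andP[/eqP-> /eqP->]]|/andP[/eqP-> /eqP->]].
- by do 2 apply: linked_add_edge.
- by do 2 apply: linked_add_edge.
- by do 2 apply: linked_add_edge.
- by apply: linked_add_edge; apply: linked_new_edge.
Qed.

End AddEdge.
Arguments add_edge [V] e a b x y /.

Lemma even_card_involution (V : finType) (f : V -> V) (S : {pred V}) :
  involutive f -> (forall x, x \in S -> f x != x) ->
  (forall x, x \in S -> f x \in S) -> ~~ odd #|S|.
Proof.
move=> fK fN fS; have finj := inv_inj fK.
rewrite -(@fcard_order_set _ f finj 2 S) ?muln2 ?odd_double //.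
  apply/subsetP => x Sx; rewrite inE; apply/eqP.
  have := @order_le_cycle _ f [:: x; f x] _ x.
  rewrite /= !inE !eqxx fK eqxx => /(_ isT isT) le2.
  case: order (order_gt0 f x) (iter_order finj x) le2 => [|[|[|]]] // _ /= fx.
  by case/eqP: (fN x Sx).
apply: intro_closed; first exact: fconnect_sym.
by move=> x y /eqP<- /fS.
Qed.

(* The component of [a] once the edge is removed would have both an even and an odd
   number of points. *)
Lemma no_bridge (V : finType) (W g : V -> V) (a : V) :
  involutive W -> (forall x, W x != x) -> involutive g -> (forall x, g x != x) ->
  linked [rel u v | (v == W u) || ((v == g u) && (u \notin [:: a; g a]))] a (g a).
Proof.
move=> WK WN gK gN; set e := [rel u v | _].
apply/negP => /negP nl.
pose S : pred V := linked e a.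
have evS : ~~ odd #|S|.
  apply: (even_card_involution WK) => // x; rewrite !inE => lx.
  by apply: linked_trans lx _; apply: linked1; rewrite /= eqxx.
suff : ~~ odd #|predD1 S a|.
  have aS : a \in S by exact: linked0.
  by move: evS; rewrite (cardD1 a S) aS /=; case: odd.
apply: (even_card_involution gK) => // x; rewrite !inE => /andP[nxa lx].
have nxga : x != g a by apply: contraNneq nl => <-.
rewrite (inv_eq gK) eq_sym eq_sym nxga /=.
by apply: linked_trans lx _; apply: linked1; rewrite /= !inE eqxx negb_or nxa nxga orbT.
Qed.

(** * Gluing discs along a partial matching *)

Definition functional_wiring (X : finType) (w : rel X) : Prop :=
  forall u v v', symrel w u v -> symrel w u v' -> v = v'.

Section GlueGraph.
Variables (I O : finType) (w : rel (I + O)%type).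
Hypothesis w_fun : functional_wiring w.
Variable m : pairing I.
Hypothesis mK : involutive m.

Let G := glue_rel w m.

Lemma glue_rel_sym : symmetric G.
Proof.
move=> u v; rewrite /G /glue_rel /=.
have -> : (match u with inl x => match v with inl y => m x == y | inr _ => false end
   | inr _ => false end) = (match v with inl x => match u with inl y => m x == y
   | inr _ => false end | inr _ => false end).
  by case: u v => [x|o] [y|o'] //; rewrite (can2_eq mK mK) eq_sym.
by rewrite orbCA.
Qed.

Lemma glue_csym : connect_sym G.
Proof. exact/sym_connect_sym/glue_rel_sym. Qed.

Let alpha (u : I + O) : I + O := match u with inl x => inl (m x) | inr o => inr o end.
Let beta (u : I + O) : I + O := odflt u [pick v | symrel w u v].

Let alphaK : involutive alpha. Proof. by case=> [x|o] //=; rewrite mK. Qed.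

Let betaP u v : symrel w u v -> beta u = v.
Proof.
rewrite /beta => uv; case: pickP => [v' uv'|/(_ v)]; last by rewrite uv.
exact: w_fun uv' uv.
Qed.

Let betaK : involutive beta.
Proof.
move=> u; rewrite {2}/beta; case: pickP => [v /= uv|nu]; first by apply: betaP; rewrite /= orbC.
by rewrite /= /beta; case: pickP => // v; rewrite nu.
Qed.

(* [alpha] and [beta] generate a dihedral group, whose orbits contain at most two
   fixed points of [alpha]. *)
Let q := alpha \o beta.
Let q_inj : injective q. Proof. exact: inj_comp (inv_inj alphaK) (inv_inj betaK). Qed.

Let alpha_q k o : alpha (iter k q (inr o)) = iter k (finv q) (inr o).
Proof.
elim: k => //= k <-; rewrite alphaK.
by apply: (q_inj); rewrite f_finv // /q /= betaK.
Qed.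

Let glue_orbit o v : connect G (inr o) v -> fconnect q (inr o) v.
Proof.
have st u : fconnect q (inr o) u -> fconnect q (inr o) (alpha u).
  move=> /iter_findex <-; rewrite alpha_q.
  by elim: findex => //= k IH; apply: connect_trans IH _; apply: fconnect_finv.
suff gen p y : fconnect q (inr o) y -> path G y p -> fconnect q (inr o) (last y p).
  by case/connectP=> p e_p ->; apply: gen e_p; apply: connect0.
elim: p y => //= z p IHp x qx /andP[exz]; apply: IHp.
case/or3P: exz => [xz|zx|].
- have <- : beta x = z by apply: betaP; rewrite /= xz.
  by rewrite -(alphaK (beta x)); apply: st; apply: connect_trans qx _; apply: fconnect1.
- have <- : beta x = z by apply: betaP; rewrite /= zx orbT.
  by rewrite -(alphaK (beta x)); apply: st; apply: connect_trans qx _; apply: fconnect1.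
case: x z qx => [x|//] [z|//] qx /eqP<-; exact: (st _ qx).
Qed.

(** This makes the choice in [glue_pairing] unambiguous. A second outer point at distance k from [o]
    on an orbit of [q] of length N is fixed by the reflection [alpha], which forces 2k = N and so
    determines it. *)
Lemma glue_at_most_two o o1 o2 : connect G (inr o) (inr o1) ->
  connect G (inr o) (inr o2) -> o1 != o -> o2 != o -> o1 = o2.
Proof.
have half o' : connect G (inr o) (inr o') -> o' != o ->
    (findex q (inr o) (inr o')).*2 = order q (inr o).
  move=> /glue_orbit oo' no; set k := findex _ _ _.
  have kN : k < order q (inr o) by apply: findex_max.
  have k0 : k != 0.
    by rewrite findex_eq0; apply: contra no => /eqP[->].
  have ko : iter k q (inr o) = inr o' by apply: iter_findex.
  have : iter (k + k) q (inr o) = inr o.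
    have := alpha_q k o; rewrite ko /= => E.
    by rewrite iterD ko E; elim: (k) => //= j IH; rewrite -iterS iterSr f_finv.
  rewrite addnn; case: (ltnP k.*2 (order q (inr o))) => [lt E|le].
    have := findex_iter lt; rewrite E findex0 => /eqP; rewrite eq_sym double_eq0.
    by rewrite (negbTE k0).
  rewrite -{1}(subnK le) iterD iter_order // => E.
  have lt : k.*2 - order q (inr o) < order q (inr o) by rewrite -addnn; lia.
  have := findex_iter lt; rewrite E findex0; move: le; lia.
move=> c1 c2 n1 n2; have e1 := half _ c1 n1; have e2 := half _ c2 n2.
have /double_inj ek : (findex q (inr o) (inr o1)).*2 = (findex q (inr o) (inr o2)).*2.
  by rewrite e1 e2.
have := iter_findex (glue_orbit c1); rewrite ek (iter_findex (glue_orbit c2)).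
by case.
Qed.

Lemma glue_pairingP o o' : o' != o -> connect G (inr o) (inr o') ->
  glue_pairing w m o = o'.
Proof.
move=> no oo'; rewrite ffunE; case: pickP => [o2 /andP[n2 c2]|/(_ o')].
  exact: glue_at_most_two c2 oo' n2 no.
by rewrite no /= oo'.
Qed.

Lemma glue_pairing_connect o : connect G (inr o) (inr (glue_pairing w m o)).
Proof.
by rewrite ffunE; case: pickP => [o2 /andP[n2 c2]|_] //=.
Qed.

End GlueGraph.

Section FlattenGlue.
Variables (T I O V : finType) (w : rel (I + O)%type) (e : rel V) (iota : T -> O -> V).
Variable mu : T -> pairing I.
Hypothesis w_fun : functional_wiring w.
Hypothesis w_out : forall o o', w (inr o) (inr o') = false.
Hypothesis muK : forall t, involutive (mu t).

Definition outer_graph : rel V := fun u v =>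
  e u v || [exists t, [exists o, (u == iota t o) && (v == iota t (glue_pairing w (mu t) o))]].

Definition flat_graph : rel (V + T * I)%type := fun u v =>
  match u, v with
  | inl u, inl v => e u v
  | inr (t, i), inr (t', i') => (t == t') && (w (inl i) (inl i') || (mu t i == i'))
  | inr (t, i), inl v =>
      [exists o, (w (inl i) (inr o) || w (inr o) (inl i)) && (v == iota t o)]
  | inl _, inr _ => false
  end.

Let H := symrel flat_graph.
Let G t := glue_rel w (mu t).
Let h t (u : I + O) : V + T * I :=
  match u with inl i => inr (t, i) | inr o => inl (iota t o) end.

Let Hsym : connect_sym H. Proof. exact: symrel_sym. Qed.
Let Gsym t : connect_sym (G t). Proof. exact/glue_csym. Qed.

Let h_edge t x y : G t x y -> connect H (h t x) (h t y).
Proof.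
suff one x' y' : w x' y' || match x', y' with inl i, inl j => mu t i == j | _, _ => false end ->
     connect H (h t x') (h t y').
  case/or3P=> [xy|yx|xy]; first by apply: one; rewrite xy.
    by rewrite Hsym; apply: one; rewrite yx.
  by apply: one; rewrite xy orbT.
case: x' y' => [i|o] [j|o'] /=.
- by move=> ij; apply: linked1; rewrite /= eqxx ij.
- rewrite orbF => io; apply: linked1; rewrite /=.
  by apply/existsP; exists o'; rewrite io eqxx.
- rewrite orbF => oi; apply: linked1r; rewrite /=.
  by apply/existsP; exists o; rewrite oi orbT eqxx.
- by rewrite w_out.
Qed.

Let h_connect t x y : connect (G t) x y -> connect H (h t x) (h t y).
Proof.
case/connectP=> p e_p ->; elim: p x e_p => //= z p IHp x /andP[xz /IHp].
by apply: connect_trans; apply: h_edge.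
Qed.

Let touches : pred (V + T * I) := fun x => [exists u, connect H x (inl u)].

Let touches_closed : closed H touches.
Proof.
apply: intro_closed; first exact: Hsym.
move=> x y xy /existsP[u xu]; apply/existsP; exists u.
by apply: connect_trans xu; rewrite Hsym; apply: connect1.
Qed.

Let outer_to_flat u v : linked outer_graph u v -> connect H (inl u) (inl v).
Proof.
apply: (@linked_map _ _ outer_graph flat_graph inl) => {u v} u v.
case/orP=> [uv|/existsP[t /existsP[o /andP[/eqP-> /eqP->]]]]; first exact: linked1.
exact: (h_connect (glue_pairing_connect w (mu t) o)).
Qed.

Let outer_link u (x : V + T * I) : Prop :=
  match x with
  | inl v => linked outer_graph u v
  | inr (t, i) => forall o, connect (G t) (inl i) (inr o) -> linked outer_graph u (iota t o)
  end.

Let flat_to_outer u x : connect H (inl u) x -> outer_link u x.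
Proof.
apply: (@linked_ind _ flat_graph (outer_link u)) => [|y z]; first exact: linked0.
have gp_link t o o' : connect (G t) (inr o) (inr o') -> linked outer_graph (iota t o) (iota t o').
  have [->//|no] := eqVneq o' o.
  move=> oo'; have <- := glue_pairingP w_fun (muK t) no oo'.
  by apply: linked1; rewrite /outer_graph; apply/orP; right; apply/existsP; exists t;
     apply/existsP; exists o; rewrite !eqxx.
have edge t i o : w (inl i) (inr o) || w (inr o) (inl i) -> connect (G t) (inl i) (inr o).
  by move=> io; apply: connect1; rewrite /G /glue_rel /= orbF.
have inner t i j : w (inl i) (inl j) || (mu t i == j) -> connect (G t) (inl i) (inl j).
  by move=> ij; apply: connect1; rewrite /G /glue_rel /=; case/orP: ij => ->; rewrite ?orbT.
case: y z => [v|[t i]] [v'|[t' i']]; rewrite /H /outer_link /=.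
- by case/orP=> [vv'|vv'] uv; apply: linked_trans uv _;
    [apply: linked1|apply: linked1r]; rewrite /outer_graph vv'.
- case/existsP=> o /andP[io /eqP->] uv o' io'.
  apply: linked_trans uv _; apply: gp_link; apply: connect_trans io'.
  by rewrite Gsym; apply: edge.
- by rewrite orbF => /existsP[o /andP[io /eqP->]]; apply; apply: edge.
- case/orP=> /andP[/eqP<- ij] IH o io; apply: IH; apply: connect_trans io.
    exact: inner.
  by rewrite Gsym; apply: inner.
Qed.

Let n_touching : n_comp H touches = ncomp outer_graph.
Proof.
rewrite (adjunction_n_comp inl Hsym (@symrel_sym _ outer_graph)) //.
  rewrite /ncomp; apply: eq_n_comp_r => u; rewrite !inE; apply/existsP; by exists u.
split=> [x xt|u v _].
  by apply/sigW/existsP.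
by apply/idP/idP => [/outer_to_flat //|/flat_to_outer].
Qed.

Let inner_part t : pred (V + T * I) := fun x =>
  ~~ touches x && (if x is inr (t', _) then t' == t else false).

Let inner_closed t : closed H (inner_part t).
Proof.
apply: intro_closed; first exact: Hsym.
move=> x y xy; rewrite !unfold_in => /andP[nx tx].
have ny : ~~ touches y by rewrite -[touches y]/(y \in touches) -(touches_closed xy).
rewrite ny /=.
case: y ny xy => [v|[t' i']] ny xy.
  by case/existsP: nx; exists v; apply: connect1.
case: x tx nx xy => [//|[t1 i]] /eqP-> nx; rewrite /H /=.
by case/orP=> /andP[/eqP-> _].
Qed.

Let n_inner t : n_comp H (inner_part t) = glue_circles w (mu t).
Proof.
have lift i x : ~~ touches (inr (t, i)) -> connect H (inr (t, i)) x ->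
    (match x return Prop with inl _ => False
     | inr (t', j) => t' = t /\ connect (G t) (inl i) (inl j) end).
  move=> nt; pose P (x : V + T * I) : Prop := match x with inl _ => False
    | inr (t', j) => t' = t /\ connect (G t) (inl i) (inl j) end.
  apply: (@linked_ind _ flat_graph P) => [|y z]; first by split.
  case: y z => [//|[t1 j]] [v|[t2 j']] jj' [e1 ij]; subst t1.
    case/existsP: nt; exists v; apply: connect_trans (connect1 jj').
    exact: (h_connect ij).
  have {jj'} [e2 jj'] : t2 = t /\ connect (G t) (inl j) (inl j').
    case/orP: jj' => /= /andP[/eqP<- jj']; split=> //; first last.
      rewrite Gsym; apply: connect1; rewrite /G /glue_rel /=.
      by case/orP: jj' => ->; rewrite ?orbT.
    by apply: connect1; rewrite /G /glue_rel /=; case/orP: jj' => ->; rewrite ?orbT.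
  by split=> //; apply: connect_trans jj'.
rewrite (adjunction_n_comp (h t) Hsym (Gsym t)); last 2 first.
- exact: inner_closed.
- split=> [[v|[t' i]]|[i|o] y]; rewrite !unfold_in.
  + by rewrite andbF.
  + by case/andP=> _ /eqP->; exists (inl i).
  + case/andP=> nt _; apply/idP/idP=> [/h_connect //|/(lift _ _ nt)].
    by case: y => [j|o] //= [].
  + by rewrite /= andbF.
rewrite /glue_circles -/(G t); apply: eq_n_comp_r => x.
rewrite !unfold_in; apply/idP/forallP => [|nx].
  case: x => [i|o]; rewrite ?andbF // => /andP[nt _] o.
  by apply: contra nt => /h_connect io; apply/existsP; exists (iota t o).
case: x nx => [i|o] nx; last by have := nx o; rewrite connect0.
rewrite /= /inner_part eqxx andbT; apply/existsP => -[u iu].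
suff [o io] : exists o, connect (G t) (inl i) (inr o) by case/negP: (nx o).
pose P (x : V + T * I) : Prop := match x with inl _ => exists o, connect (G t) (inl i) (inr o)
    | inr (t', j) => (exists o, connect (G t) (inl i) (inr o)) \/
        (t' = t /\ connect (G t) (inl i) (inl j)) end.
suff : P (inl u) by [].
move: (inl u : V + T * I) iu.
apply: (@linked_ind _ flat_graph P) => [|y z]; first by right.
case: y z => [v|[t1 j]] [v'|[t2 j']]; rewrite /P //=.
- by left.
- rewrite orbF => /existsP[o /andP[jo _]] [//|[t1t ij]].
  by exists o; apply: connect_trans ij _; apply: connect1; rewrite /G /glue_rel /= orbF.
- move=> jj' [|[t1t ij]]; first by left.
  subst t1; right.
  have {jj'} [e2 jj'] : t2 = t /\ connect (G t) (inl j) (inl j').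
    case/orP: jj' => /= /andP[/eqP<- jj']; split=> //; first last.
      rewrite Gsym; apply: connect1; rewrite /G /glue_rel /=.
      by case/orP: jj' => ->; rewrite ?orbT.
    by apply: connect1; rewrite /G /glue_rel /=; case/orP: jj' => ->; rewrite ?orbT.
  by split=> //; apply: connect_trans jj'.
Qed.

(** A component of the flattened graph either meets [V], and then corresponds to a component of
    [outer_graph], or stays inside one disc [t], where it is a circle counted by [glue_circles].
    This turns nested gluings into the components of a single graph. *)
Lemma ncomp_flat :
  ncomp flat_graph = (ncomp outer_graph + \sum_t glue_circles w (mu t))%N.
Proof.
rewrite /ncomp (n_compC touches) n_touching; congr (_ + _)%N.
under eq_bigr do rewrite -n_inner.
rewrite /n_comp_mem -sum1_card.
rewrite (eq_bigr (fun x => \sum_t (if x is inr (t', _) then t' == t : nat else 0)%N)); last first.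
  move=> [v|[t i]] /andP[_].
    by move/negP; case; apply/existsP; exists v; apply: connect0.
  by rewrite (bigD1 t) //= eqxx big1 ?addn0 // => t' /negbTE; rewrite eq_sym => ->.
rewrite exchange_big; apply: eq_bigr => t _ /=.
rewrite -sum1_card [LHS]big_mkcond [RHS]big_mkcond /=; apply: eq_bigr => x _.
rewrite !unfold_in /=; case: (fingraph.roots _ _) => //=.
rewrite -[x \in [predC _]]/(~~ touches x) -[x \in inner_part t]/(~~ touches x && _).
by case: (touches x) => //=; case: x => [//|[t' i]]; case: eqP.
Qed.

End FlattenGlue.

Local Open Scope ring_scope.

(** * State sums over families of discs *)

Section FamilySums.
Variable T : finType.

(** The state sum: each disc [t] independently takes a state [mu t] with coefficient [x t (mu t)],
    and [F] evaluates the resulting diagram. *)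
Definition fsum (X : finType) (x : T -> X -> QA) (F : {ffun T -> X} -> QA) : QA :=
  \sum_(mu : {ffun T -> X}) (\prod_t x t (mu t)) * F mu.

Definition update (X : Type) (x : T -> X) (t0 : T) (a : X) : T -> X :=
  fun t => if t == t0 then a else x t.

Definition fupdate (X : finType) (mu : {ffun T -> X}) (t0 : T) (a : X) : {ffun T -> X} :=
  [ffun t => if t == t0 then a else mu t].

Lemma eq_fsum (X : finType) (x x' : T -> X -> QA) (F F' : {ffun T -> X} -> QA) : x =2 x' ->
  (forall mu : {ffun T -> X}, (forall t, x t (mu t) != 0) -> F mu = F' mu) -> fsum x F = fsum x' F'.
Proof.
move=> xx' FF'; apply: eq_bigr => mu _.
rewrite -(eq_bigr _ (fun t _ => xx' t (mu t))).
have [/existsP[t /eqP xt]|nx] := boolP [exists t, x t (mu t) == 0].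
  by rewrite (bigD1 t) //= xt !mul0r.
rewrite FF' // => t; apply: contra nx => xt; by apply/existsP; exists t.
Qed.

Lemma fsum0 (X : finType) (x : T -> X -> QA) (F : {ffun T -> X} -> QA) :
  (forall mu : {ffun T -> X}, (forall t, x t (mu t) != 0) -> F mu = 0) -> fsum x F = 0.
Proof.
move=> F0; rewrite (@eq_fsum _ x x F (fun=> 0)) //.
by rewrite /fsum big1 // => mu _; rewrite mulr0.
Qed.

Lemma fsum_sum (X J : finType) (x : T -> X -> QA) (F : J -> {ffun T -> X} -> QA) :
  \sum_j fsum x (F j) = fsum x (fun mu => \sum_j F j mu).
Proof.
by rewrite exchange_big; apply: eq_bigr => mu _; rewrite mulr_sumr.
Qed.

Lemma fsumZ (X : finType) (x : T -> X -> QA) F c :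
  c * fsum x F = fsum x (fun mu => c * F mu).
Proof. by rewrite mulr_sumr; apply: eq_bigr => mu _; rewrite mulrCA. Qed.

(** Gluing, juxtaposition and families of families all produce the states of a disc as images under
    some [g] of states of smaller discs; they are the instances used below. *)
Lemma fsum_push (X U : finType) (g : T -> U -> X) (x : T -> X -> QA) (y : T -> U -> QA) F :
  (forall t a, x t a = \sum_(u | g t u == a) y t u) ->
  fsum x F = fsum y (fun nu => F [ffun t => g t (nu t)]).
Proof.
move=> xE; rewrite /fsum.
under eq_bigr => mu _.
  under eq_bigr => t _ do rewrite xE big_mkcond /=.
  rewrite bigA_distr_bigA mulr_suml.
  over.
rewrite exchange_big; apply: eq_bigr => nu _ /=.
rewrite (bigD1 [ffun t => g t (nu t)]) //= [X in _ + X]big1 ?addr0.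
  by congr (_ * _); apply: eq_bigr => t _; rewrite ffunE eqxx.
move=> mu nmu; suff /existsP[t nt] : [exists t, g t (nu t) != mu t].
  by rewrite (bigD1 t) //= (negbTE nt) !mul0r.
rewrite -negb_forall; apply: contra nmu => /forallP E; apply/eqP/ffunP => t.
by rewrite ffunE (eqP (E t)).
Qed.

Lemma fsum_pair (X Y : finType) (x : T -> X -> QA) (y : T -> Y -> QA) F :
  fsum (fun t u => x t u.1 * y t u.2) F =
  fsum x (fun mu => fsum y (fun nu => F [ffun t => (mu t, nu t)])).
Proof.
rewrite /fsum; under [RHS]eq_bigr do rewrite mulr_sumr.
rewrite pair_bigA /=.
rewrite (reindex (fun u : {ffun T -> X} * {ffun T -> Y} => [ffun t => (u.1 t, u.2 t)])) /=.
  apply: eq_bigr => -[mu nu] _ /=; rewrite mulrA -big_split /=; congr (_ * _).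
  by apply: eq_bigr => t _; rewrite ffunE.
exists (fun v : {ffun T -> X * Y} => ([ffun t => (v t).1], [ffun t => (v t).2])) => /=.
  by move=> [mu nu] _ /=; congr (_, _); apply/ffunP => t; rewrite !ffunE.
by move=> v _; apply/ffunP => t; rewrite !ffunE; case: (v t).
Qed.

(* Summing over the state of [t0] first; [a0] is an arbitrary placeholder state. *)
Lemma fsum_int (X : finType) (x : T -> X -> QA) F t0 (a0 : X) :
  fsum x F = fsum (update x t0 (fun a => (a == a0)%:R))
                  (fun mu => \sum_a x t0 a * F (fupdate mu t0 a)).
Proof.
rewrite /fsum.
under [RHS]eq_bigr do rewrite mulr_sumr.
rewrite [RHS]exchange_big /= (partition_big (fun mu : {ffun T -> X} => mu t0) xpredT) //=.
apply: eq_bigr => a _.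
rewrite [RHS](bigID (fun mu : {ffun T -> X} => mu t0 == a0)) /= [X in _ + X]big1 ?addr0; last first.
  move=> mu /negbTE na; rewrite (bigD1 t0) //= /update eqxx na !mul0r //.
rewrite (reindex_onto (fun mu => fupdate mu t0 a) (fun mu => fupdate mu t0 a0)) /=; last first.
  move=> mu /eqP <-; apply/ffunP => t; rewrite !ffunE.
  by case: eqP => // ->.
apply: eq_big => [mu|mu]; rewrite !ffunE !eqxx /=.
  apply/eqP/eqP => [<-|E]; first by rewrite !ffunE eqxx.
  by apply/ffunP => t; rewrite !ffunE; case: eqP => // ->.
move=> /eqP E; have {}E : mu t0 = a0 by rewrite -E !ffunE eqxx.
rewrite mulrA; congr (_ * _).
rewrite (bigD1 t0) // [in RHS](bigD1 t0) //= !ffunE !eqxx /update eqxx E eqxx mul1r mulrC.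
congr (_ * _); apply: eq_bigr => t nt; by rewrite ffunE (negbTE nt).
Qed.

Lemma fsum_split (X : finType) (x y z : T -> X -> QA) F t0 :
  (forall a, x t0 a = y t0 a + z t0 a) ->
  (forall t, t != t0 -> y t =1 x t /\ z t =1 x t) ->
  fsum x F = fsum y F + fsum z F.
Proof.
move=> x0 xt; rewrite /fsum -big_split /=; apply: eq_bigr => mu _.
rewrite -mulrDl (bigD1 t0) //= x0 mulrDl; congr ((_ + _) * _).
  by rewrite [RHS](bigD1 t0) //=; congr (_ * _); apply: eq_bigr => t /xt[-> _].
by rewrite [RHS](bigD1 t0) //=; congr (_ * _); apply: eq_bigr => t /xt[_ ->].
Qed.

Lemma fsum_curry (G X : finType) (x : T -> G -> X -> QA) (F : {ffun T -> {ffun G -> X}} -> QA) :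
  fsum (fun t (mu : {ffun G -> X}) => \prod_g x t g (mu g)) F =
  \sum_(mu : {ffun T * G -> X}) (\prod_u x u.1 u.2 (mu u)) *
     F [ffun t => [ffun g => mu (t, g)]].
Proof.
rewrite /fsum (reindex (fun mu : {ffun T * G -> X} => [ffun t => [ffun g => mu (t, g)]])) /=.
  apply: eq_bigr => mu _; congr (_ * _).
  rewrite pair_bigA /=; apply: eq_bigr => -[t g] _ /=; by rewrite !ffunE.
exists (fun v : {ffun T -> {ffun G -> X}} => [ffun u => v u.1 u.2]).
  by move=> mu _; apply/ffunP=> -[t g]; rewrite !ffunE.
by move=> v _; apply/ffunP => t; apply/ffunP => g; rewrite !ffunE.
Qed.

End FamilySums.

Lemma fsum_curryE (T G X : finType) (x : T -> G -> X -> QA) (F : {ffun T -> {ffun G -> X}} -> QA) :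
  fsum (fun t (mu : {ffun G -> X}) => \prod_g x t g (mu g)) F =
  fsum (fun u : T * G => x u.1 u.2) (fun mu => F [ffun t => [ffun g => mu (t, g)]]).
Proof. exact: fsum_curry. Qed.

Lemma sum_family (T B : finType) (x : T -> skein B) (F : pairing (T * B) -> QA) :
  \sum_m family x m * F m = fsum (fun t => x t) (fun mu => F (family_pairing mu)).
Proof.
rewrite /fsum (partition_big (@family_pairing T B) xpredT) //=.
apply: eq_bigr => m _; rewrite ffunE mulr_suml.
by apply: eq_bigr => mu /eqP->.
Qed.

Lemma sum_juxt (B C : finType) (x : skein B) (y : skein C) (F : pairing (B + C) -> QA) :
  \sum_m juxt x y m * F m = \sum_u x u * \sum_v y v * F (juxt_pairing u v).
Proof.
under [RHS]eq_bigr do rewrite mulr_sumr.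
rewrite [RHS]pair_bigA /= (partition_big (fun u => juxt_pairing u.1 u.2) xpredT) //=.
apply: eq_bigr => m _; rewrite ffunE mulr_suml.
by apply: eq_bigr => -[u v] /= /eqP->; rewrite mulrA.
Qed.

Section FamilySkeins.
Variables T : finType.

Lemma fsum_glue (I O : finType) (w : rel (I + O)) (y : T -> skein I) F :
  fsum (fun t => glue w (y t)) F =
  fsum (fun t => y t) (fun mu => delta ^+ (\sum_t glue_circles w (mu t)) *
                         F [ffun t => glue_pairing w (mu t)]).
Proof.
rewrite (@fsum_push _ _ _ (fun=> @glue_pairing I O w) _
  (fun t m => y t m * delta ^+ glue_circles w m)); last by move=> t a; rewrite ffunE.
rewrite /fsum; apply: eq_bigr => mu _; rewrite big_split /= -mulrA; congr (_ * (_ * _)).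
by elim/big_ind2: _ => [|a b c d -> ->|t _]; rewrite ?expr0 ?exprD.
Qed.

Lemma fsum_juxt (B C : finType) (x : T -> skein B) (y : T -> skein C) F :
  fsum (fun t => juxt (x t) (y t)) F =
  fsum (fun t => x t) (fun mu => fsum (fun t => y t) (fun nu =>
     F [ffun t => juxt_pairing (mu t) (nu t)])).
Proof.
rewrite (@fsum_push _ _ _ (fun t (u : pairing B * pairing C) => juxt_pairing u.1 u.2) _
  (fun t u => x t u.1 * y t u.2)); last by move=> t a; rewrite ffunE.
rewrite (fsum_pair (fun t a => x t a) (fun t a => y t a));
apply: eq_bigr => mu _; congr (_ * _); apply: eq_bigr => nu _; congr (_ * F _).
by apply/ffunP => t; rewrite !ffunE.
Qed.

Lemma fsum_family (G B : finType) (x : T -> G -> skein B) F :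
  fsum (fun t => family (x t)) F =
  fsum (fun u : T * G => x u.1 u.2) (fun mu =>
    F [ffun t => family_pairing [ffun g => mu (t, g)]]).
Proof.
rewrite (@fsum_push _ _ _ (fun t => @family_pairing G B) _
  (fun t mu => \prod_g x t g (mu g))); last by move=> t a; rewrite ffunE.
rewrite (fsum_curryE (fun t g (a : pairing B) => x t g a)).
by apply: eq_bigr => mu _; congr (_ * F _); apply/ffunP => t; rewrite !ffunE.
Qed.

End FamilySkeins.

Definition closed_graph (I : finType) (w : rel (I + void)) (m : pairing I) : rel I :=
  fun u v => w (inl u) (inl v) || (m u == v).

Lemma glue_circles_closed (I : finType) (w : rel (I + void)) (m : pairing I) :
  involutive m -> glue_circles w m = ncomp (closed_graph w m).
Proof.
move=> mK.
rewrite /glue_circles (adjunction_n_comp inl (glue_csym w mK) (@symrel_sym _ (closed_graph w m))).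
- apply: eq_n_comp_r => u; rewrite !inE; apply/forallP => -[].
- apply: intro_closed => [|x y _ _]; first exact: glue_csym.
  rewrite inE; apply/forallP => -[].
have sub (x y : I) : glue_rel w m (inl x) (inl y) = symrel (closed_graph w m) x y.
  rewrite /glue_rel /= /closed_graph.
  have -> : (m y == x) = (m x == y) by rewrite (can2_eq mK mK) eq_sym.
  by case: (w _ _); case: (w _ _); case: (m x == y).
split=> [[x|[]] _|x y _]; first by exists x; apply: connect0.
apply/connectP/connectP => -[p e_p]; last first.
  elim: p x e_p => [|[z|[]] p IHp] x; first by move=> _ [->]; exists [::].
  rewrite /= -/(glue_rel w m (inl x) (inl z)) sub => /andP[xz /IHp{}IHp] /IHp[q e_q ->].
  by exists (z :: q) => //; apply/andP; split.
move=> ->; exists [seq inl z | z <- p]; last by rewrite last_map.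
elim: p x e_p => //= z p IHp x /andP[xz /IHp->]; rewrite andbT.
by rewrite -/(glue_rel w m (inl x) (inl z)) sub.
Qed.

Lemma bracketE (I : finType) (w : rel (I + void)) (x : skein I) :
  (forall m, x m != 0 -> involutive m) ->
  bracket w x = \sum_m x m * delta ^+ ncomp (closed_graph w m).
Proof.
move=> xinv; rewrite /bracket ffunE; apply: eq_big => [m|m _].
  by apply/eqP/ffunP => -[].
have [->|/xinv mK] := eqVneq (x m) 0; first by rewrite !mul0r.
by rewrite glue_circles_closed.
Qed.

Lemma family_pairingK (T B : finType) (mu : {ffun T -> pairing B}) :
  (forall t, involutive (mu t)) -> involutive (family_pairing mu).
Proof. by move=> muK [t b]; rewrite !ffunE /= muK. Qed.

Lemma juxt_pairingK (B C : finType) (m : pairing B) (m' : pairing C) :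
  involutive m -> involutive m' -> involutive (juxt_pairing m m').
Proof. by move=> mK mK' [b|c]; rewrite !ffunE ?mK ?mK'. Qed.

Lemma glue_pairingK (I O : finType) (w : rel (I + O)) (m : pairing I) :
  functional_wiring w -> involutive m -> involutive (glue_pairing w m).
Proof.
move=> wf mK o; set o' := glue_pairing w m o.
have [e|no] := eqVneq o' o; first by rewrite e.
apply: glue_pairingP => //; first by rewrite eq_sym.
rewrite (glue_csym w mK); exact: glue_pairing_connect.
Qed.

Lemma smoothingK s : involutive (smoothing s).
Proof. by move=> a; rewrite !ffunE /follows; case: s; case: a => -[|[|[|[|]]]] //= i; apply: val_inj. Qed.

Lemma crossing_supp m : crossing m != 0 -> m = smoothing true \/ m = smoothing false.
Proof.
rewrite ffunE !ffunE; case: (m =P smoothing true) => [->|_]; first by left.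
by case: (m =P smoothing false) => [->|_]; [right|rewrite !mulr0 addr0 eqxx].
Qed.

Lemma crossingK m : crossing m != 0 -> involutive m.
Proof. by case/crossing_supp=> ->; apply: smoothingK. Qed.

Lemma delta_neq0 : delta != 0.
Proof.
have X0 : varA != 0 by rewrite tofrac_eq0 polyX_eq0.
rewrite /delta -opprD oppr_eq0; apply/negP => /eqP E.
have : varA ^+ 2 * (varA ^+ 2 + varA ^- 2) = 0 by rewrite E mulr0.
rewrite mulrDr mulfV ?expf_neq0 // -exprD => /eqP.
rewrite -tofracXn -tofrac1 -tofracD tofrac_eq0 => /eqP E1.
have := congr1 (fun p : {poly rat} => p`_0) E1.
by rewrite coefD coefXn coef1 coef0 /= add0r => /eqP; rewrite oner_eq0.
Qed.

(** * Caps killed by a box *)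

Section Attach.
Variables (B V : finType).

Definition attach (e : rel V) (iota : B -> V) (m : pairing B) : rel V :=
  fun u v => e u v || [exists p, (u == iota p) && (v == iota (m p))].

Lemma cap_wire_fun (a b : B) : a != b -> functional_wiring (@cap_wire B a b).
Proof.
move=> ab [x|[c cN]] [y|[c' c'N]] [z|[c'' c''N]] //=; rewrite ?orbF.
- case/orP=> /andP[/eqP ? /eqP ?]; case/orP=> /andP[/eqP ? /eqP ?]; subst=> //;
  by rewrite ?eqxx in ab.
- case/orP=> /andP[/eqP ? /eqP ?] /eqP ?; subst; by have := c''N; rewrite !inE ?eqxx ?orbT.
- move=> /eqP ?; case/orP=> /andP[/eqP ? /eqP ?]; subst; by have := c'N; rewrite !inE ?eqxx ?orbT.
- by move=> /eqP E1 /eqP E2; congr inr; apply: val_inj; rewrite /= -E1 E2.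
- by move=> /eqP-> /eqP->.
Qed.

Lemma ncomp_cap_flat (e : rel V) (iota : B -> V) (a b : B) (m : pairing B) :
  linked e (iota a) (iota b) ->
  (forall p, p != a -> p != b -> ~~ linked e (iota a) (iota p)) ->
  ncomp (flat_graph (@cap_wire B a b) e (fun (_ : unit) o => iota (val o)) (fun _ => m)) =
  (ncomp (attach e iota m)).+1.
Proof.
move=> lab niso; set F := flat_graph _ _ _ _.
have nF : ~~ linked F (inr (tt, a)) (inl (iota a)).
  apply/negP => lF; pose P (x : V + unit * B) :=
    if x is inl v then linked e (iota a) v else false.
  suff : P (inr (tt, a)) = P (inl (iota a)) by rewrite /= linked0.
  apply: linked_inv lF => -[v|[[] i]] [v'|[[] i']] //=.
    move=> ee; apply/idP/idP => l; apply: linked_trans l _; first exact: linked1.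
    exact: linked1r.
  case/existsP=> -[c cN] /andP[_ /eqP->] /=.
  by move: cN; rewrite !inE negb_or => /andP[ca cb]; rewrite (negbTE (niso _ ca cb)).
rewrite -(ncomp_add_edge F (inr (tt, a)) (inl (iota a))) nF addn1; congr _.+1.
set F' := add_edge _ _ _.
have lFa : linked F' (inr (tt, a)) (inl (iota a)) by exact: linked_new_edge.
have lFw i j : F i j -> linked F' i j by move=> ij; apply: linked_add_edge; apply: linked1.
have lFab : linked F' (inr (tt, a)) (inr (tt, b)).
  by apply: lFw; rewrite /= !eqxx.
have lFe u v : linked e u v -> linked F' (inl u) (inl v).
  by apply: linked_map => x y xy; apply: lFw.
have lFp p : linked F' (inr (tt, p)) (inl (iota p)).
  have [->//|pa] := eqVneq p a.
  have [->|pb] := eqVneq p b.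
    apply: (@linked_trans _ _ (inr (tt, a))); first by rewrite linkedC.
    exact: linked_trans lFa (lFe _ _ lab).
  have pN : p \notin [:: a; b] by rewrite !inE negb_or pa pb.
  by apply: lFw; apply/existsP; exists (exist _ p pN); rewrite /= !eqxx.
apply/eqP; rewrite eqn_leq; apply/andP; split.
  apply: (@ncomp_le _ _ _ _ inl) => [[v|[[] p]]|u v].
  - by exists v.
  - by exists (iota p).
  - case/orP=> [uv|/existsP[p /andP[/eqP-> /eqP->]]]; first exact: lFw.
    apply: (@linked_trans _ _ (inr (tt, p))); first by rewrite linkedC.
    apply: (@linked_trans _ _ (inr (tt, m p))) (lFp _).
    by apply: lFw; rewrite /= eqxx orbT.
pose h (x : V + unit * B) := match x with inl v => v | inr (_, p) => iota p end.
apply: (@ncomp_le _ _ _ _ h) => [v|x y]; first by exists (inl v).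
have le u v : linked e u v -> linked (attach e iota m) u v.
  by apply: linked_sub => {u v} u v uv; apply: linked1; rewrite /attach uv.
case/orP; last by case/andP=> /eqP-> /eqP->.
case: x y => [v|[[] i]] [v'|[[] i']] //=.
- by move=> vv'; apply/le/linked1.
- by case/existsP=> c /andP[/orP[/eqP->|//] /eqP->].
- case/orP=> [/andP[/eqP-> /eqP->]|/eqP<-]; first exact: le.
  by apply: linked1; rewrite /attach; apply/orP; right; apply/existsP; exists i; rewrite !eqxx.
Qed.

Lemma cap_kill (f : skein B) (e : rel V) (iota : B -> V) (a b : B) : a != b ->
  cap_off a b f = 0 -> (forall m, f m != 0 -> involutive m) ->
  linked e (iota a) (iota b) ->
  (forall p, p != a -> p != b -> ~~ linked e (iota a) (iota p)) ->
  \sum_m f m * delta ^+ ncomp (attach e iota m) = 0.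
Proof.
move=> ab f0 fK lab niso; apply: (mulfI delta_neq0); rewrite mulr0 mulr_sumr.
pose io (_ : unit) (o : {c : B | c \notin [:: a; b]}) := iota (val o).
pose Phi (m' : pairing {c : B | c \notin [:: a; b]}) : QA :=
  delta ^+ ncomp (fun u v => e u v || [exists o, (u == iota (val o)) && (v == iota (val (m' o)))]).
have : \sum_m' cap_off a b f m' * Phi m' = 0.
  by rewrite big1 // => m' _; rewrite f0 ffunE mul0r.
have -> : \sum_m' cap_off a b f m' * Phi m' =
    \sum_m f m * delta ^+ glue_circles (@cap_wire B a b) m * Phi (glue_pairing (@cap_wire B a b) m).
  rewrite [RHS](partition_big (glue_pairing (@cap_wire B a b)) xpredT) //=.
  apply: eq_bigr => m' _; rewrite ffunE mulr_suml.
  by apply: eq_bigr => m /eqP->.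
move=> E0; rewrite -[RHS]E0; apply: eq_bigr => m _.
have [->|/fK mK] := eqVneq (f m) 0; first by rewrite !mul0r mulr0.
rewrite mulrCA -mulrA; congr (_ * _).
rewrite -exprS -(ncomp_cap_flat m lab niso) -exprD; congr (_ ^+ _).
rewrite (@ncomp_flat _ _ _ _ (@cap_wire B a b) e io (fun _ => m)) //; last first.
  exact: cap_wire_fun.
rewrite big_const card_unit /= addn0 addnC; congr (_ + _)%N.
apply: eq_ncomp => x y /=.
  case/orP=> [xy|/existsP[[] /existsP[o /andP[/eqP-> /eqP->]]]]; apply: linked1; first by rewrite xy.
  by apply/orP; right; apply/existsP; exists o; rewrite !eqxx.
case/orP=> [xy|/existsP[o /andP[/eqP-> /eqP->]]]; apply: linked1; rewrite /outer_graph ?xy //.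
by apply/orP; right; apply/existsP; exists tt; apply/existsP; exists o; rewrite !eqxx.
Qed.

End Attach.

(** * The Reidemeister II move by counting components *)

Section AddEdges.
Variable V : finType.
Implicit Types (e : rel V) (s : seq (V * V)).

Definition add_edges e s : rel V := fun x y => e x y || ((x, y) \in s).

Lemma linked_edge e s x y : (x, y) \in s -> linked (add_edges e s) x y.
Proof. by move=> xy; apply: linked1; rewrite /add_edges xy orbT. Qed.

Lemma linked_edgeC e s x y : (y, x) \in s -> linked (add_edges e s) x y.
Proof. by rewrite linkedC; apply: linked_edge. Qed.

Lemma linked_edge_or e s x y :
  ((x, y) \in s) || ((y, x) \in s) -> linked (add_edges e s) x y.
Proof. by case/orP; [apply: linked_edge|apply: linked_edgeC]. Qed.

Lemma linked_edges e s x y : linked e x y -> linked (add_edges e s) x y.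
Proof. by apply: linked_sub => u v uv; apply: linked1; rewrite /add_edges uv. Qed.

Lemma ncomp_cons e s a b :
  (ncomp (add_edges e ((a, b) :: s)) + ~~ linked (add_edges e s) a b)%N = ncomp (add_edges e s).
Proof.
rewrite -[RHS](ncomp_add_edge _ a b); congr (_ + _)%N.
by apply: eq_ncomp => x y xy; apply: linked1; move: xy;
   rewrite /add_edges /= !inE xpair_eqE orbCA orbC.
Qed.

Lemma eq_ncomp_edges e s s' :
  all (fun u => linked (add_edges e s') u.1 u.2) s ->
  all (fun u => linked (add_edges e s) u.1 u.2) s' ->
  ncomp (add_edges e s) = ncomp (add_edges e s').
Proof.
move=> /allP h /allP h'; apply: eq_ncomp => x y /orP[xy|].
- by apply: linked_edges; apply: linked1.
- by move/h.
- by apply: linked_edges; apply: linked1.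
- by move/h'.
Qed.

Lemma isolated_edges e s a b :
  all (fun u => linked e a u.1 == linked e a u.2) s -> ~~ linked e a b ->
  ~~ linked (add_edges e s) a b.
Proof.
move=> /allP h; apply: contra => ab.
rewrite -(@linked_inv _ _ _ (linked e a) _ _ _ ab) // => x y /orP[xy|/h/eqP //].
by apply/idP/idP => l; apply: linked_trans l _; [apply: linked1|apply: linked1r].
Qed.

End AddEdges.

Section R2Graph.
Variables (V : finType) (e : rel V) (u u' v v' p2 p3 q1 q2 : V).
Hypotheses (uu : linked e u u') (vv : linked e v v') (uv : ~~ linked e u v).
Hypothesis u_out : all (fun x => ~~ linked e u x) [:: p2; p3; q1; q2].
Hypothesis v_out : all (fun x => ~~ linked e v x) [:: p2; p3; q1; q2].

Let N := ncomp (add_edges e [:: (p2, p3); (q1, q2)]).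
Let N' := ncomp (add_edges e [:: (p3, q1); (p2, q2)]).
Let vu : ~~ linked e v u. Proof. by rewrite linkedC. Qed.

Ltac out := move/and5P: u_out => [/negbTE up2 /negbTE up3 /negbTE uq1 /negbTE uq2 _];
  move/and5P: v_out => [/negbTE vp2 /negbTE vp3 /negbTE vq1 /negbTE vq2 _].

(** Here [u], [u'] and [v], [v'] are the ends of the two arcs between the crossings, the other four
    points the ends leading away. The two arcs, isolated in [N], close up to one circle in this
    state; in the states below they are absorbed into the outer strands. *)
Lemma ncomp_r2_circle :
  (ncomp (add_edges e [:: (v, u); (p2, p3); (v', u'); (q1, q2)])).+1 = N.
Proof.
out; rewrite /N -[RHS](ncomp_cons _ _ v u) isolated_edges //= ?vp2 ?vp3 ?vq1 ?vq2 // addn1; congr _.+1.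
apply: eq_ncomp_edges; last by rewrite /= !linked_edge ?inE ?eqxx ?orbT.
apply/and5P; split=> //=; try by rewrite linked_edge ?inE ?eqxx ?orbT.
apply: (@linked_trans _ _ v); first by rewrite linkedC linked_edges.
by apply: linked_trans (linked_edges _ uu); rewrite linked_edge ?inE ?eqxx.
Qed.

Lemma ncomp_r2_aa :
  (ncomp (add_edges e [:: (v, u); (p2, p3); (v', q1); (q2, u')])).+2 = N.
Proof.
out; rewrite /N -[RHS](ncomp_cons _ _ v q1) isolated_edges //= ?vp2 ?vp3 ?vq1 ?vq2 // addn1; congr _.+1.
rewrite -[RHS](ncomp_cons _ _ u v).
rewrite isolated_edges //= ?up2 ?up3 ?uq1 ?uq2 ?(negbTE uv) // addn1; congr _.+1.
apply: eq_ncomp_edges; set s := add_edges _ _.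
  have a1 : linked s u v by rewrite linked_edge ?inE ?eqxx ?orbT.
  have a2 : linked s v q1 by rewrite linked_edge ?inE ?eqxx ?orbT.
  have a3 : linked s q1 q2 by rewrite linked_edge ?inE ?eqxx ?orbT.
  have a4 : linked s v v' by rewrite linked_edges.
  have a5 : linked s u u' by rewrite linked_edges.
  apply/and5P; split=> //=; first by rewrite linkedC.
  - by rewrite linked_edge ?inE ?eqxx ?orbT.
  - by apply: linked_trans a2; rewrite linkedC.
  - rewrite linkedC; apply: linked_trans a3; apply: linked_trans a2.
    by apply: linked_trans a1; rewrite linkedC.
have a1 : linked s v u by rewrite linked_edge ?inE ?eqxx ?orbT.
have a2 : linked s v' q1 by rewrite linked_edge ?inE ?eqxx ?orbT.
have a3 : linked s q2 u' by rewrite linked_edge ?inE ?eqxx ?orbT.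
have a4 : linked s v v' by rewrite linked_edges.
have a5 : linked s u u' by rewrite linked_edges.
apply/and5P; split=> //=; first by rewrite linkedC.
- exact: linked_trans a4 a2.
- by rewrite linked_edge ?inE ?eqxx ?orbT.
- rewrite linkedC; apply: linked_trans a3 _; rewrite linkedC.
  rewrite linkedC in a2; apply: linked_trans a2 _; rewrite linkedC in a4.
  by apply: linked_trans a4 _; apply: linked_trans a1 a5.
Qed.

Lemma ncomp_r2_bb :
  (ncomp (add_edges e [:: (v, p3); (u, p2); (v', u'); (q1, q2)])).+2 = N.
Proof.
out; rewrite /N -[RHS](ncomp_cons _ _ v p3) isolated_edges //= ?vp2 ?vp3 ?vq1 ?vq2 // addn1; congr _.+1.
rewrite -[RHS](ncomp_cons _ _ u v).
rewrite isolated_edges //= ?up2 ?up3 ?uq1 ?uq2 ?(negbTE uv) // addn1; congr _.+1.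
apply: eq_ncomp_edges; set s := add_edges _ _.
  have a1 : linked s u v by rewrite linked_edge ?inE ?eqxx ?orbT.
  have a2 : linked s v p3 by rewrite linked_edge ?inE ?eqxx ?orbT.
  have a3 : linked s p3 p2 by rewrite linked_edgeC ?inE ?eqxx ?orbT.
  have a4 : linked s v v' by rewrite linked_edges.
  have a5 : linked s u u' by rewrite linked_edges.
  apply/and5P; split=> //=.
  - exact: linked_trans a1 (linked_trans a2 a3).
  - rewrite linkedC in a4; apply: linked_trans a4 _; rewrite linkedC in a1.
    exact: linked_trans a1 a5.
  - by rewrite linked_edge ?inE ?eqxx ?orbT.
have a1 : linked s v p3 by rewrite linked_edge ?inE ?eqxx ?orbT.
have a2 : linked s u p2 by rewrite linked_edge ?inE ?eqxx ?orbT.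
have a3 : linked s u' v' by rewrite linked_edgeC ?inE ?eqxx ?orbT.
have a4 : linked s v' v by rewrite linkedC linked_edges.
have a5 : linked s u u' by rewrite linked_edges.
have a6 : linked s u v by apply: linked_trans a5 (linked_trans a3 a4).
apply/and5P; split=> //=.
- by rewrite linkedC in a2; apply: linked_trans a2 (linked_trans a6 a1).
- by rewrite linked_edge ?inE ?eqxx ?orbT.
Qed.

Lemma ncomp_r2_ba :
  (ncomp (add_edges e [:: (v, p3); (u, p2); (v', q1); (q2, u')])).+2 = N'.
Proof.
out; rewrite /N' -[RHS](ncomp_cons _ _ v q1) isolated_edges //= ?vp2 ?vp3 ?vq1 ?vq2 // addn1; congr _.+1.
rewrite -[RHS](ncomp_cons _ _ u p2).
rewrite isolated_edges //= ?up2 ?up3 ?uq1 ?uq2 ?(negbTE uv) // addn1; congr _.+1.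
apply: eq_ncomp_edges; set s := add_edges _ _.
  have a1 : linked s u p2 by rewrite linked_edge ?inE ?eqxx ?orbT.
  have a2 : linked s v q1 by rewrite linked_edge ?inE ?eqxx ?orbT.
  have a3 : linked s q1 p3 by rewrite linked_edgeC ?inE ?eqxx ?orbT.
  have a4 : linked s v' v by rewrite linkedC linked_edges.
  have a5 : linked s u u' by rewrite linked_edges.
  have a6 : linked s q2 p2 by rewrite linked_edgeC ?inE ?eqxx ?orbT.
  apply/and5P; split=> //=.
  - exact: linked_trans a2 a3.
  - exact: linked_trans a4 a2.
  - by apply: linked_trans a6 _; rewrite linkedC in a1; apply: linked_trans a1 a5.
have a1 : linked s v p3 by rewrite linked_edge ?inE ?eqxx ?orbT.
have a2 : linked s u p2 by rewrite linked_edge ?inE ?eqxx ?orbT.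
have a3 : linked s v' q1 by rewrite linked_edge ?inE ?eqxx ?orbT.
have a4 : linked s v v' by rewrite linked_edges.
have a5 : linked s u u' by rewrite linked_edges.
have a6 : linked s u' q2 by rewrite linked_edgeC ?inE ?eqxx ?orbT.
apply/and5P; split=> //=.
- exact: linked_trans a4 a3.
- rewrite linkedC in a1; apply: linked_trans a1 _; exact: linked_trans a4 a3.
- rewrite linkedC in a2; apply: linked_trans a2 _; exact: linked_trans a5 a6.
Qed.

End R2Graph.

Lemma ncomp_r2_straight (V : finType) (e : rel V) (u u' v v' p2 p3 q1 q2 : V) :
  linked e u u' -> linked e v v' -> ~~ linked e u v ->
  all (fun x => ~~ linked e u x) [:: p2; p3; q1; q2] ->
  all (fun x => ~~ linked e v x) [:: p2; p3; q1; q2] ->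
  (ncomp (add_edges e [:: (v, p2); (u, p3); (v', q2); (q1, u')])).+2 =
  ncomp (add_edges e [:: (p3, q1); (p2, q2)]).
Proof.
move=> uu vv uv uo vo.
rewrite (eq_ncomp_edges (s' := [:: (u, p3); (v, p2); (u', q1); (q2, v')])); first last.
- by apply/and5P; split=> //=; first [by rewrite linked_edge ?inE ?eqxx ?orbT | by rewrite linked_edgeC ?inE ?eqxx ?orbT].
- by apply/and5P; split=> //=; first [by rewrite linked_edge ?inE ?eqxx ?orbT | by rewrite linked_edgeC ?inE ?eqxx ?orbT].
rewrite (@ncomp_r2_ba _ e v v' u u' p2 p3 q1 q2) //; last by rewrite linkedC.
Qed.

(** The disc is left empty, which exposes its points as ends of arcs. *)
Definition stay (B : finType) : pairing B := [ffun p => p].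

(** The two strands pass through each other. This is not planar, but only components are counted; it
    replaces a crossing across which a cup has been pulled. *)
Definition straight : pairing 'I_4 := [ffun k => k + 1 + 1].

Lemma sum_basis (B : finType) (m0 : pairing B) (G : pairing B -> QA) :
  \sum_m basis m0 m * G m = G m0.
Proof.
rewrite (bigD1 m0) //= ffunE eqxx mul1r big1 ?addr0 // => m /negbTE nm.
by rewrite ffunE nm mul0r.
Qed.

Lemma sum_crossing (G : pairing 'I_4 -> QA) :
  \sum_m crossing m * G m = varA * G (smoothing true) + varA^-1 * G (smoothing false).
Proof.
under eq_bigr do rewrite ffunE mulrDl -!mulrA.
by rewrite big_split /= -!mulr_sumr !sum_basis.
Qed.

Lemma varA_neq0 : varA != 0.
Proof. by rewrite tofrac_eq0 polyX_eq0. Qed.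

(** The smoothings as seen from the end [eps], which is joined to the next end counterclockwise by
    [turn_left] and to the previous one by [turn_right]. Which of them is the A-smoothing depends on
    the parity of [eps]; with these names one argument serves all four ends. *)
Definition turn_left (eps : 'I_4) : pairing 'I_4 := smoothing (~~ odd eps).
Definition turn_right (eps : 'I_4) : pairing 'I_4 := smoothing (odd eps).

Lemma ord4_cases (eps k : 'I_4) :
  [\/ k = eps, k = eps + 1, k = eps + 1 + 1 | k = eps - 1].
Proof.
case: eps k => -[|[|[|[|]]]] // ie [[|[|[|[|]]]] // ik];
  (by constructor 1; apply: val_inj) || (by constructor 2; apply: val_inj) ||
  (by constructor 3; apply: val_inj) || (by constructor 4; apply: val_inj).
Qed.

Lemma turn_leftE (eps : 'I_4) : [/\ turn_left eps eps = eps + 1, turn_left eps (eps + 1) = eps,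
  turn_left eps (eps + 1 + 1) = eps - 1 & turn_left eps (eps - 1) = eps + 1 + 1].
Proof.
by rewrite !ffunE; case: eps => -[|[|[|[|]]]] // i; split; apply: val_inj.
Qed.

Lemma turn_rightE (eps : 'I_4) : [/\ turn_right eps eps = eps - 1, turn_right eps (eps - 1) = eps,
  turn_right eps (eps + 1 + 1) = eps + 1 & turn_right eps (eps + 1) = eps + 1 + 1].
Proof.
by rewrite !ffunE; case: eps => -[|[|[|[|]]]] // i; split; apply: val_inj.
Qed.

Lemma straightE (eps : 'I_4) : [/\ straight eps = eps + 1 + 1, straight (eps + 1 + 1) = eps,
  straight (eps + 1) = eps - 1 & straight (eps - 1) = eps + 1].
Proof.
by rewrite !ffunE; case: eps => -[|[|[|[|]]]] // i; split; apply: val_inj.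
Qed.

Lemma ord4_neq (eps : 'I_4) :
  uniq [:: eps; eps + 1; eps + 1 + 1; eps - 1].
Proof. by case: eps => -[|[|[|[|]]]]. Qed.

Definition left_weight (eps : 'I_4) : QA := if odd eps then varA^-1 else varA.
Definition right_weight (eps : 'I_4) : QA := if odd eps then varA else varA^-1.

Lemma sum_crossing_turn (eps : 'I_4) (G : pairing 'I_4 -> QA) :
  \sum_m crossing m * G m =
  left_weight eps * G (turn_left eps) + right_weight eps * G (turn_right eps).
Proof.
rewrite sum_crossing /left_weight /right_weight /turn_left /turn_right.
by case: odd; rewrite //= addrC.
Qed.

Lemma turn_weights (eps : 'I_4) : left_weight eps * right_weight eps = 1 /\
  left_weight eps ^+ 2 + right_weight eps ^+ 2 = - delta.
Proof.
rewrite /left_weight /right_weight /delta opprD !opprK.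
case: odd; split; rewrite ?mulfV ?mulVf ?varA_neq0 // exprVn //; exact: addrC.
Qed.

(** * Nets of crossings and boxes *)

Section Net.
Variables (T1 T2 : finType) (n : nat).
Local Notation pt := (T1 * 'I_4 + T2 * tl_points n)%type.
Implicit Types (x : T1 -> skein 'I_4) (b : T2 -> skein (tl_points n)).
Implicit Types (sg : {ffun T1 -> pairing 'I_4}) (M : {ffun T2 -> pairing (tl_points n)}).
Variable W : pt -> pt.

Definition step sg M (z : pt) : pt :=
  match z with inl (t, k) => inl (t, sg t k) | inr (d, p) => inr (d, M d p) end.

Definition net_graph sg M : rel pt := fun z z' => (z' == W z) || (z' == step sg M z).

Definition netsum x b : QA :=
  fsum (fun t => x t) (fun sg => fsum (fun d => b d) (fun M => delta ^+ ncomp (net_graph sg M))).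

Lemma linked_W sg M z : linked (net_graph sg M) z (W z).
Proof. by apply: linked1; rewrite /net_graph eqxx. Qed.

Lemma linked_step sg M z : linked (net_graph sg M) z (step sg M z).
Proof. by apply: linked1; rewrite /net_graph eqxx orbT. Qed.

Lemma eq_netsum x x' b b' : x =1 x' -> b =1 b' -> netsum x b = netsum x' b'.
Proof.
move=> xx bb; apply: eq_fsum => [t m|sg _]; first by rewrite xx.
by apply: eq_fsum => [t m|//]; rewrite bb.
Qed.

Lemma netsum_split1 (x y z : T1 -> skein 'I_4) b t0 : (forall m, x t0 m = y t0 m + z t0 m) ->
  (forall t, t != t0 -> y t =1 x t /\ z t =1 x t) -> netsum x b = netsum y b + netsum z b.
Proof. exact: fsum_split. Qed.

Definition inv_weights (T : Type) (B : finType) (x : T -> skein B) :=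
  forall t m, x t m != 0 -> involutive m.

Lemma ncomp_box sg M d m :
  ncomp (net_graph sg (fupdate M d m)) =
  ncomp (attach (net_graph sg (fupdate M d (stay (tl_points n)))) (fun p => inr (d, p)) m).
Proof.
apply: eq_ncomp => z z'.
  case/orP=> /eqP->; first by apply: linked1; rewrite /attach /net_graph eqxx.
  case: z => [[t k]|[d' p]] /=; first by apply: linked1; rewrite /attach /net_graph /= eqxx orbT.
  have [->|nd] := eqVneq d' d.
    rewrite !ffunE eqxx; apply: linked1; rewrite /attach; apply/orP; right.
    by apply/existsP; exists p; rewrite !eqxx.
  by apply: linked1; rewrite /attach /net_graph /= !ffunE (negbTE nd) eqxx orbT.
case/orP=> [/orP[]|/existsP[p /andP[/eqP-> /eqP->]]].
- by move/eqP->; apply: linked_W.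
- move/eqP->; case: z => [[t k]|[d' p]] /=; first exact: (linked_step _ _ (inl (t, k))).
  rewrite ffunE; case: eqP => [_|nd]; first by rewrite ffunE.
  have := linked_step sg (fupdate M d m) (inr (d', p)).
  by rewrite /= ffunE; case: eqP nd.
- by have := linked_step sg (fupdate M d m) (inr (d, p)); rewrite /= ffunE eqxx.
Qed.

(* [D] is a set of boxes whose state is left open; an arc avoids them, except at its
   ends. *)
Definition forced x b (D : pred (T1 + T2)) (z z' : pt) : Prop :=
  match z, z' with
  | inl (t, k), inl (t', k') =>
      [/\ t' = t, ~~ D (inl t) & forall m, x t m != 0 -> m k = k']
  | inr (d, p), inr (d', q) =>
      [/\ d' = d, ~~ D (inr d) & forall m, b d m != 0 -> m p = q]
  | _, _ => False
  end.

Definition node (z : pt) : T1 + T2 := match z with inl u => inl u.1 | inr u => inr u.1 end.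

(** The list records the points on the way, so that [arc_isolated] can show that the component
    contains nothing else. *)
Inductive arc x b D : seq pt -> pt -> pt -> Prop :=
| Arc1 u : arc x b D [:: u; W u] u (W u)
| ArcS u v s v' : forced x b D (W u) v -> arc x b D s v v' ->
    arc x b D [:: u, W u & s] u v'.

Hypothesis WK : involutive W.

Lemma arc_cat x b D s u v u' s' v' : arc x b D s u v -> forced x b D v u' ->
  arc x b D s' u' v' -> arc x b D (s ++ s') u v'.
Proof.
move=> sa; elim: sa u' s' v' => {s u v} [u|u v s v1 uv sa IH] u' s' v' f a.
  exact: ArcS f a.
apply: ArcS uv _; exact: IH f a.
Qed.

Lemma arc_ends x b D s u v : arc x b D s u v -> (u \in s) /\ (v \in s).
Proof.
by elim=> {s u v} [u|u v s v1 uv sa [IH1 IH2]]; split; rewrite !inE ?eqxx ?IH2 ?orbT.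
Qed.

Lemma arc_W x b D s u v z : arc x b D s u v -> z \in s -> W z \in s.
Proof.
elim=> {s u v} [u|u v s v1 uv sa IH]; rewrite !inE.
  by case/orP=> /eqP->; rewrite ?WK eqxx ?orbT.
by case/or3P=> [/eqP->|/eqP->|/IH->]; rewrite ?WK ?eqxx ?orbT.
Qed.

Lemma forced_node x b D z z' : forced x b D z z' -> node z' = node z /\ ~~ D (node z).
Proof. by case: z z' => [[t k]|[d p]] [[t' k']|[d' p']] //= [->]. Qed.

Lemma arc_mem x b D s u v z : arc x b D s u v -> z \in s ->
  [\/ z = u, z = v | ~~ D (node z)].
Proof.
elim=> {s u v} [u|u v s v1 uv sa IH]; rewrite !inE.
  by case/orP=> /eqP->; [constructor 1|constructor 2].
have [e nD] := forced_node uv.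
case/or3P=> [/eqP->|/eqP->|/IH[->|->|]]; first by constructor 1.
- by constructor 3.
- by constructor 3; rewrite e.
- by constructor 2.
- by constructor 3.
Qed.

Lemma arc_weaken x x' b b' (D D' : pred (T1 + T2)) s u v :
  (forall t, ~~ D (inl t) -> ~~ D' (inl t) /\ x t = x' t) ->
  (forall d, ~~ D (inr d) -> ~~ D' (inr d) /\ b d = b' d) ->
  arc x b D s u v -> arc x' b' D' s u v.
Proof.
move=> h1 h2; elim=> {s u v} [u|u v s v1 uv sa IH]; first exact: Arc1.
refine (@ArcS x' b' D' u v s v1 _ IH).
clear IH sa. move: (W u) v uv.
move=> z z'. rewrite /forced.
case: z => [[t k]|[d p]].
case: z' => [[t' k']|[d' p']].
move=> [e nD f]. have [nD' xx] := h1 _ nD. split. exact: e. exact: nD'.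
rewrite -xx. exact: f.
by [].
case: z' => [[t' k']|[d' p']].
by [].
move=> [e nD f]. have [nD' xx] := h2 _ nD. split. exact: e. exact: nD'.
rewrite -xx. exact: f.
Qed.

Lemma step_forced x b D sg M z z' :
  (forall t, ~~ D (inl t) -> x t (sg t) != 0) ->
  (forall d, ~~ D (inr d) -> b d (M d) != 0) ->
  forced x b D z z' -> step sg M z = z'.
Proof.
move=> h1 h2; case: z z' => [[t k]|[d p]] [[t' k']|[d' p']] //= [-> nD f].
  by rewrite f // h1.
by rewrite f // h2.
Qed.

Lemma arc_linked x b D s u v sg M : arc x b D s u v ->
  (forall t, ~~ D (inl t) -> x t (sg t) != 0) ->
  (forall d, ~~ D (inr d) -> b d (M d) != 0) ->
  linked (net_graph sg M) u v.
Proof.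
move=> sa h1 h2; elim: sa => {s u v} [u|u v s v1 uv sa IH]; first exact: linked_W.
apply: linked_trans (linked_W _ _ _) _; apply: linked_trans IH.
by rewrite -(step_forced h1 h2 uv); apply: linked_step.
Qed.

Lemma arc_isolated x b D s u v sg M : arc x b D s u v ->
  (forall t, ~~ D (inl t) -> x t (sg t) != 0) ->
  (forall d, ~~ D (inr d) -> b d (M d) != 0) ->
  involutive (step sg M) -> step sg M u = u -> step sg M v = v ->
  forall z z', linked (net_graph sg M) z z' -> (z \in s) = (z' \in s).
Proof.
move=> sa h1 h2 stK fu fv.
have cl z : z \in s -> [\/ z = u, z = v | step sg M z \in s].
  elim: sa z {fu fv} => {s u v} [u|u v s v1 uv sa IH] z; rewrite !inE.
    by case/orP=> /eqP->; [constructor 1|constructor 2].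
  have e := step_forced h1 h2 uv; have [vs v1s] := arc_ends sa.
  case/or3P=> [/eqP->|/eqP->|/IH[->|->|->]]; first by constructor 1.
  - by constructor 3; rewrite e vs !orbT.
  - by constructor 3; rewrite -e stK eqxx orbT.
  - by constructor 2.
  - by constructor 3; rewrite !orbT.
have [us vs] := arc_ends sa.
have cls z : z \in s -> step sg M z \in s.
  by move=> zs; case: (cl z zs) => [->|->|] //; rewrite ?fu ?fv.
move=> z z'; apply: linked_inv => {z z'} z z' /orP[] /eqP->; apply/idP/idP => zs.
- exact: arc_W sa zs.
- by rewrite -(WK z); apply: arc_W sa zs.
- exact: cls.
- by rewrite -(stK z); apply: cls.
Qed.

Lemma stepK sg M : (forall t, involutive (sg t)) -> (forall d, involutive (M d)) ->
  involutive (step sg M).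
Proof. by move=> h1 h2 [[t k]|[d p]] /=; rewrite ?h1 ?h2. Qed.

Lemma stayK B : involutive (stay B).
Proof. by move=> p; rewrite !ffunE. Qed.

(** With the states of all other nodes fixed and the sum over the box [d] taken last, the arc is the
    outer arc required by [cap_kill]. *)
Lemma netsum_kill x b d p q s :
  inv_weights x -> inv_weights b -> p != q -> cap_off p q (b d) = 0 \/ cap_off q p (b d) = 0 ->
  arc x b (pred1 (inr d)) s (inr (d, p)) (inr (d, q)) -> netsum x b = 0.
Proof.
move=> xK bK pq cap0 sa; apply: fsum0 => sg xs.
(* The placeholder [stay] empties the box [d], so that the arc really ends at [p] and [q]. *)
rewrite (fsum_int _ _ d (stay (tl_points n))); apply: fsum0 => M bs.
under eq_bigr do rewrite ncomp_box.
set e := net_graph _ _.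
have h1 t : ~~ pred1 (inr d) (inl t : T1 + T2) -> x t (sg t) != 0 by move=> _; apply: xs.
have h2 d' : ~~ pred1 (inr d) (inr d' : T1 + T2) ->
    b d' (fupdate M d (stay (tl_points n)) d') != 0.
  move=> nd; have nd' : d' != d by apply: contraNneq nd => ->; rewrite /= eqxx.
  by have := bs d'; rewrite ffunE /update !(negbTE nd').
have MK d' : involutive (fupdate M d (stay (tl_points n)) d').
  have [->|nd] := eqVneq d' d; first by rewrite ffunE eqxx; apply: stayK.
  by apply: (bK d'); apply: h2; apply: contraNneq nd => -[->].
have sgK t : involutive (sg t) by apply: (xK t); apply: xs.
have fx r : step sg (fupdate M d (stay (tl_points n))) (inr (d, r)) = inr (d, r).
  by rewrite /= ffunE eqxx ffunE.
have iso := arc_isolated sa h1 h2 (stepK sgK MK) (fx p) (fx q).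
have lpq : linked e (inr (d, p)) (inr (d, q)) := arc_linked sa h1 h2.
have niso r : r != p -> r != q -> ~~ linked e (inr (d, p)) (inr (d, r)).
  move=> rp rq; apply/negP => /iso; have [ps _] := arc_ends sa.
  rewrite ps => /esym /(arc_mem sa)[[e1]|[e1]|/=].
  - by rewrite e1 eqxx in rp.
  - by rewrite e1 eqxx in rq.
  - by rewrite eqxx.
case: cap0 => cap0; first exact: cap_kill pq cap0 (bK d) lpq niso.
apply: (cap_kill _ cap0 (bK d)); first by rewrite eq_sym.
  by rewrite linkedC.
move=> r rq rp; apply: contra (niso r rp rq); exact: linked_trans.
Qed.

Lemma ncomp_two sg M P Q (pi pi' : pairing 'I_4) (s : seq (pt * pt)) : P != Q ->
  let e := net_graph (fupdate (fupdate sg Q (stay 'I_4)) P (stay 'I_4)) M in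
  (forall k, linked (add_edges e s) (inl (P, k)) (inl (P, pi k))) ->
  (forall k, linked (add_edges e s) (inl (Q, k)) (inl (Q, pi' k))) ->
  all (fun u => if u is (inl (t, k), inl (t', k')) then
     (t == t') && ((t == P) && ((k' == pi k) || (k == pi k')) ||
                   (t == Q) && ((k' == pi' k) || (k == pi' k'))) else false) s ->
  ncomp (net_graph (fupdate (fupdate sg Q pi') P pi) M) = ncomp (add_edges e s).
Proof.
move=> PQ e hP hQ /allP hs; apply: eq_ncomp => z z'.
  case/orP=> /eqP->; first exact/linked_edges/linked_W.
  case: z => [[t k]|[d p]] /=; last by apply/linked_edges/(linked_step _ _ (inr (d, p))).
  rewrite !ffunE; case: eqP => [->|nP]; first exact: hP.
  case: eqP => [->|nQ]; first exact: hQ.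
  apply: linked_edges; have := linked_step (fupdate (fupdate sg Q (stay 'I_4)) P (stay 'I_4)) M (inl (t, k)).
  by rewrite /= !ffunE; case: eqP nP => // _ _; case: eqP nQ.
set sg' := fupdate (fupdate sg Q pi') P pi.
have stP k : linked (net_graph sg' M) (inl (P, k)) (inl (P, pi k)).
  by have := linked_step sg' M (inl (P, k)); rewrite /= ffunE eqxx.
have stQ k : linked (net_graph sg' M) (inl (Q, k)) (inl (Q, pi' k)).
  by have := linked_step sg' M (inl (Q, k)); rewrite /= ffunE eq_sym (negbTE PQ) ffunE eqxx.
case/orP=> [/orP[]/eqP->|/hs].
- exact: linked_W.
- case: z => [[t k]|[d p]] /=; last exact: (linked_step _ _ (inr (d, p))).
  rewrite !ffunE; case: eqP => [->|nP]; first by rewrite ffunE.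
  case: eqP => [->|nQ]; first by rewrite ffunE.
  have := linked_step sg' M (inl (t, k)).
  by rewrite /= !ffunE; case: eqP nP => // _ _; case: eqP nQ.
- case: z z' => [[t k]|//] [[t' k']|//] /andP[/eqP<-].
  case/orP=> /andP[/eqP-> /orP[]/eqP->] //; by rewrite linkedC.
Qed.

(** Reidemeister II: a strand through the ends [eps - 1] and [eps + 1] of [P] and [Q] crosses both
    legs of a cup that joins their ends [eps]. With weights l and r of the left and right turns, l r
    = 1 and l^2 + r^2 = - delta. The states LL, RR and LR amount to one value with total weight l^2
    + r^2 + delta = 0, and RL is the picture pulled apart, with weight 1. *)
Lemma netsum_r2 x b (D : pred (T1 + T2)) s P Q (eps : 'I_4) :
  inv_weights x -> inv_weights b -> P != Q -> x P = crossing -> x Q = crossing ->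
  W (inl (P, eps + 1)) = inl (Q, eps - 1) -> D (inl P) -> D (inl Q) ->
  arc x b D s (inl (P, eps)) (inl (Q, eps)) ->
  netsum x b = netsum (update (update x P (basis straight)) Q (basis straight)) b.
Proof.
move=> xK bK PQ xP xQ WPQ DP DQ sa.
have QP : Q == P = false by rewrite eq_sym; apply: negbTE.
rewrite /netsum.
set S := fun sg => fsum _ _.
rewrite (fsum_int _ _ P (stay 'I_4)) (fsum_int _ _ Q (stay 'I_4)).
rewrite [RHS](fsum_int _ _ P (stay 'I_4)) [RHS](fsum_int _ _ Q (stay 'I_4)).
apply: eq_fsum => [t m|sg xs].
  by rewrite /update; case: (t == Q) => //; case: (t == P).
rewrite {1 3}/update QP xQ xP /update !eqxx QP.
under eq_bigr do rewrite (sum_crossing_turn eps).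
rewrite (sum_crossing_turn eps) sum_basis if_same sum_basis.
pose G M := net_graph (fupdate (fupdate sg Q (stay 'I_4)) P (stay 'I_4)) M.
pose pp k : pt := inl (P, k); pose qq k : pt := inl (Q, k).
have h1 t : ~~ D (inl t) -> x t (fupdate (fupdate sg Q (stay 'I_4)) P (stay 'I_4) t) != 0.
  move=> nD; have tP : t != P by apply: contraNneq nD => ->.
  have tQ : t != Q by apply: contraNneq nD => ->.
  by have := xs t; rewrite /update !ffunE !(negbTE tP, negbTE tQ).
have base M : (forall d, b d (M d) != 0) ->
  [/\ linked (G M) (pp (eps + 1)) (qq (eps - 1)), linked (G M) (pp eps) (qq eps),
      ~~ linked (G M) (pp (eps + 1)) (pp eps),
      all (fun z => ~~ linked (G M) (pp (eps + 1)) z)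
        [:: pp (eps + 1 + 1); pp (eps - 1); qq (eps + 1); qq (eps + 1 + 1)] &
      all (fun z => ~~ linked (G M) (pp eps) z)
        [:: pp (eps + 1 + 1); pp (eps - 1); qq (eps + 1); qq (eps + 1 + 1)]].
  move=> bs.
  have h2 d : ~~ D (inr d) -> b d (M d) != 0 by move=> _; apply: bs.
  have stK : involutive (step (fupdate (fupdate sg Q (stay 'I_4)) P (stay 'I_4)) M).
    apply: stepK => [t|d]; last by apply: (bK d); apply: bs.
    have [->|tP] := eqVneq t P; first by rewrite ffunE eqxx; apply: stayK.
    have [->|tQ] := eqVneq t Q; first by rewrite ffunE QP ffunE eqxx; apply: stayK.
    by apply: (xK t); have := xs t; rewrite /update !ffunE !(negbTE tP, negbTE tQ).
  have fP k : step (fupdate (fupdate sg Q (stay 'I_4)) P (stay 'I_4)) M (pp k) = pp k.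
    by rewrite /= ffunE eqxx ffunE.
  have fQ k : step (fupdate (fupdate sg Q (stay 'I_4)) P (stay 'I_4)) M (qq k) = qq k.
    by rewrite /= ffunE QP ffunE eqxx ffunE.
  have iso := arc_isolated sa h1 h2 stK (fP eps) (fQ eps).
  have a1 := Arc1 x b D (pp (eps + 1)); rewrite WPQ in a1.
  have iso1 := arc_isolated a1 h1 h2 stK (fP _) (fQ _).
  have l0 : linked (G M) (pp eps) (qq eps) by apply: arc_linked sa h1 h2.
  have l1 : linked (G M) (pp (eps + 1)) (qq (eps - 1)) by apply: arc_linked a1 h1 h2.
  have /and4P[] := ord4_neq eps; rewrite !inE !negb_or.
  move=> /and3P[n01 n02 n03] /andP[n12 n13] n23 _.
  have [ps _] := arc_ends sa; have [ps1 _] := arc_ends a1.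
  have ppqq k k' : pp k != qq k' by apply/eqP => -[/eqP]; rewrite (negbTE PQ).
  have outP k : k != eps -> ~~ linked (G M) (pp eps) (pp k).
    move=> nk; apply/negP => /iso; rewrite ps => /esym /(arc_mem sa)[[e]|e|]; last by rewrite DP.
      by rewrite e eqxx in nk.
    by case/eqP: (ppqq k eps).
  have outQ k : k != eps -> ~~ linked (G M) (pp eps) (qq k).
    move=> nk; apply/negP => /iso; rewrite ps => /esym /(arc_mem sa)[e|[e]|]; last by rewrite DQ.
      by case/eqP: (ppqq eps k).
    by rewrite e eqxx in nk.
  have out1P k : k != eps + 1 -> ~~ linked (G M) (pp (eps + 1)) (pp k).
    move=> nk; apply/negP => /iso1; rewrite ps1 => /esym; rewrite !inE.
    case/orP=> /eqP e; first by case: e nk => ->; rewrite eqxx.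
    by case/eqP: (ppqq k (eps - 1)).
  have out1Q k : k != eps - 1 -> ~~ linked (G M) (pp (eps + 1)) (qq k).
    move=> nk; apply/negP => /iso1; rewrite ps1 => /esym; rewrite !inE.
    case/orP=> /eqP e; first by case/eqP: (ppqq (eps + 1) k).
    by case: e nk => ->; rewrite eqxx.
  split=> //=; first exact: out1P.
    by rewrite !out1P ?out1Q // eq_sym.
  by rewrite !outP ?outQ // eq_sym.
have [L0 L1 L2 L3] := turn_leftE eps; have [R0 R3 R2 R1] := turn_rightE eps.
have [S0 S2 S1 S3] := straightE eps.
have two M (pi pi' : pairing 'I_4) k1 k2 k1' k2' l1 l2 l1' l2' :
   let s := [:: (pp k1, pp k2); (pp k1', pp k2'); (qq l1, qq l2); (qq l1', qq l2')] in
   (forall k, linked (add_edges (G M) s) (pp k) (pp (pi k))) ->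
   (forall k, linked (add_edges (G M) s) (qq k) (qq (pi' k))) ->
   [/\ pi k1 = k2, pi k1' = k2', pi' l1 = l2 & pi' l1' = l2'] ->
   ncomp (net_graph (fupdate (fupdate sg Q pi') P pi) M) = ncomp (add_edges (G M) s).
  move=> ss hP hQ [e1 e2 e3 e4]; apply: ncomp_two => //=.
  by rewrite !eqxx e1 e2 e3 e4 !eqxx ?orbT.
pose st (pi pi' : pairing 'I_4) := fupdate (fupdate sg Q pi') P pi.
have NM M : (forall d, b d (M d) != 0) ->
  let c pi pi' := ncomp (net_graph (st pi pi') M) in
  [/\ (c (turn_left eps) (turn_left eps)).+1 = c (turn_left eps) (turn_right eps),
      c (turn_right eps) (turn_right eps) = c (turn_left eps) (turn_left eps) &
      c (turn_right eps) (turn_left eps) = c straight straight].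
  move=> /base [uu vv uv uo vo] c.
  have c1 : c (turn_left eps) (turn_left eps) = ncomp (add_edges (G M)
      [:: (pp eps, pp (eps + 1)); (pp (eps + 1 + 1), pp (eps - 1));
          (qq eps, qq (eps + 1)); (qq (eps + 1 + 1), qq (eps - 1))]).
    apply: two => [k|k|]; last (split; assumption); case: (ord4_cases eps k) => ->; rewrite ?L0 ?L1 ?L2 ?L3;
      apply: linked_edge_or; rewrite !inE !eqxx ?orbT; exact: isT.
  have c2 : c (turn_left eps) (turn_right eps) = ncomp (add_edges (G M)
      [:: (pp eps, pp (eps + 1)); (pp (eps + 1 + 1), pp (eps - 1));
          (qq eps, qq (eps - 1)); (qq (eps + 1), qq (eps + 1 + 1))]).
    apply: two => [k|k|]; last (split; assumption); case: (ord4_cases eps k) => ->; rewrite ?L0 ?L1 ?L2 ?L3 ?R0 ?R1 ?R2 ?R3;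
      apply: linked_edge_or; rewrite !inE !eqxx ?orbT; exact: isT.
  have c3 : c (turn_right eps) (turn_right eps) = ncomp (add_edges (G M)
      [:: (pp eps, pp (eps - 1)); (pp (eps + 1), pp (eps + 1 + 1));
          (qq eps, qq (eps - 1)); (qq (eps + 1), qq (eps + 1 + 1))]).
    apply: two => [k|k|]; last (split; assumption); case: (ord4_cases eps k) => ->; rewrite ?R0 ?R1 ?R2 ?R3;
      apply: linked_edge_or; rewrite !inE !eqxx ?orbT; exact: isT.
  have c4 : c (turn_right eps) (turn_left eps) = ncomp (add_edges (G M)
      [:: (pp eps, pp (eps - 1)); (pp (eps + 1), pp (eps + 1 + 1));
          (qq eps, qq (eps + 1)); (qq (eps + 1 + 1), qq (eps - 1))]).
    apply: two => [k|k|]; last (split; assumption); case: (ord4_cases eps k) => ->; rewrite ?L0 ?L1 ?L2 ?L3 ?R0 ?R1 ?R2 ?R3;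
      apply: linked_edge_or; rewrite !inE !eqxx ?orbT; exact: isT.
  have c5 : c straight straight = ncomp (add_edges (G M)
      [:: (pp eps, pp (eps + 1 + 1)); (pp (eps + 1), pp (eps - 1));
          (qq eps, qq (eps + 1 + 1)); (qq (eps + 1), qq (eps - 1))]).
    apply: two => [k|k|]; last (split; assumption); case: (ord4_cases eps k) => ->; rewrite ?S0 ?S1 ?S2 ?S3;
      apply: linked_edge_or; rewrite !inE !eqxx ?orbT; exact: isT.
  have r1 := ncomp_r2_aa uu vv uv uo vo; rewrite -c1 in r1.
  have r2 := ncomp_r2_circle uu vv uv uo vo; rewrite -c2 in r2.
  have r3 := ncomp_r2_bb uu vv uv uo vo; rewrite -c3 in r3.
  have r4 := ncomp_r2_ba uu vv uv uo vo; rewrite -c4 in r4.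
  have r5 := ncomp_r2_straight uu vv uv uo vo; rewrite -c5 in r5.
  split.
  - exact: (succn_inj (etrans r1 (esym r2))).
  - exact: (succn_inj (succn_inj (etrans r3 (esym r1)))).
  - exact: (succn_inj (succn_inj (etrans r4 (esym r5)))).
rewrite -![fupdate (fupdate sg _ _) _ _]/(st _ _).
have e1 : S (st (turn_left eps) (turn_right eps)) = delta * S (st (turn_left eps) (turn_left eps)).
  rewrite fsumZ; apply: eq_fsum => [d m|M bs]; first exact: erefl.
  have [E _ _] := NM M bs; rewrite -E; exact: exprS.
have e2 : S (st (turn_right eps) (turn_right eps)) = S (st (turn_left eps) (turn_left eps)).
  apply: eq_fsum => [d m|M bs]; first exact: erefl.
  have [_ E _] := NM M bs; exact: (congr1 (fun k => delta ^+ k) E).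
have e3 : S (st (turn_right eps) (turn_left eps)) = S (st straight straight).
  apply: eq_fsum => [d m|M bs]; first exact: erefl.
  have [_ _ E] := NM M bs; exact: (congr1 (fun k => delta ^+ k) E).
rewrite e1 e2 e3; have [w1 w2] := turn_weights eps.
move: (S (st straight straight)) (S (st (turn_left eps) (turn_left eps))) w1 w2 => s2 s1; move: (left_weight eps) (right_weight eps) delta => l r dl w1 w2.
have -> : l * (l * s1 + r * s2) + r * (l * (dl * s1) + r * s1) =
  (l ^+ 2 + r ^+ 2) * s1 + (l * r) * s2 + (l * r) * (dl * s1) by ring.
by rewrite w1 w2; ring.
Qed.

End Net.

Lemma basisP (B : finType) (m m' : pairing B) : basis m m' != 0 -> m' = m.
Proof. by rewrite ffunE; case: (m' =P m) => // _; rewrite eqxx. Qed.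

Lemma straightK : involutive straight.
Proof. by move=> k; have [-> -> _ _] := straightE k. Qed.

Lemma inv_weights_update (T B : finType) (x : T -> skein B) t0 (m : pairing B) : inv_weights x ->
  involutive m -> inv_weights (update x t0 (basis m)).
Proof.
by move=> xK mK t m'; rewrite /update; case: (t =P t0) => [_ /basisP->|_ /xK].
Qed.

(** * Sliding a cup through a grid *)

Section Ladder.
Variables (T1 T2 : finType) (n : nat).
Local Notation pt := (T1 * 'I_4 + T2 * tl_points n)%type.
Variable W : pt -> pt.
Hypothesis WK : involutive W.
Variables (P Q : nat -> T1) (N : nat) (eps : 'I_4) (d : T2) (p q : tl_points n).
Hypothesis P_inj : forall i j, (i < N)%N -> (j < N)%N -> P i = P j -> i = j.
Hypothesis Q_inj : forall i j, (i < N)%N -> (j < N)%N -> Q i = Q j -> i = j.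
Hypothesis PQ_neq : forall i j, (i < N)%N -> (j < N)%N -> P i <> Q j.
Let topP j : pt := if (j < N)%N then inl (P j, eps) else inr (d, p).
Let topQ j : pt := if (j < N)%N then inl (Q j, eps) else inr (d, q).
Hypothesis WPQ : forall j, (j < N)%N -> W (inl (P j, eps + 1)) = inl (Q j, eps - 1).
Hypothesis WP : forall j, (j < N)%N -> W (inl (P j, eps + 1 + 1)) = topP j.+1.
Hypothesis WQ : forall j, (j < N)%N -> W (inl (Q j, eps + 1 + 1)) = topQ j.+1.
Hypothesis pq : p != q.

(** What the cup has still to pass, and its arc may therefore not run through: the rungs from the
    [j]-th on and the box [d]. *)
Definition ladder_above j : pred (T1 + T2) := fun u =>
  match u with
  | inl t => [exists i : 'I_N, (j <= i)%N && ((t == P i) || (t == Q i))]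
  | inr d' => d' == d
  end.

(* Pulling the cup across the rungs of the ladder, one at a time, brings it to the
   box [d]. *)
Lemma netsum_ladder j x b s : (j <= N)%N -> inv_weights x -> inv_weights b ->
  cap_off p q (b d) = 0 \/ cap_off q p (b d) = 0 ->
  (forall i, (j <= i < N)%N -> x (P i) = crossing /\ x (Q i) = crossing) ->
  arc W x b (ladder_above j) s (topP j) (topQ j) -> netsum W x b = 0.
Proof.
elim: {j}(N - j)%N {-2}j (erefl (N - j)%N) x s => [|k IH] j Nj x s jN xK bK cap0 cr sa.
  have jE : j = N by apply/eqP; rewrite eqn_leq jN -subn_eq0 Nj.
  apply: (netsum_kill WK xK bK pq cap0 (s := s)).
  move: sa; rewrite /topP /topQ jE ltnn; apply: arc_weaken => [t|d'] nD //=.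
have jlt : (j < N)%N by rewrite -subn_gt0 Nj.
have [xP xQ] : x (P j) = crossing /\ x (Q j) = crossing by apply: cr; rewrite leqnn.
have Pj : ladder_above j (inl (P j)).
  by apply/existsP; exists (Ordinal jlt); rewrite /= leqnn eqxx.
have Qj : ladder_above j (inl (Q j)).
  by apply/existsP; exists (Ordinal jlt); rewrite /= leqnn eqxx orbT.
have PQj : P j != Q j by apply/eqP; apply: PQ_neq.
rewrite /topP /topQ jlt in sa.
rewrite (netsum_r2 WK xK bK PQj xP xQ (WPQ jlt) Pj Qj sa).
set x' := update _ _ _.
have nPj : ~~ ladder_above j.+1 (inl (P j)).
  apply/existsP => -[i /andP[ji]]; case/orP=> /eqP e.
    by move: ji; rewrite -(P_inj jlt (ltn_ord i) e) ltnn.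
  by case: (PQ_neq jlt (ltn_ord i) e).
have nQj : ~~ ladder_above j.+1 (inl (Q j)).
  apply/existsP => -[i /andP[ji]]; case/orP=> /eqP e.
    by case: (PQ_neq (ltn_ord i) jlt).
  by move: ji; rewrite -(Q_inj jlt (ltn_ord i) e) ltnn.
have x'P : x' (P j) = basis straight.
  by rewrite /x' /update (negbTE PQj) eqxx.
have x'Q : x' (Q j) = basis straight by rewrite /x' /update eqxx.
(* The arc grows by a straight passage through [P j] at its beginning and one through [Q j] at its
   end. *)
apply: (IH j.+1 _ x' ([:: topP j.+1, inl (P j, eps + 1 + 1) & s] ++
                      [:: inl (Q j, eps + 1 + 1); topQ j.+1])).
- by rewrite subnS Nj.
- exact: jlt.
- do 2 (apply: inv_weights_update; last exact: straightK).
  exact: xK.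
- exact: bK.
- exact: cap0.
- move=> i /andP[ji iN]; rewrite /x' /update.
  have -> : (P i == Q j) = false by apply/eqP => e; apply: (PQ_neq iN jlt).
  have -> : (P i == P j) = false.
    by apply/eqP => e; move: ji; rewrite (P_inj iN jlt e) ltnn.
  have -> : (Q i == Q j) = false.
    by apply/eqP => e; move: ji; rewrite (Q_inj iN jlt e) ltnn.
  have -> : (Q i == P j) = false.
    by apply/eqP => e; apply: (PQ_neq jlt iN); rewrite e.
  by apply: cr; rewrite iN andbT ltnW.
have [S0 S2 _ _] := straightE eps.
have WtP : W (topP j.+1) = inl (P j, eps + 1 + 1) by rewrite -(WP jlt) WK.
apply: (@arc_cat _ _ _ W x' b _ _ _ (inl (Q j, eps)) (inl (Q j, eps + 1 + 1))).
- rewrite -WtP; apply: (@ArcS _ _ _ W x' b _ (topP j.+1) (inl (P j, eps)) s).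
    rewrite WtP /forced; split; [exact: erefl|exact: nPj|].
    by move=> m; rewrite x'P => /basisP->.
  apply: arc_weaken sa => [t nD|d' nD]; last by split.
  have tP : (t == P j) = false by apply: contraNF nD => /eqP->.
  have tQ : (t == Q j) = false by apply: contraNF nD => /eqP->.
  split; last by rewrite /x' /update tP tQ.
  apply: contra nD => /existsP[i /andP[ji e]]; apply/existsP; exists i.
  by rewrite e (ltnW ji).
- rewrite /forced; split; [exact: erefl|exact: nQj|].
  by move=> m; rewrite x'Q => /basisP->.
- by rewrite -(WQ jlt); apply: Arc1.
Qed.

End Ladder.

(** * Inserting the idempotent *)

Section Insert.
Variables (T1 T2 : finType) (n : nat).
Variable W : (T1 * 'I_4 + T2 * tl_points n) -> (T1 * 'I_4 + T2 * tl_points n).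

Definition tl_idp : pairing (tl_points n) :=
  [ffun u => match u with inl i => inr i | inr i => inl i end].

Lemma netsum_expand x b d : netsum W x b =
  \sum_m b d m * netsum W x (update b d (basis m)).
Proof.
rewrite /netsum.
under [RHS]eq_bigr do rewrite fsumZ.
rewrite fsum_sum; apply: eq_fsum => // sg _.
rewrite (fsum_int _ _ d tl_idp).
under [RHS]eq_bigr => m _ do rewrite (fsum_int _ _ d tl_idp) fsumZ.
rewrite (eq_bigr (fun m => fsum (update (fun d => b d : pairing (tl_points n) -> QA) d (fun a => (a == tl_idp)%:R))
  (fun M => b d m * delta ^+ ncomp (net_graph W sg (fupdate M d m))))); last first.
  move=> m _; apply: eq_fsum => [d' m'|M _].
    by rewrite /update; case: (d' == d).
  by rewrite /update eqxx sum_basis.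
by rewrite fsum_sum.
Qed.

(** Of the expansion of [f] only the identity diagram survives, with coefficient 1. Read from right
    to left, it creates a copy of [f]. *)
Lemma netsum_insert x (b : T2 -> skein (tl_points n)) d (f : skein (tl_points n)) : f tl_idp = 1 -> b d = f ->
  (forall m, f m != 0 -> m != tl_idp -> netsum W x (update b d (basis m)) = 0) ->
  netsum W x b = netsum W x (update b d (tl_id n)).
Proof.
move=> f1 bd kill; rewrite (netsum_expand x b d) (bigD1 tl_idp) //= bd f1 mul1r.
rewrite big1 ?addr0 // => m nm; have [->|fm] := eqVneq (f m) 0; first by rewrite mul0r.
by rewrite kill ?mulr0.
Qed.

End Insert.

Local Close Scope ring_scope.

(** * Caps in planar diagrams *)

Section TLDiagrams.
Variable n : nat.
Implicit Type m : pairing (tl_points n).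

(** Strict monotonicity gives i <= g i, and conjugation by [rev_ord] gives the opposite
    inequality. *)
Lemma increasing_ord (g : 'I_n -> 'I_n) :
  (forall i j : 'I_n, i < j -> g i < g j) -> forall i, g i = i.
Proof.
have ge (h : 'I_n -> 'I_n) : (forall i j : 'I_n, i < j -> h i < h j) -> forall i : 'I_n, i <= h i.
  move=> hmono [i]; elim: i => //= i IH iN.
  have iN' : i < n by apply: ltnW.
  by apply: leq_ltn_trans (IH iN') _; apply: hmono.
move=> gm i; apply: val_inj; apply/eqP; rewrite eqn_leq (ge g gm) andbT.
have := ge (fun i => rev_ord (g (rev_ord i))) _ (rev_ord i).
rewrite rev_ordK /= => H.
have {}H : n - i.+1 <= n - (g i).+1.
  by apply: H => a b ab /=; have := gm (rev_ord b) (rev_ord a); rewrite /=;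
     have := ltn_ord a; have := ltn_ord b; have := ltn_ord (g (rev_ord a));
     have := ltn_ord (g (rev_ord b)); lia.
by have := ltn_ord i; have := ltn_ord (g i); lia.
Qed.

(** An innermost arc between two top points joins neighbours. Without any arc between top points all
    strands run from top to bottom, in increasing order by planarity, which leaves only the
    identity. *)
Lemma tl_top_cap m : tl_diagram m -> m <> tl_idp n ->
  exists a b : 'I_n, b = a.+1 :> nat /\ m (inl a) = inl b.
Proof.
move=> [mK mN mP] m1.
suff inner k (i j : 'I_n) : j - i <= k -> i < j -> m (inl i) = inl j ->
    exists a b : 'I_n, b = a.+1 :> nat /\ m (inl a) = inl b.
  have [/existsP[i /existsP[j /eqP mij]]|none] :=
      boolP [exists i, [exists j, m (inl i) == inl j]].
    have := mN (inl i); rewrite mij; case: (ltngtP i j) => [ij _|ji _|/val_inj-> /eqP //].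
      exact: inner mij.
    by apply: (inner _ j i (leqnn _) ji); rewrite -mij mK.
  have top i : {j | m (inl i) = inr j}.
    case mi : (m (inl i)) => [j|j]; last by exists j.
    by case/existsP: none; exists i; apply/existsP; exists j; apply/eqP.
  pose g i := sval (top i); have gE i : m (inl i) = inr (g i) := svalP (top i).
  have g1 : forall i, g i = i.
    apply: increasing_ord => i j ij.
    have gij : g i != g j.
      apply/eqP => e; have : m (inl i) = m (inl j) by rewrite !gE e.
      by move/(inv_inj mK) => [e']; rewrite e' ltnn in ij.
    have := mP (inl i) (inl j); rewrite !gE /= ij /=.
    have := ltn_ord (g i); have := ltn_ord (g j); have := ltn_ord j.
    by move: gij; rewrite -val_eqE /= => *; lia.
  case: m1; apply/ffunP => -[i|i]; rewrite ffunE; first by rewrite gE g1.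
  by rewrite -{1}(g1 i) -gE mK.
elim: k i j => [|k IH] i j; first by lia.
move=> jik ij mij; have [ji|ji] := eqVneq (j : nat) i.+1; first by exists i, j.
have cn : i.+1 < n by have := ltn_ord j; lia.
pose c := Ordinal cn.
have nci : m (inl c) != inl i.
  by apply/eqP => e; have := mij; rewrite -e mK => -[] /(congr1 val) /= ; lia.
have ncj : m (inl c) != inl j.
  apply/eqP => e; have : m (inl c) = m (inl i) by rewrite e mij.
  by move/(inv_inj mK) => [] /(congr1 val) /=; lia.
have ncc := mN (inl c).
have := mP (inl i) (inl c); have := mP (m (inl c)) (inl i); rewrite mK mij /=.
case mc : (m (inl c)) ncc nci ncj => [c'|c'] /=.
  rewrite !(inj_eq (@inl_inj _ _)) -!val_eqE /= => h1 h2 h3 h4 h5.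
  apply: (IH c c') mc => /=; lia.
have := ltn_ord c'; have := ltn_ord j; lia.
Qed.

(** The reflection exchanging top and bottom; it reverses [tl_pos] and so preserves planarity. *)
Definition tl_flip m : pairing (tl_points n) :=
  [ffun u => tl_idp n (m (tl_idp n u))].

Lemma tl_idpK : involutive (tl_idp n).
Proof. by case=> i; rewrite !ffunE. Qed.

Lemma tl_flipE m u : tl_flip m u = tl_idp n (m (tl_idp n u)).
Proof. by rewrite ffunE. Qed.

Lemma tl_flip_diagram m : tl_diagram m -> tl_diagram (tl_flip m).
Proof.
have posE u : tl_pos (tl_idp n u) = (n + n - (tl_pos u).+1)%N.
  by case: u => i; rewrite ffunE /=; have := ltn_ord i; lia.
have pos_lt u : (tl_pos (u : tl_points n) < n + n)%N.
  by case: u => i /=; have := ltn_ord i; lia.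
move=> [mK mN mP]; split=> [u|u|u v].
- by rewrite !tl_flipE tl_idpK mK tl_idpK.
- apply/eqP; rewrite tl_flipE => e; have := mN (tl_idp n u).
  by rewrite -{2}e tl_idpK eqxx.
rewrite !tl_flipE; have := mP (m (tl_idp n v)) (m (tl_idp n u)).
rewrite !mK !posE.
have := pos_lt u; have := pos_lt v; have := pos_lt (m (tl_idp n u)).
have := pos_lt (m (tl_idp n v)).
move: (tl_pos u) (tl_pos v) (tl_pos (m _)) (tl_pos (m _)) => a b c d; lia.
Qed.

Lemma tl_bottom_cap m : tl_diagram m -> m <> tl_idp n ->
  exists a b : 'I_n, b = a.+1 :> nat /\ m (inr a) = inr b.
Proof.
move=> mD m1; have [|a [b [ab]]] := @tl_top_cap (tl_flip m) (tl_flip_diagram mD).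
  move=> e; case: m1; apply/ffunP => u.
  have := congr1 (fun h : pairing _ => tl_idp n (h (tl_idp n u))) e.
  by rewrite /= tl_flipE !tl_idpK.
move=> e; exists a, b; split=> //.
have := congr1 (tl_idp n) e; rewrite tl_flipE tl_idpK.
by rewrite !ffunE /= => ->.
Qed.

End TLDiagrams.

Local Open Scope ring_scope.

Definition kills_caps (n : nat) (f : skein (tl_points n)) : Prop :=
  forall a b : 'I_n, b = a.+1 :> nat ->
    cap_off (inl a) (inl b) f = 0 /\ cap_off (inr a) (inr b) f = 0.

(** * Order at [A = 0] *)

Lemma fractionP (R : idomainType) (P : {fraction R}) : exists p q : R, q != 0 /\ P = tofrac p / tofrac q.
Proof.
elim/quotW: P => x; exists x.1, x.2.
split; first by case: x.
apply: (@mulIf _ (tofrac x.2)); first by rewrite tofrac_eq0; case: x.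
rewrite divfK; last by rewrite tofrac_eq0; case: x.
have E y : FracField.tofrac y = (\pi_(FracField.type R) (Ratio y 1))%qT.
  by unlock FracField.tofrac.
rewrite !E -[LHS]/(FracField.mul _ _) -(FracField.pi_mul x (Ratio x.2 1)).
apply/eqmodP.
rewrite /= FracField.equivfE /FracField.mulf.
case: x => [[p q] /= q0].
rewrite !numden_Ratio ?mulf_neq0 ?oner_neq0 //=.
by rewrite !mulr1 mulrC.
Qed.

(* [vge k P]: the Laurent expansion of [P] only involves powers [A^i] with [i >= k]. *)
Definition vge (k : int) (P : QA) : Prop :=
  exists p q : {poly rat}, q`_0 != 0 /\ P = varA ^ k * (tofrac p / tofrac q).

Definition vexact (k : int) (P : QA) : Prop :=
  exists p q : {poly rat}, [/\ p`_0 != 0, q`_0 != 0 & P = varA ^ k * (tofrac p / tofrac q)].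

Lemma coef0_neq0 (q : {poly rat}) : q`_0 != 0 -> tofrac q != 0 :> QA.
Proof. by apply: contraNneq => /eqP; rewrite tofrac_eq0 => /eqP->; rewrite coef0. Qed.

Lemma varAX n : varA ^+ n = tofrac 'X^n.
Proof. by rewrite tofracXn. Qed.

Lemma varA_expD (k l : int) : varA ^ (k + l) = varA ^ k * varA ^ l.
Proof. by rewrite expfzDr ?varA_neq0. Qed.

Lemma vexact_vge k P : vexact k P -> vge k P.
Proof. by case=> p [q [_ q0 ->]]; exists p, q. Qed.

Lemma vge0 k : vge k 0.
Proof. by exists 0, 1; rewrite coef1 oner_eq0 tofrac0 mul0r mulr0. Qed.

Lemma vexactA k : vexact k (varA ^ k).
Proof. by exists 1, 1; rewrite coef1 oner_eq0 tofrac1 divr1 mulr1. Qed.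

Lemma vgeA k : vge k (varA ^ k). Proof. exact/vexact_vge/vexactA. Qed.

Lemma vexact1 : vexact 0 1. Proof. exact: (vexactA 0). Qed.

Lemma vge_weak k l P : l <= k -> vge k P -> vge l P.
Proof.
move=> lk [p [q [q0 ->]]].
have -> : k = l + `|k - l|%N by lia.
rewrite varA_expD; exists ('X^(`|k - l|%N) * p), q; split=> //.
by rewrite tofracM -varAX -!mulrA.
Qed.

Lemma vgeD k P Q : vge k P -> vge k Q -> vge k (P + Q).
Proof.
move=> [p [q [q0 ->]]] [r [s [s0 ->]]]; exists (p * s + r * q), (q * s).
rewrite coef0M mulf_neq0 //; split=> //; rewrite -mulrDr; congr (_ * _).
by rewrite tofracD !tofracM addf_div // coef0_neq0.
Qed.

Lemma vgeM k l P Q : vge k P -> vge l Q -> vge (k + l) (P * Q).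
Proof.
move=> [p [q [q0 ->]]] [r [s [s0 ->]]]; exists (p * r), (q * s).
rewrite coef0M mulf_neq0 //; split=> //.
by rewrite varA_expD mulrACA !tofracM mulf_div.
Qed.

Lemma vexactM k l P Q : vexact k P -> vexact l Q -> vexact (k + l) (P * Q).
Proof.
move=> [p [q [p0 q0 ->]]] [r [s [r0 s0 ->]]]; exists (p * r), (q * s).
rewrite !coef0M !mulf_neq0 //; split=> //.
by rewrite varA_expD mulrACA !tofracM mulf_div.
Qed.

Lemma vgeN k P : vge k P -> vge k (- P).
Proof.
by move=> [p [q [q0 ->]]]; exists (- p), q; rewrite tofracN mulNr mulrN.
Qed.

Lemma vge_sum (I : finType) (D : pred I) k (F : I -> QA) :
  (forall i, D i -> vge k (F i)) -> vge k (\sum_(i | D i) F i).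
Proof. by move=> h; elim/big_ind: _ => //; [exact: vge0|exact: vgeD]. Qed.

Lemma vgeX k P n : vge k P -> vge (k *+ n) (P ^+ n).
Proof.
move=> h; elim: n => [|n IH]; first exact: (vgeA 0).
by rewrite exprS mulrS; apply: vgeM.
Qed.

Lemma vexactX k P n : vexact k P -> vexact (k *+ n) (P ^+ n).
Proof.
move=> h; elim: n => [|n IH]; first exact: vexact1.
by rewrite exprS mulrS; apply: vexactM.
Qed.

Lemma vexactD k P Q : vexact k P -> vge (k + 1) Q -> vexact k (P + Q).
Proof.
move=> [p [q [p0 q0 ->]]] [r [s [s0 ->]]]; exists (p * s + 'X * r * q), (q * s).
rewrite coefD !coef0M coefX /= !mul0r addr0 !mulf_neq0 //; split=> //.
rewrite varA_expD -mulrA -mulrDr; congr (_ * _).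
by rewrite tofracD !tofracM expr1z [varA * _]mulrA addf_div ?coef0_neq0.
Qed.

Lemma vexact_neq0 k P : vexact k P -> P != 0.
Proof.
case=> p [q [p0 q0 ->]]; rewrite !mulf_neq0 ?invr_eq0 ?coef0_neq0 //.
by rewrite expfz_neq0 ?varA_neq0.
Qed.

Lemma vexactV k P : vexact k P -> vexact (- k) P^-1.
Proof.
case=> p [q [p0 q0 ->]]; exists q, p; split=> //.
by rewrite invfM -invr_expz invf_div invr_expz.
Qed.

Lemma vexact_delta : vexact (- 2) delta.
Proof.
exists (- (1 + 'X^4)), 1; split; first by rewrite coefN coefD coef1 coefXn addr0 oppr_eq0 oner_eq0.
  by rewrite coef1 oner_eq0.
rewrite tofrac1 divr1 tofracN tofracD tofrac1 -varAX /delta mulrN mulrDr mulr1.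
have -> : varA ^ (-2 : int) = varA ^- 2 by rewrite -exprz_inv -exprVn.
by rewrite (exprD _ 2 2) mulrA mulVf ?expf_neq0 ?varA_neq0 // mul1r opprD addrC.
Qed.

Lemma vexact_exists P : P != 0 -> exists k, vexact k P.
Proof.
have poly (p : {poly rat}) : p != 0 -> exists k, vexact k (tofrac p).
  move=> p0; pose j := find (fun x => x != 0) p.
  have hp : has (fun x => x != 0) p.
    apply/hasP; exists (lead_coef p); last by rewrite lead_coef_eq0.
    by rewrite /lead_coef mem_nth // prednK // size_poly_gt0.
  have pj : p`_j != 0 by apply: (nth_find 0 hp).
  have lt i : (i < j)%N -> p`_i = 0 by move=> ij; apply/eqP; have := before_find 0 ij; move/negbFE.
  exists (j : int), (\poly_(i < size p) p`_(i + j)), 1; rewrite coef1 oner_eq0; split=> //.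
    by rewrite coef_poly size_poly_gt0 p0 add0n.
  rewrite tofrac1 divr1 -exprnP varAX -tofracM; congr tofrac; apply/polyP => i.
  rewrite coefXnM; case: ltnP => [/lt //|ji]; rewrite coef_poly subnK //.
  by case: ltnP => // h; rewrite nth_default // (leq_trans h) // leq_subr.
have [p [q [q0 ->]]] := fractionP P.
rewrite mulf_eq0 invr_eq0 !tofrac_eq0 negb_or => /andP[p0 _].
have [k kp] := poly p p0; have [l lq] := poly q q0.
exists (k - l); apply: vexactM kp _; exact: vexactV.
Qed.

Lemma vge_any P : exists k, vge k P.
Proof.
have [->|/vexact_exists[k /vexact_vge h]] := eqVneq P 0; first by exists 0; apply: vge0.
by exists k.
Qed.

Lemma vge_common (I : finType) (F : I -> QA) : exists k, forall i, vge k (F i).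
Proof.
suff [k hk] : exists k, {in enum I, forall i, vge k (F i)}.
  by exists k => i; apply: hk; rewrite mem_enum.
elim: (enum I) => [|i s [k IH]]; first by exists 0.
have [l hl] := vge_any (F i); exists (Num.min k l) => j; rewrite inE => /predU1P[->|js].
  by apply: vge_weak hl; rewrite ge_min lexx orbT.
by apply: vge_weak (IH j js); rewrite ge_min lexx.
Qed.

Lemma vge_vexact k l P : vexact k P -> vge l P -> l <= k.
Proof.
move=> [p [q [p0 q0 ->]]] [r [s [s0 E]]]; rewrite leNgt; apply/negP => kl.
have {}E : varA ^ (l - k) * tofrac (r * q) = tofrac (p * s).
  rewrite !tofracM; apply: (@mulfI _ (varA ^ k)); first by rewrite expfz_neq0 ?varA_neq0.
  rewrite mulrA -varA_expD addrC subrK.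
  apply: (@mulIf _ (tofrac q * tofrac s)^-1); first by rewrite invr_eq0 mulf_neq0 ?coef0_neq0.
  have -> : varA ^ k * (tofrac p * tofrac s) / (tofrac q * tofrac s) = varA ^ k * (tofrac p / tofrac q).
    by rewrite -mulrA -mulf_div divff ?coef0_neq0 ?mulr1.
  rewrite E -mulrA; congr (_ * _).
  by rewrite (mulrC (tofrac q)) -mulf_div divff ?coef0_neq0 ?mulr1.
have lkE : l - k = `|l - k|%N by lia.
move: E; rewrite lkE -exprnP varAX -tofracM => /eqP; rewrite tofrac_eq => /eqP E.
have := congr1 (fun u : {poly rat} => u`_0) E.
rewrite coefXnM coef0M /=; have -> : (0 < `|l - k|)%N by lia.
by move/eqP; rewrite eq_sym mulf_eq0 (negbTE p0) (negbTE s0).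
Qed.

Lemma vge_all_eq0 P : (forall k, vge k P) -> P = 0.
Proof.
move=> h; apply/eqP; apply: contraT => /vexact_exists[k kP].
by have h1 := vge_vexact kP (h (k + 1)); exfalso; lia.
Qed.

(** * Power series expansions *)

Section Expansion.
Variables p q : {poly rat}.

(** Division of power series. The list of all previous coefficients is carried along because the
    next one depends on every one of them. *)
Fixpoint exp_coefs (n : nat) : seq rat :=
  if n is n'.+1 then
    let s := exp_coefs n' in
    rcons s ((p`_n' - \sum_(j < n') q`_j.+1 * s`_(n' - j.+1)) / q`_0)
  else [::].

Definition exp_coef (n : nat) : rat := (exp_coefs n.+1)`_n.

Lemma size_exp_coefs n : size (exp_coefs n) = n.
Proof. by elim: n => //= n IH; rewrite size_rcons IH. Qed.

Lemma nth_exp_coefs n i : (i < n)%N -> (exp_coefs n)`_i = exp_coef i.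
Proof.
elim: n => // n IH; rewrite ltnS leq_eqVlt => /predU1P[->//|lt] /=.
by rewrite nth_rcons size_exp_coefs lt IH.
Qed.

Lemma exp_coefE (q0 : q`_0 != 0) i : p`_i = \sum_(j < i.+1) q`_j * exp_coef (i - j)%N.
Proof.
rewrite big_ord_recl /= subn0 {1}/exp_coef /= nth_rcons size_exp_coefs ltnn eqxx.
rewrite mulrC divfK // -{1}[p`_i](subrK (\sum_(j < i) q`_j.+1 * (exp_coefs i)`_(i - j.+1))).
congr (_ + _); apply: eq_bigr => j _; rewrite nth_exp_coefs //.
by rewrite ltn_subrL /= (leq_ltn_trans _ (ltn_ord j)).
Qed.

End Expansion.

Lemma expands_exp_coef (p q : {poly rat}) : q`_0 != 0 ->
  expands (tofrac p / tofrac q) (exp_coef p q).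
Proof. by move=> q0; exists p, q; split=> // i; apply: exp_coefE. Qed.

Lemma exp_coef0 (p q : {poly rat}) : q`_0 != 0 -> exp_coef p q 0 = p`_0 / q`_0.
Proof.
by move=> q0; rewrite (exp_coefE p q0 0) big_ord_recl big_ord0 addr0 /= mulrC mulKf.
Qed.

(** The fraction on the left is p/q + X^m r/s. The difference of the two expansions, truncated at m,
    is annihilated by [q * s] modulo X^m, and the constant term of [q * s] is invertible. *)
Lemma exp_coef_eq (p q r s : {poly rat}) m : q`_0 != 0 -> s`_0 != 0 ->
  forall i, (i < m)%N -> exp_coef (p * s + 'X^m * r * q) (q * s) i = exp_coef p q i.
Proof.
move=> q0 s0; set p' := _ + _; set q' := q * s.
have q'0 : q'`_0 != 0 by rewrite coef0M mulf_neq0.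
pose C1 := \poly_(i < m) exp_coef p' q' i; pose C2 := \poly_(i < m) exp_coef p q i.
have trunc (u v : {poly rat}) : u`_0 != 0 -> forall i, (i < m)%N ->
    (u * \poly_(j < m) exp_coef v u j)`_i = v`_i.
  move=> u0 i im; rewrite coefM (exp_coefE v u0); apply: eq_bigr => j _.
  by rewrite coef_poly (leq_ltn_trans (leq_subr _ _) im).
have h1 : forall i, (i < m)%N -> (q' * C1)`_i = p'`_i by apply: trunc.
have h2 : forall i, (i < m)%N -> (q' * C2)`_i = p'`_i.
  move=> i im; rewrite /q' (mulrC q) -mulrA coefD -mulrA coefXnM im addr0 (mulrC p) !coefM.
  apply: eq_bigr => j _; congr (_ * _); apply: trunc => //.
  exact: leq_ltn_trans (leq_subr _ _) im.
have D0 : forall i, (i < m)%N -> (C1 - C2)`_i = 0.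
  move=> i; elim/ltn_ind: i => i IH im.
  have : (q' * (C1 - C2))`_i = 0 by rewrite mulrBr coefB h1 // h2 // subrr.
  rewrite coefM big_ord_recl /= subn0 big1 ?addr0 => [/eqP|j _].
    by rewrite mulf_eq0 (negbTE q'0) => /eqP.
  rewrite IH ?mulr0 //.
    by rewrite ltn_subrL /= (leq_ltn_trans _ (ltn_ord j)).
  exact: leq_ltn_trans (leq_subr _ _) im.
move=> i im; have := D0 i im; rewrite coefB !coef_poly im => /eqP.
by rewrite subr_eq0 => /eqP.
Qed.

(** The form in which the theorem is reached: the remainder [R] starts m powers above [U] and cannot
    touch its first m coefficients. *)
Lemma doteq_vexact (m : nat) (j k : int) (P U R : QA) : (0 < m)%N ->
  vexact k U -> vge (k + m) R -> P = varA ^ j * (U + R) -> doteq m P U.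
Proof.
move=> m0 [p [q [p0 q0 ->]]] [r [s [s0 ->]]] ->.
(* These shifts make both series start in degree 0; the common sign is plus. *)
exists (- k - j), (- k), (exp_coef (p * s + 'X^m * r * q) (q * s)), (exp_coef p q), false.
have qs0 : (q * s)`_0 != 0 by rewrite coef0M mulf_neq0.
split.
- have -> : varA ^ (- k - j) * (varA ^ j * (varA ^ k * (tofrac p / tofrac q) +
      varA ^ (k + m) * (tofrac r / tofrac s))) =
      tofrac (p * s + 'X^m * r * q) / tofrac (q * s).
    rewrite [varA ^ (k + m)]varA_expD -[varA ^ k * varA ^ m * _]mulrA -mulrDr varA_expD.
    have -> : forall x : QA, varA ^ (- k) * varA ^ (- j) * (varA ^ j * (varA ^ k * x)) = x.
      by move=> x; rewrite !mulrA -!varA_expD subrK addNr mul1r.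
    rewrite tofracD !tofracM -varAX -exprnP mulrA addf_div ?coef0_neq0 //.
  exact: expands_exp_coef.
- rewrite mulrA -varA_expD addNr mul1r; exact: expands_exp_coef.
- by rewrite exp_coef_eq // exp_coef0 // mulf_neq0 ?invr_eq0.
- by rewrite exp_coef0 // mulf_neq0 ?invr_eq0.
- by move=> i im; rewrite expr0 mul1r exp_coef_eq.
Qed.

Local Close Scope ring_scope.

(** * Surgeries *)

Section Surgery.
Variables (V : finType) (W g g1 : V -> V) (a b c d : V).
Hypotheses (ga : g a = b) (gb : g b = a) (gc : g c = d) (gd : g d = c).
Hypotheses (g1a : g1 a = c) (g1c : g1 c = a) (g1b : g1 b = d) (g1d : g1 d = b).
Hypothesis gg1 : forall z, z \notin [:: a; b; c; d] -> g z = g1 z.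

Let G (h : V -> V) : rel V := fun z z' => (z' == W z) || (z' == h z).
Let e : rel V := fun z z' => (z' == W z) || (z' == g z) && (z \notin [:: a; b; c; d]).

Let Ge : ncomp (G g) = ncomp (add_edge (add_edge e a b) c d).
Proof.
apply: eq_ncomp => z z'.
  case/orP=> /eqP->; first by do 2 apply: linked_add_edge; apply: linked1; rewrite /e eqxx.
  have [|nz] := boolP (z \in [:: a; b; c; d]); last first.
    by do 2 apply: linked_add_edge; apply: linked1; rewrite /e eqxx nz orbT.
  rewrite !inE; case/or4P=> /eqP->; rewrite ?ga ?gb ?gc ?gd.
  - apply: linked_add_edge; exact: linked_new_edge.
  - apply: linked_add_edge; rewrite linkedC; exact: linked_new_edge.
  - exact: linked_new_edge.
  - rewrite linkedC; exact: linked_new_edge.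
move=> /= /orP[/orP[|]|].
- by case/orP=> [/eqP->|/andP[/eqP-> _]]; apply: linked1; rewrite /G eqxx ?orbT.
- by case/andP=> /eqP-> /eqP->; apply: linked1; rewrite /G ga eqxx orbT.
- by case/andP=> /eqP-> /eqP->; apply: linked1; rewrite /G gc eqxx orbT.
Qed.

Let linkG1 z z' : linked (G g1) z z' -> linked (add_edge (add_edge e a c) b d) z z'.
Proof.
apply: linked_sub => {z z'} z z'.
case/orP=> /eqP->; first by do 2 apply: linked_add_edge; apply: linked1; rewrite /e eqxx.
have [|nz] := boolP (z \in [:: a; b; c; d]); last first.
  by do 2 apply: linked_add_edge; apply: linked1; rewrite /e gg1 // eqxx nz orbT.
rewrite !inE; case/or4P=> /eqP->; rewrite ?g1a ?g1b ?g1c ?g1d.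
- apply: linked_add_edge; exact: linked_new_edge.
- exact: linked_new_edge.
- apply: linked_add_edge; rewrite linkedC; exact: linked_new_edge.
- rewrite linkedC; exact: linked_new_edge.
Qed.

Let link1G z z' : linked (add_edge (add_edge e a c) b d) z z' -> linked (G g1) z z'.
Proof.
apply: linked_sub => {z z'} z z' /= /orP[/orP[|]|].
- case/orP=> [/eqP->|/andP[/eqP-> nz]]; apply: linked1; first by rewrite /G eqxx.
  by rewrite /G gg1 // eqxx orbT.
- by case/andP=> /eqP-> /eqP->; apply: linked1; rewrite /G g1a eqxx orbT.
- by case/andP=> /eqP-> /eqP->; apply: linked1; rewrite /G g1b eqxx orbT.
Qed.

Let Ge1 : ncomp (G g1) = ncomp (add_edge (add_edge e a c) b d).
Proof.
by apply: eq_ncomp => x y /linked1; [apply: linkG1|apply: link1G].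
Qed.

Lemma surgery_le : ncomp (G g) <= (ncomp (G g1)).+1.
Proof.
rewrite Ge Ge1; exact: ncomp_surgery.
Qed.

Hypotheses (WK : involutive W) (WN : forall z, W z != z).
Hypotheses (g1K : involutive g1) (g1N : forall z, g1 z != z).

(** The perfect matchings [W] and [g1] form a union of cycles. The edges from [a] to [c] and from
    [b] to [d] lie on different cycles, so that deleting both still leaves [a] linked to [c] and [b]
    to [d], and [g] fuses the two cycles. *)
Lemma surgery_merge : ~~ linked (G g1) a b -> (ncomp (G g)).+1 = ncomp (G g1).
Proof.
move=> nab.
(* [no_bridge] removes only the edge from [u] to [v]; the other missing edge is never met, since
   [u'] and [v'] lie in another component. *)
have half u v u' v' : g1 u = v -> g1 u' = v' -> g1 v' = u' ->
    ~~ linked (G g1) u u' -> ~~ linked (G g1) u v' ->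
    (forall z, z \in [:: a; b; c; d] -> z \in [:: u; v; u'; v']) -> linked e u v.
  move=> uv uv' vu' nu' nv' es; have := no_bridge u WK WN g1K g1N; rewrite uv.
  set nb := [rel z z' | _] => luv.
  pose P z := linked e u z && linked (G g1) u z.
  suff : P v by case/andP.
  apply: (@linked_ind _ nb P u _ _ v luv); first by rewrite /P !linked0.
  have one y z : nb y z -> P y || P z -> linked e y z /\ linked (G g1) y z.
    case/orP=> [/eqP-> _|/andP[/eqP-> yuv] Pyz].
      by split; apply: linked1; rewrite /e /G eqxx.
    have lG : linked (G g1) y (g1 y) by apply: linked1; rewrite /G eqxx orbT.
    split=> //; have uy : linked (G g1) u y.
      case/orP: Pyz => /andP[_ //] h; apply: linked_trans h _; by rewrite linkedC.
    have nz : y \notin [:: a; b; c; d].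
      apply/negP => /es; move: yuv; rewrite !inE negb_or => /andP[/negbTE-> /negbTE->] /=.
      by case/orP=> /eqP yE; rewrite -yE uy in nu' nv'.
    by apply: linked1; rewrite /e gg1 // eqxx nz orbT.
  move=> y z /orP[yz|zy] Py.
    have [|h1 h2] := one y z yz; first by rewrite Py.
    case/andP: Py => Py1 Py2; apply/andP; split; first exact: linked_trans Py1 h1.
    exact: linked_trans Py2 h2.
  have [|h1 h2] := one z y zy; first by rewrite Py orbT.
  rewrite linkedC in h1; rewrite linkedC in h2.
  case/andP: Py => Py1 Py2; apply/andP; split; first exact: linked_trans Py1 h1.
  exact: linked_trans Py2 h2.
have lac : linked (G g1) a c by apply: linked1; rewrite /G g1a eqxx orbT.
have lbd : linked (G g1) b d by apply: linked1; rewrite /G g1b eqxx orbT.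
have nad : ~~ linked (G g1) a d.
  by apply: contra nab => h; apply: linked_trans h _; rewrite linkedC.
have nbc : ~~ linked (G g1) b c.
  by apply: contra nab => h; rewrite linkedC; apply: linked_trans h _; rewrite linkedC.
have ac : linked e a c.
  by apply: (half a c b d) => // z; rewrite !inE => /or4P[] ->; rewrite ?orbT.
have bd : linked e b d.
  apply: (half b d a c) => //; first by rewrite linkedC.
  by move=> z; rewrite !inE => /or4P[] ->; rewrite ?orbT.
rewrite Ge Ge1; apply: ncomp_merge => //.
by apply: contra nab => /link1G.
Qed.

End Surgery.

(** * Coefficients of the Jones-Wenzl idempotent *)

Section CapOff.
Variables (B : finType) (a b : B).
Implicit Type m : pairing B.
Hypothesis ab : a != b.
Let O := {c : B | c \notin [:: a; b]}.
Let w := @cap_wire B a b.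

Let out c (ca : c != a) (cb : c != b) : c \notin [:: a; b].
Proof. by rewrite !inE negb_or ca cb. Qed.

Let gp_eq m (o : O) c : involutive m -> (forall u, m u != u) ->
  connect (glue_rel w m) (inr o) (inl c) -> c != a -> c != b -> c != val o ->
  val (glue_pairing w m o) = c.
Proof.
move=> mK mN oc ca cb co.
rewrite (@glue_pairingP _ _ w (cap_wire_fun ab) m mK o (exist _ c (out ca cb))) //.
apply: connect_trans oc _; apply: connect1; by rewrite /glue_rel /= eqxx.
Qed.

Let o_in m (o : O) : connect (glue_rel w m) (inr o) (inl (val o)).
Proof. by apply: connect1; rewrite /glue_rel /= eqxx. Qed.

Let m_edge m c : connect (glue_rel w m) (inl c) (inl (m c)).
Proof. by apply: connect1; rewrite /glue_rel /= eqxx !orbT. Qed.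

Let ab_edge m : connect (glue_rel w m) (inl a) (inl b).
Proof. by apply: connect1; rewrite /glue_rel /= !eqxx. Qed.

Let ba_edge m : connect (glue_rel w m) (inl b) (inl a).
Proof. by apply: connect1; rewrite /glue_rel /= !eqxx orbT. Qed.

Lemma cap_pairing m (o : O) : involutive m -> (forall u, m u != u) ->
  m (val o) != a -> m (val o) != b -> val (glue_pairing w m o) = m (val o).
Proof.
move=> mK mN oa ob; apply: gp_eq => //; exact: connect_trans (o_in m o) (m_edge m _).
Qed.

Lemma cap_pairing_a m (o : O) : involutive m -> (forall u, m u != u) ->
  m (val o) = a -> val (glue_pairing w m o) = m b.
Proof.
move=> mK mN oa; have [/= on] := svalP o.
move: on; rewrite !inE negb_or => /andP[oa' ob'].
have mbo : m b != val o.
  by apply/eqP => e; move: ab; rewrite -oa -e mK eqxx.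
apply: gp_eq => //.
- apply: connect_trans (o_in m o) _; apply: connect_trans (m_edge m _) _; rewrite oa.
  exact: connect_trans (ab_edge m) (m_edge m b).
- by apply/eqP => e; move: ob'; rewrite -(mK (val o)) oa -e mK eqxx.
Qed.

Lemma cap_circles1 m : involutive m -> m a = b -> glue_circles w m = 1.
Proof.
move=> mK mab; have mba : m b = a by rewrite -mab mK.
have sym := glue_csym w mK.
rewrite -(n_comp_connect sym (inl a)); apply: eq_n_comp_r => u.
rewrite !inE; apply/forallP/idP => [nu|au o].
  case: u nu => [c|o] nu; last by have := nu o; rewrite connect0.
  have [->|ca] := eqVneq c a; first exact: connect0.
  have [->|cb] := eqVneq c b; first exact: ab_edge.
  have := nu (exist _ c (out ca cb)); rewrite sym.
  by rewrite (o_in m (exist _ c (out ca cb))).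
rewrite -(same_connect sym au).
apply/negP => ao; have cl : closed (glue_rel w m) [pred u : B + O | u \in [:: inl a; inl b]].
  apply: intro_closed => // x y xy; rewrite !inE => /orP[]/eqP e; move: xy; rewrite e /glue_rel.
    case: y => [y|y] /=; last first.
      by rewrite !orbF => /eqP ya; have := svalP y; rewrite /= -ya !inE eqxx.
    by rewrite eqxx (negbTE ab) andbF /= mab => /orP[]/eqP->; rewrite eqxx ?orbT.
  case: y => [y|y] /=; last first.
    by rewrite !orbF => /eqP yb; have := svalP y; rewrite /= -yb !inE eqxx orbT.
  by rewrite eqxx eq_sym (negbTE ab) /= andbT mba => /orP[]/eqP->; rewrite eqxx.
have := closed_connect cl ao; by rewrite !inE eqxx.
Qed.

Lemma cap_circles0 m : involutive m -> (forall u, m u != u) -> m a != b ->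
  glue_circles w m = 0.
Proof.
move=> mK mN mab; apply/eqP; rewrite -leqn0 leqNgt; apply/negP => /card_gt0P[u].
rewrite inE => /andP[_]; rewrite inE => /forallP nu.
have sym := glue_csym w mK.
have hit c : c != a -> c != b -> exists o, connect (glue_rel w m) (inl c) (inr o).
  by move=> ca cb; exists (exist _ c (out ca cb)); rewrite sym; apply: o_in.
have hita : exists o, connect (glue_rel w m) (inl a) (inr o).
  have [o ho] := hit (m a) (mN a) mab.
  by exists o; apply: connect_trans (m_edge m a) ho.
have [o uo] : exists o, connect (glue_rel w m) u (inr o).
  case: u {nu} => [c|o]; last by exists o; apply: connect0.
  have [->|ca] := eqVneq c a; first exact: hita.
  have [->|cb] := eqVneq c b; last exact: hit.
  by have [o ho] := hita; exists o; apply: connect_trans (ba_edge m) ho.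
by have := nu o; rewrite uo.
Qed.

(** Capping [m] takes away a circle and changes nothing else, whereas capping [m1] joins the
    partners of [a] and [b]. If the results agree, these partners are paired by [m] and all other
    pairs coincide. *)
Lemma cap_pairing_surgery m m1 : involutive m -> (forall u, m u != u) ->
  involutive m1 -> (forall u, m1 u != u) -> m a = b -> m1 != m ->
  glue_pairing w m1 = glue_pairing w m ->
  [/\ m1 a != b, m (m1 a) = m1 b &
    forall u, u \notin [:: a; b; m1 a; m1 b] -> m u = m1 u].
Proof.
move=> mK mN m1K m1N mab nm E.
have mba : m b = a by rewrite -mab mK.
have gpm (o : O) : val (glue_pairing w m o) = m (val o).
  have := svalP o; rewrite /= !inE negb_or => /andP[oa ob].
  apply: cap_pairing => //; first by rewrite (can2_eq mK mK) mab.
  by rewrite (can2_eq mK mK) mba.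
have same u : u != a -> u != b -> m1 u != a -> m1 u != b -> m u = m1 u.
  move=> ua ub m1ua m1ub; have := gpm (exist _ u (out ua ub)).
  by rewrite -E /= cap_pairing.
have m1ab : m1 a != b.
  apply: contra nm => /eqP m1ab; apply/eqP/ffunP => u.
  have m1ba : m1 b = a by rewrite -m1ab m1K.
  have [->|ua] := eqVneq u a; first by rewrite m1ab mab.
  have [->|ub] := eqVneq u b; first by rewrite m1ba mba.
  by rewrite (same u) // (can2_eq m1K m1K) ?m1ab ?m1ba.
have m1aa := m1N a.
split=> //.
  have := gpm (exist _ (m1 a) (out m1aa m1ab)).
  by rewrite -E cap_pairing_a //= m1K.
move=> u; rewrite !inE !negb_or => /and4P[ua ub uma umb].
by apply: same; rewrite // (can2_eq m1K m1K).
Qed.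

End CapOff.

Local Open Scope ring_scope.

(** * Lower bounds on orders *)

Section NetDegree.
Variables (T1 T2 : finType) (n : nat).
Local Notation pt := (T1 * 'I_4 + T2 * tl_points n)%type.
Variable W : pt -> pt.
Hypotheses (WK : involutive W) (WN : forall z, W z != z).
Variable sg : {ffun T1 -> pairing 'I_4}.
Hypotheses (sgK : forall t, involutive (sg t)) (sgN : forall t k, sg t k != k).
Variable f : skein (tl_points n).
Hypotheses (fT : in_TL f) (fcap : kills_caps f).

Implicit Type M : {ffun T2 -> pairing (tl_points n)}.
Let c M := ncomp (net_graph W sg M).
Let coef M := \prod_d f (M d).
Definition all_id : {ffun T2 -> pairing (tl_points n)} := [ffun=> tl_idp n].

(** The coefficient of the capped [m] in [cap_off f = 0]: only [m] itself closes a circle and gets a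
    factor [delta]; every other diagram with the same capping differs from [m] by a surgery at the
    cap. *)
Lemma cap_relation m : tl_diagram m -> m <> tl_idp n ->
  exists a b : 'I_n, [/\ b = a.+1 :> nat, m (inl a) = inl b &
    delta * f m = - \sum_(m1 | [&& f m1 != 0, m1 (inl a) != inl b, m (m1 (inl a)) == m1 (inl b) &
       [forall u, (u \notin [:: inl a; inl b; m1 (inl a); m1 (inl b)]) ==> (m u == m1 u)]] &&
       (glue_pairing (@cap_wire _ (inl a) (inl b)) m1 ==
        glue_pairing (@cap_wire _ (inl a) (inl b)) m)) f m1].
Proof.
move=> mD m1; have [mK mN _] := mD; have [a [b [ab mab]]] := tl_top_cap mD m1.
exists a, b; split=> //; have [f0 _] := fcap ab.
have nab : inl a != inl b :> tl_points n.
  by apply/eqP => -[e]; move: ab; rewrite e => /esym/eqP; rewrite -[X in X == _]addn1 -[X in _ == X]addn0 eqn_add2l.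
have := congr1 (fun x : skein _ => x (glue_pairing (@cap_wire _ (inl a) (inl b)) m)) f0.
rewrite /cap_off !ffunE (bigD1 m) //= cap_circles1 // expr1 mulrC => /eqP.
rewrite addr_eq0 => /eqP->; congr (- _).
rewrite big_mkcond [RHS]big_mkcond /=; apply: eq_bigr => m2 _.
have [->|f2] /= := eqVneq (f m2) 0; first by rewrite mul0r; case: ifP.
have [m2K m2N _] := fT f2.
case: eqP => /= [E|]; last by rewrite !andbF.
have [->|nm] /= := eqVneq m2 m; first by rewrite mab eqxx.
have [s1 s2 s3] := cap_pairing_surgery nab mK mN m2K m2N mab nm E.
rewrite s1 s2 eqxx cap_circles0 // expr0 mulr1 /=.
by case: forallP => // -[] u; apply/implyP => nu; apply/eqP; apply: s3.
Qed.

Lemma coefD1 M d m : coef (fupdate M d m) = f m * \prod_(d' | d' != d) f (M d').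
Proof.
rewrite /coef (bigD1 d) //= ffunE eqxx; congr (_ * _).
by apply: eq_bigr => d' nd; rewrite ffunE (negbTE nd).
Qed.

Lemma fupdate_same M d : fupdate M d (M d) = M.
Proof. by apply/ffunP => d'; rewrite ffunE; case: eqP => // ->. Qed.

Lemma fupdate_step M d (m : pairing (tl_points n)) z :
  step sg (fupdate M d m) z = if z is inr (d', p) then
     (if d' == d then inr (d, m p) else step sg M z) else step sg M z.
Proof. by case: z => [[t k]|[d' p]] //=; rewrite ffunE; case: eqP => // ->. Qed.

(* Expressing the coefficient of a diagram with a cap by those of its surgeries. *)
Lemma coef_step M : coef M != 0 -> M != all_id ->
  exists d (a b : 'I_n), [/\ b = a.+1 :> nat,
    forall k, (forall m, f m != 0 -> M d <> m -> (c M <= (c (fupdate M d m)).+1)%N ->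
       (~~ linked (net_graph W sg (fupdate M d m)) (inr (d, inl a)) (inr (d, inl b)) ->
         (forall d', involutive (fupdate M d m d')) ->
         (forall d' u, fupdate M d m d' u != u) -> (c M).+1 = c (fupdate M d m)) ->
       vge (k - 2) (coef (fupdate M d m))) -> vge k (coef M) & M d != tl_idp n].
Proof.
move=> cM; rewrite -[M == all_id]negbK => nM.
have /existsP[d Md] : [exists d, M d != tl_idp n].
  apply: contraR nM; rewrite negb_exists negbK => /forallP h; apply/eqP/ffunP => d.
  by rewrite ffunE; apply/eqP; have := h d; rewrite negbK.
have fMd : f (M d) != 0 by apply: contraNneq cM => e; rewrite /coef (bigD1 d) //= e mul0r.
have [mK mN mP] := fT fMd.
have [a [b [ab mab rel]]] := cap_relation (fT fMd) (elimN eqP Md).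
exists d, a, b; split=> // k h.
have nab : inl a != inl b :> tl_points n by rewrite -mab eq_sym.
have -> : coef M = - delta^-1 * \sum_(m1 | [&& f m1 != 0, m1 (inl a) != inl b,
      M d (m1 (inl a)) == m1 (inl b) &
       [forall u, (u \notin [:: inl a; inl b; m1 (inl a); m1 (inl b)]) ==> (M d u == m1 u)]] &&
       (glue_pairing (@cap_wire _ (inl a) (inl b)) m1 ==
        glue_pairing (@cap_wire _ (inl a) (inl b)) (M d))) coef (fupdate M d m1).
  under eq_bigr do rewrite coefD1.
  rewrite -mulr_suml mulrA -{1}(fupdate_same M d) coefD1; congr (_ * _).
  rewrite mulNr -mulrN -rel mulrA (mulVf delta_neq0) mul1r; exact: erefl.
(* [delta] has order -2, so dividing by it gains 2. *)
have -> : k = 2 + (k - 2) by rewrite addrC subrK.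
apply: vgeM.
  by apply/vgeN/vexact_vge; rewrite -[2]opprK; apply: vexactV; apply: vexact_delta.
apply: vge_sum => m /andP[/and4P[fm mab' /eqP mm /forallP ms] _].
have [m1K m1N _] := fT fm.
have ms' u : u \notin [:: inl a; inl b; m (inl a); m (inl b)] -> M d u = m u.
  by move=> nu; apply/eqP; have := ms u; rewrite nu.
have stM p : step sg M (inr (d, p)) = inr (d, M d p) by [].
have stm p : step sg (fupdate M d m) (inr (d, p)) = inr (d, m p).
  by rewrite fupdate_step eqxx.
have st z : z \notin [:: inr (d, inl a); inr (d, inl b); inr (d, m (inl a)); inr (d, m (inl b))] ->
    step sg M z = step sg (fupdate M d m) z.
  rewrite fupdate_step; case: z => [//|[d' p]]; case: eqP => // -> nz /=.
  rewrite ms' //; move: nz; apply: contra; rewrite !inE.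
  by case/or4P=> /eqP->; rewrite eqxx ?orbT.
have surg_le := @surgery_le pt W (step sg M) (step sg (fupdate M d m))
  (inr (d, inl a)) (inr (d, inl b)) (inr (d, m (inl a))) (inr (d, m (inl b))).
have surg_merge := @surgery_merge pt W (step sg M) (step sg (fupdate M d m))
  (inr (d, inl a)) (inr (d, inl b)) (inr (d, m (inl a))) (inr (d, m (inl b))).
have e1 : M d (inl b) = inl a by rewrite -mab mK.
have e2 : M d (m (inl b)) = m (inl a) by rewrite -mm mK.
apply: h => //.
- by move=> e; move: mab'; rewrite -e mab eqxx.
- apply: surg_le; rewrite ?stM ?stm ?mab ?e1 ?mm ?e2 ?m1K //; exact: st.
move=> nl MK MN; apply: surg_merge => //; rewrite ?stM ?stm ?mab ?e1 ?mm ?e2 ?m1K //.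
- exact: stepK.
- move=> [[t j]|[d' p]] /=; first by apply/eqP => -[e]; have := sgN t j; rewrite e eqxx.
  by apply/eqP => -[e]; have := MN d' p; rewrite e eqxx.
Qed.

Variable B : int.
Hypothesis hB : vge B (coef all_id).
(** Chosen so that the lower bound for the order of [coef M * delta ^+ c M] is the same for all [M],
    namely that of the term with identities in the boxes. *)
Let e M : int := B + (c M)%:Z *+ 2 - (c all_id)%:Z *+ 2.

(** The cap relation gains 2, and a surgery that loses a component lowers [e] by 2, so the slack is
    kept and induction on [c M] applies. If no component is lost, the gain allows falling back on
    the bound with slack [K + 1]. Thus the slack can be lowered to 0 in steps of one. *)
Lemma vge_coef M : vge (e M) (coef M).
Proof.
have step_down (K : nat) : (forall M, vge (e M - K.+1%:Z) (coef M)) ->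
    forall M, vge (e M - K%:Z) (coef M).
  move=> H M'; have [N] := ubnP (c M'); elim: N M' => // N IH M' cN.
  have [->|cM] := eqVneq (coef M') 0; first exact: vge0.
  have [->|nM] := eqVneq M' all_id; first by apply: vge_weak hB; rewrite /e; lia.
  have [d [a [b [_ h _]]]] := coef_step cM nM; apply: h => m fm nm cle _.
  case: (ltnP (c (fupdate M' d m)) (c M')) => cN'.
    have lt : (c (fupdate M' d m) < N)%N by lia.
    by apply: vge_weak (IH _ lt); rewrite /e; lia.
  by apply: vge_weak (H _); rewrite /e; lia.
have [k hk] := vge_common coef.
have [K hK] : exists K : nat, forall M, vge (e M - K%:Z) (coef M).
  (* [k] bounds the order of all coefficients from below, and [c M'] is at most the number of
     points. *)
  exists (`|k| + `|B| + 2 * #|{: pt}|)%N => M'; apply: vge_weak (hk M').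
  have cb : (c M' <= #|{: pt}|)%N by rewrite /c /ncomp /n_comp_mem; apply: max_card.
  by rewrite /e; lia.
elim: K hK => [|K IH] hK; first by have := hK M; rewrite subr0.
by apply: IH; apply: step_down.
Qed.

Lemma all_idK d : involutive (all_id d).
Proof. move=> u; rewrite [all_id d]ffunE; exact: tl_idpK. Qed.

Lemma all_idN d u : all_id d u != u.
Proof. by rewrite [all_id d]ffunE ffunE; case: u. Qed.

(** Neighbouring strands of the identity state lie in different components, so a surgery from [M] to
    the identity forces [M] to have one component fewer, and the gain of 2 leaves room for the extra
    unit. A surgery that does not lower the number of components leaves room too, by [vge_coef];
    otherwise the unit is inherited by induction. *)
Lemma vge_coef_strict M :
  (forall d (a b : 'I_n), b = a.+1 :> nat ->
     ~~ linked (net_graph W sg all_id) (inr (d, inl a)) (inr (d, inl b))) ->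
  M != all_id -> vge (e M + 1) (coef M).
Proof.
move=> adequate; have [N] := ubnP (c M); elim: N M => // N IH M cN nM.
have [->|cM] := eqVneq (coef M) 0; first exact: vge0.
have [d [a [b [ab h _]]]] := coef_step cM nM; apply: h => m fm nm cle merge.
have [E|nM'] := eqVneq (fupdate M d m) all_id.
  move: merge; rewrite E => /(_ (adequate d a b ab) all_idK all_idN) cc.
  by apply: vge_weak hB; rewrite /e; lia.
case: (ltnP (c (fupdate M d m)) (c M)) => cN'.
  have lt : (c (fupdate M d m) < N)%N by lia.
  by apply: vge_weak (IH _ lt nM'); rewrite /e; lia.
by apply: vge_weak (vge_coef _); rewrite /e; lia.
Qed.

End NetDegree.

Lemma sum_glue (I O : finType) (w : rel (I + O)) (x : skein I) (Phi : pairing O -> QA) :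
  \sum_m glue w x m * Phi m = \sum_m x m * (delta ^+ glue_circles w m * Phi (glue_pairing w m)).
Proof.
rewrite [RHS](partition_big (glue_pairing w) xpredT) //=.
apply: eq_bigr => m _; rewrite ffunE mulr_suml.
by apply: eq_bigr => m' /eqP->; rewrite mulrA.
Qed.

Section JonesWenzl.
Variables (n : nat) (f : skein (tl_points n)).
Hypothesis fJ : jones_wenzl f.
Let fT : in_TL f. Proof. by case: fJ. Qed.
Let f0 : f != 0. Proof. by case: fJ. Qed.
Let ff : tl_mul f f = f. Proof. by case: fJ. Qed.
Let fcap : kills_caps f. Proof. by case: fJ. Qed.

(** A net without crossings and with a single box, closed up: the trace of [f]. *)
Let W (z : void * 'I_4 + unit * tl_points n) : void * 'I_4 + unit * tl_points n :=
  match z with inl z => inl z | inr (t, u) => inr (t, tl_idp n u) end.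

Let WK : involutive W. Proof. by move=> [[[]]|[t u]] /=; rewrite tl_idpK. Qed.
Let WN z : W z != z. Proof. by case: z => [[[]]|[t [i|i]]]; rewrite /W ffunE. Qed.

Let sg0 : {ffun void -> pairing 'I_4} := [ffun=> stay 'I_4].

Let prod_unit (M : {ffun unit -> pairing (tl_points n)}) : \prod_d f (M d) = f (M tt).
Proof. by rewrite (bigD1 tt) //= big1 ?mulr1 // => -[]. Qed.

Let box (m : pairing (tl_points n)) : {ffun unit -> pairing (tl_points n)} := [ffun=> m].

(** If it vanished, every [B] would be admissible in [vge_coef], and all coefficients of [f] would
    have infinite order. *)
Let f1_neq0 : f (tl_idp n) != 0.
Proof.
apply: contraNneq f0 => e; apply/eqP/ffunP => m; rewrite [RHS]ffunE.
apply: vge_all_eq0 => k.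
have h B : vge B (\prod_d f (all_id unit n d)) by rewrite prod_unit ffunE e; apply: vge0.
have := vge_coef WK WN (sg := sg0) (fun t => match t with end) (fun t => match t with end)
  fT fcap (h _) (box m).
rewrite prod_unit [box m tt]ffunE => /(_ (k - ((ncomp (net_graph W sg0 (box m)))%:Z *+ 2 -
  (ncomp (net_graph W sg0 (all_id unit n)))%:Z *+ 2))).
by apply: vge_weak; rewrite -addrA subrK.
Qed.

Let closure_net (m : pairing (tl_points n)) :
  ncomp (closed_graph (@closure_wire n) m) = ncomp (net_graph W sg0 (box m)).
Proof.
apply: anti_leq; apply/andP; split.
  pose h (z : void * 'I_4 + unit * tl_points n) : tl_points n :=
    match z with inl (v, _) => match v with end | inr (_, u) => u end.
  apply: (ncomp_le (h := h)) => [u|z z']; first by exists (inr (tt, u)).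
  case: z => [[[]]|[[] u]].
  case/orP=> /eqP->; last first.
    by apply: linked1; rewrite /closed_graph /h /= ffunE eqxx orbT.
  rewrite /h /= ffunE; case: u => i; first by apply: linked1; rewrite /closed_graph /= eqxx.
  by apply: linked1r; rewrite /closed_graph /= eqxx.
pose h (u : tl_points n) : void * 'I_4 + unit * tl_points n := inr (tt, u).
apply: (ncomp_le (h := h)) => [z|u v]; first by case: z => [[[]]|[[] u]]; exists u.
case/orP=> [|/eqP<-]; last first.
  by have := linked_step W sg0 (box m) (h u); rewrite /= ffunE.
have lW i : linked (net_graph W sg0 (box m)) (h (inl i)) (h (inr i)).
  by have := linked_W W sg0 (box m) (h (inl i)); rewrite /= ffunE.
by case: u v => [i|i] [j|j] //= /eqP->; apply: lW.
Qed.

Let closureE : tl_closure f = \sum_m f m * delta ^+ ncomp (closed_graph (@closure_wire n) m).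
Proof. by apply: bracketE => m /fT[]. Qed.

(** The strands of the closed identity are distinct circles, so by [vge_coef_strict] the identity
    alone contributes to the lowest order. *)
Lemma tl_closure_neq0 : tl_closure f != 0.
Proof.
rewrite closureE (bigD1 (tl_idp n)); last exact: isT.
have [k kf] := vexact_exists f1_neq0.
set c0 := ncomp _.
have h : vge k (\prod_d f (all_id unit n d)) by rewrite prod_unit ffunE; apply: vexact_vge.
apply: (@vexact_neq0 (k + (- 2) *+ c0)); apply: vexactD.
  by apply: vexactM kf _; apply: vexactX vexact_delta.
apply: vge_sum => m /andP[_ nm].
have adequate d (a b : 'I_n) : b = a.+1 :> nat ->
   ~~ linked (net_graph W sg0 (all_id unit n)) (inr (d, inl a)) (inr (d, inl b)).
  move=> ab; pose lab (z : void * 'I_4 + unit * tl_points n) : nat :=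
    match z with inl (v, _) => match v with end | inr (_, u) =>
      match u with inl i => i | inr i => i end end.
  apply/negP => /(@linked_inv _ _ _ lab) => /(_ _)/= E.
  suff : a = b :> nat by rewrite ab => /n_Sn.
  by apply: E => -[[[]]|[t [u|u]]] z' /orP[]/eqP->; rewrite /= ?[all_id _ _ _]ffunE ffunE.
have nM : box m != all_id unit n.
  by apply: contra nm => /eqP/(congr1 (fun M : {ffun _ -> _} => M tt)); rewrite !ffunE => ->.
have := vge_coef_strict WK WN (sg := sg0) (fun t => match t with end) (fun t => match t with end)
  fT fcap h adequate nM.
rewrite prod_unit [box m tt]ffunE => hm.
have {}hm : vge (k + (ncomp (closed_graph (@closure_wire n) m))%:Z *+ 2 - c0%:Z *+ 2 + 1) (f m).
  by rewrite /c0 !closure_net; exact: hm.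
have hd := vgeX (ncomp (closed_graph (@closure_wire n) m)) (vexact_vge vexact_delta).
by apply: vge_weak (vgeM hm hd); lia.
Qed.

Let mul_fun : functional_wiring (@tl_mul_wire n).
Proof.
by move=> [[[p|p]|[p|p]]|[p|p]] [[[q|q]|[q|q]]|[q|q]] [[[r|r]|[r|r]]|[r|r]] //=;
  rewrite ?orbF // => /eqP-> /eqP->.
Qed.

Let e0 : rel (tl_points n) := fun u v => @closure_wire n (inl u) (inl v).
Let flat (m1 m2 : pairing (tl_points n)) :=
  flat_graph (@tl_mul_wire n) e0 (fun (_ : unit) u => u) (fun _ => juxt_pairing m1 m2).

Let flatE (m1 m2 : pairing (tl_points n)) : involutive m1 -> involutive m2 ->
  (ncomp (flat m1 m2) = ncomp (closed_graph (@closure_wire n)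
     (glue_pairing (@tl_mul_wire n) (juxt_pairing m1 m2))) +
   glue_circles (@tl_mul_wire n) (juxt_pairing m1 m2))%N.
Proof.
move=> m1K m2K; rewrite /flat ncomp_flat; first last.
- by move=> _; apply: juxt_pairingK.
- by move=> [i|i] [j|j].
- exact: mul_fun.
rewrite (bigD1 tt) //= big1 ?addn0; last by case.
congr (_ + _)%N.
apply: eq_ncomp => u v /orP[uv|].
- by apply: linked1; rewrite /closed_graph -/(e0 u v) uv.
- by case/existsP=> t /existsP[o /andP[/eqP-> /eqP->]]; apply: linked1; rewrite /closed_graph eqxx orbT.
- by apply: linked1; rewrite /outer_graph /e0 uv.
- move=> uv; apply: linked1; rewrite /outer_graph; apply/orP; right.
  by apply/existsP; exists tt; apply/existsP; exists u; rewrite eqxx eq_sym.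
Qed.

(** A cap at the top of the lower diagram [v] faces the bottom of the upper factor [f]. *)
Let flat_kill v : f v != 0 -> v != tl_idp n -> \sum_u f u * delta ^+ ncomp (flat u v) = 0.
Proof.
move=> fv nv; have [vK vN _] := fT fv.
have [a [b [ab vab]]] := tl_top_cap (fT fv) (elimN eqP nv).
have [_ f0'] := fcap ab.
have nab : inr a != inr b :> tl_points n.
  have : inl a != inl b :> tl_points n by rewrite -vab eq_sym.
  by rewrite !(inj_eq (@inl_inj _ _), inj_eq (@inr_inj _ _)).
have vba : v (inl b) = inl a by rewrite -vab vK.
pose e := flat (stay _) v.
pose iota p : tl_points n + unit * (tl_points n + tl_points n) := inr (tt, inl p).
have -> : \sum_u f u * delta ^+ ncomp (flat u v) =
    \sum_u f u * delta ^+ ncomp (attach e iota u).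
  apply: eq_bigr => u _; congr (_ * _ ^+ _).
  have eL p q w' : (juxt_pairing w' v (inl p) == inl q) = (w' p == q) by rewrite ffunE.
  have eN p q w' : (juxt_pairing w' v (inl p) == inr q) = false by rewrite ffunE.
  have eR p q w' : (juxt_pairing w' v (inr p) == q) = (inr (v p) == q) by rewrite ffunE.
  have le x y : e x y -> linked (attach e iota u) x y.
    by move=> xy; apply: linked1; rewrite /attach xy.
  apply: eq_ncomp => x y.
    rewrite /flat /flat_graph; case: x y => [x|[[] [p|p]]] [y|[[] [q|q]]] //=;
      rewrite ?eL ?eN ?eR ?orbF /= => xy;
      try by apply: le; rewrite /e /flat /= ?eN ?eR ?orbF.
    apply: linked1; rewrite /attach; apply/orP; right; apply/existsP; exists p.
    have /eqP-> : u p == q by case: p xy.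
    by rewrite !eqxx.
  case/orP=> [|/existsP[p /andP[/eqP-> /eqP->]]]; last first.
    by apply: linked1; rewrite /flat /iota /= eL eqxx orbT.
  rewrite /e /flat /flat_graph; case: x y => [x|[[] [p|p]]] [y|[[] [q|q]]] //=;
      rewrite ?eL ?eN ?eR ?orbF /= => xy;
      try by apply: linked1; rewrite /flat /= ?eN ?eR ?orbF.
  have {}xy : stay (tl_points n) p == q by case: p xy.
  by move: xy; rewrite ffunE => /eqP->.
have l1 c : linked e (iota (inr c)) (inr (tt, inr (inl c))).
  by apply: linked1; rewrite /e /flat /= eqxx.
apply: cap_kill nab f0' _ _ _ => [m /fT[] //||p pa pb].
  apply: linked_trans (l1 a) _; rewrite linkedC; apply: linked_trans (l1 b) _.
  by apply: linked1; rewrite /e /flat /= ffunE vba eqxx.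
(* The whole component of the cap in [e]; it meets the upper box in [a] and [b] only. *)
pose S : seq (tl_points n + unit * (tl_points n + tl_points n)) :=
  [:: iota (inr a); iota (inr b); inr (tt, inr (inl a)); inr (tt, inr (inl b))].
apply/negP => /(@linked_inv _ _ _ (fun x => x \in S)) H.
suff : (iota (inr a) \in S) = (iota p \in S).
  rewrite !inE eqxx /= -!/(iota _) => /esym; rewrite !orbF.
  by case/orP=> /eqP[e']; [rewrite e' eqxx in pa|rewrite e' eqxx in pb].
apply: H => x y.
have S1 c : (inr (tt, inl (inr c)) \in S) = (c == a) || (c == b).
  by rewrite !inE /= !orbF.
have S2 c : (inr (tt, inr (inl c)) \in S) = (c == a) || (c == b).
  by rewrite !inE.
have S3 c : (inr (tt, inl (inl c)) \in S) = false by rewrite !inE.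
have S4 c : (inr (tt, inr (inr c)) \in S) = false by rewrite !inE.
have S5 c : (inl c \in S) = false by rewrite !inE.
have vm c q : v (inl c) = inl q -> (c == a) || (c == b) = ((q == a) || (q == b)).
  move=> E; apply/idP/idP => /orP[]/eqP e'; move: E; rewrite e'.
  - by rewrite vab => -[<-]; rewrite eqxx orbT.
  - by rewrite vba => -[<-]; rewrite eqxx.
  - by move=> E; have := vK (inl c); rewrite E vab => -[<-]; rewrite eqxx orbT.
  - by move=> E; have := vK (inl c); rewrite E vba => -[<-]; rewrite eqxx.
have vn c q : v (inl c) = inr q -> (c == a) || (c == b) = false.
  by move=> E; apply/negP => /orP[]/eqP e'; move: E; rewrite e' ?vab ?vba.
case: x y => [x|[[] [[p'|p']|[p'|p']]]] [y|[[] [[q|q]|[q|q]]]] //=; rewrite ?S1 ?S2 ?S3 ?S4 ?S5 //.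
all: rewrite ?ffunE ?orbF /=.
all: try by case/existsP => -[o|o].
all: try by move=> /eqP[->].
all: try by move=> /eqP.
all: try by move=> /eqP[/vm].
all: try by move=> /eqP[/vn].
all: try by move=> /eqP[E]; apply/esym/(vn _ p'); rewrite -E vK.
Qed.

(** Taking traces in [f f = f], only the identity survives in the lower factor, so the nonzero trace
    of [f] is multiplied by this coefficient. *)
Lemma jw_id : f (tl_idp n) = 1.
Proof.
apply: (mulIf tl_closure_neq0); rewrite mul1r.
have E1 : tl_closure f = \sum_v f v * \sum_u f u * delta ^+ ncomp (flat u v).
  rewrite closureE -{1}ff /tl_mul sum_glue sum_juxt.
  under [RHS]eq_bigr do rewrite mulr_sumr.
  rewrite [RHS]exchange_big; apply: eq_bigr => u _; rewrite mulr_sumr; apply: eq_bigr => v _.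
  have [->|fu] := eqVneq (f u) 0; first by rewrite !mul0r mulr0.
  have [->|fv] := eqVneq (f v) 0; first by rewrite !mul0r mulr0.
  have [uK _ _] := fT fu; have [vK _ _] := fT fv.
  by rewrite flatE // addnC exprD mulrCA.
rewrite [RHS]E1 (bigD1 (tl_idp n)); last exact: isT.
rewrite [X in _ = _ + X]big1 ?addr0; last first.
  move=> v /andP[_ nv]; have [->|fv] := eqVneq (f v) 0; first by rewrite mul0r.
  by rewrite flat_kill ?mulr0.
rewrite closureE; congr (_ * _); apply: eq_bigr => u _; congr (_ * _ ^+ _).
have eR p q : (juxt_pairing u (tl_idp n) (inr p) == q) = (inr (tl_idp n p) == q) by rewrite ffunE.
have eL p q : (juxt_pairing u (tl_idp n) (inl p) == q) = (inl (u p) == q) by rewrite ffunE.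
apply: anti_leq; apply/andP; split.
  pose h (x : tl_points n + unit * (tl_points n + tl_points n)) : tl_points n :=
    match x with inl p | inr (_, inl p) => p
    | inr (_, inr p) => match p with inl i | inr i => inr i end end.
  apply: (ncomp_le (h := h)) => [p|x y]; first by exists (inl p).
  rewrite /flat /flat_graph; case: x y => [x|[[] [p|p]]] [y|[[] [q|q]]] //=;
    rewrite ?eL ?eR //=.
  - by move=> xy; apply: linked1; rewrite /closed_graph -/(e0 x y) xy.
  - by case/existsP=> o /andP[+ /eqP->]; case: p o => [p|p] [o|o] //=; rewrite ?orbF => /eqP->.
  - case/orP=> [|/eqP[<-]]; first by case: p q => [p|p].
    by apply: linked1; rewrite /closed_graph eqxx orbT.
  - by rewrite orbF; case: p q => [p|p] [q|q] //= => /eqP->.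
  - by case/existsP=> o /andP[+ /eqP->]; case: p o => [p|p] [o|o] //=; rewrite ?orbF => /eqP->.
  - by case: p => p /eqP.
  - by case: p => i; rewrite ffunE /= => /eqP[<-].
pose h (p : tl_points n) : tl_points n + unit * (tl_points n + tl_points n) := inl p.
apply: (ncomp_le (h := h)) => [x|p q].
  have l1 p : linked (flat u (tl_idp n)) (inr (tt, inr p)) (inl (inr (match p with inl i | inr i => i end))).
    have l0 i : linked (flat u (tl_idp n)) (inr (tt, inr (inr i))) (inl (inr i)).
      by apply: linked1; apply/existsP; exists (inr i); rewrite /= !eqxx.
    case: p => i //; apply: linked_trans (l0 i).
    by apply: linked1; rewrite /flat /= eR ffunE.
  case: x => [p|[[] [[i|i]|p]]]; first by exists p.
  - by exists (inl i); apply: linked1; apply/existsP; exists (inl i); rewrite /= !eqxx.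
  - exists (inr i); apply: linked_trans (l1 (inl i)).
    by apply: linked1; rewrite /flat /= eqxx.
  - by eexists; apply: l1.
have lp p' : linked (flat u (tl_idp n)) (inl p') (inr (tt, inl p')).
  case: p' => i.
    by apply: linked1r; apply/existsP; exists (inl i); rewrite /= !eqxx.
  apply: (@linked_trans _ _ (inr (tt, inr (inr i)))).
    by apply: linked1r; apply/existsP; exists (inr i); rewrite /= !eqxx.
  apply: (@linked_trans _ _ (inr (tt, inr (inl i)))).
    by apply: linked1; rewrite /flat /= eR ffunE.
  by apply: linked1r; rewrite /flat /= eqxx.
case/orP=> [pq|/eqP<-]; first exact: linked1.
apply: linked_trans (lp p) _; apply: (@linked_trans _ _ (inr (tt, inl (u p)))).
  by apply: linked1; rewrite /flat /= eL eqxx orbT.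
by rewrite linkedC.
Qed.

End JonesWenzl.

(** * The cabled diagram *)

Section GridCoordinates.
Variable m : nat.
Local Notation I := ('I_m.+1).

(* The crossing of the grid met by the [p]-th strand of the end [a] after [q] other
   crossings. *)
Definition grid_pos (a : 'I_4) (p q : I) : I * I :=
  match val a with
  | 0 => (p, q)
  | 1 => (rev_ord q, p)
  | 2 => (rev_ord p, rev_ord q)
  | _ => (q, rev_ord p)
  end%N.

Definition grid_strand (a : 'I_4) (g : I * I) : I :=
  match val a with 0 => g.1 | 1 => g.2 | 2 => rev_ord g.1 | _ => rev_ord g.2 end%N.

Definition grid_depth (a : 'I_4) (g : I * I) : I :=
  match val a with 0 => g.2 | 1 => rev_ord g.1 | 2 => rev_ord g.2 | _ => g.1 end%N.

Lemma grid_posK a g : grid_pos a (grid_strand a g) (grid_depth a g) = g.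
Proof. by case: a g => -[|[|[|[|]]]] // i [x y]; rewrite /grid_pos /= ?rev_ordK. Qed.

Lemma grid_strandK a p q : grid_strand a (grid_pos a p q) = p.
Proof. by case: a => -[|[|[|[|]]]] // i; rewrite /grid_strand /grid_pos /= ?rev_ordK. Qed.

Lemma grid_depthK a p q : grid_depth a (grid_pos a p q) = q.
Proof. by case: a => -[|[|[|[|]]]] // i; rewrite /grid_depth /grid_pos /= ?rev_ordK. Qed.

Lemma grid_pos_turn a p q : grid_pos (a + 1) q (rev_ord p) = grid_pos a p q.
Proof. by case: a => -[|[|[|[|]]]] // i; rewrite /grid_pos /= ?rev_ordK. Qed.

Lemma grid_pos_opp a p q : grid_pos (a + 1 + 1) (rev_ord p) (rev_ord q) = grid_pos a p q.
Proof. by rewrite grid_pos_turn grid_pos_turn. Qed.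

Lemma grid_pos_inj a p q p' q' : grid_pos a p q = grid_pos a p' q' -> p = p' /\ q = q'.
Proof.
move=> e; split; first by rewrite -(grid_strandK a p q) e grid_strandK.
by rewrite -(grid_depthK a p q) e grid_depthK.
Qed.

End GridCoordinates.

Section CabledNet.
Variables (L : link_diagram) (m : nat).
Local Notation n := m.+1.
Local Notation k := (crossings L).
Local Notation pt := (('I_k * ('I_n * 'I_n)) * 'I_4 + dart k * tl_points n)%type.

(** An end of a cell leads to the next cell in its direction, or to the box of that end of the
    crossing if the cell is on the border (depth 0). The bottom of a box leads along the edge to the
    box at its other end, where counterclockwise numbering reverses the strands. *)
Definition cabled_wire (z : pt) : pt :=
  match z with
  | inl ((i, g), a) =>
      if grid_depth a g == 0%N :> nat then inr ((i, a), inl (grid_strand a g))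
      else inl ((i, grid_pos a (grid_strand a g) (inord (grid_depth a g).-1)), a + 1 + 1)
  | inr (d, inl p) => inl ((d.1, grid_pos d.2 p ord0), d.2)
  | inr (d, inr p) => inr (@edge L d, inr (rev_ord p))
  end.
Local Notation W := cabled_wire.

Lemma cabled_wire_in i a p (q q' : 'I_n) : q = q'.+1 :> nat ->
  W (inl ((i, grid_pos a p q), a)) = inl ((i, grid_pos a p q'), a + 1 + 1).
Proof.
move=> qq; rewrite /= grid_depthK grid_strandK qq /=; congr (inl (_, _, _)).
by congr grid_pos; apply: val_inj; rewrite /= inordK.
Qed.

Lemma cabled_wire_border i a p : W (inl ((i, grid_pos a p ord0), a)) = inr ((i, a), inl p).
Proof. by rewrite /= grid_depthK grid_strandK. Qed.

Lemma ord4_opp (a : 'I_4) : a + 1 + 1 + 1 + 1 = a.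
Proof. by case: a => -[|[|[|[|]]]] // i; apply: val_inj. Qed.

Lemma cabled_wire_out i a p (q q' : 'I_n) : q = q'.+1 :> nat ->
  W (inl ((i, grid_pos a p q'), a + 1 + 1)) = inl ((i, grid_pos a p q), a).
Proof.
move=> qq; rewrite -(grid_pos_opp a p q') -(grid_pos_opp a p q).
rewrite (@cabled_wire_in _ _ _ _ (rev_ord q)) ?ord4_opp //=.
by have := ltn_ord q; rewrite qq; lia.
Qed.

Lemma cabled_wire_border_out i a p :
  W (inl ((i, grid_pos a p ord_max), a + 1 + 1)) = inr ((i, a + 1 + 1), inl (rev_ord p)).
Proof.
rewrite -(grid_pos_opp a p ord_max) -cabled_wire_border; congr (W (inl (_, grid_pos _ _ _, _))).
by apply: val_inj; rewrite /= subSS subnn.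
Qed.

Lemma cabled_wire_side i a (p p' q : 'I_n) : p' = p.+1 :> nat ->
  W (inl ((i, grid_pos a p q), a + 1)) = inl ((i, grid_pos a p' q), a - 1).
Proof.
move=> pp; rewrite -(grid_pos_turn a p q) -(grid_pos_turn a p' q).
rewrite (@cabled_wire_in _ _ _ _ (rev_ord p')) /=.
  by congr (inl (_, _)); case: a => -[|[|[|[|]]]] // ia; apply: val_inj.
by have := ltn_ord p'; rewrite pp; lia.
Qed.

Lemma cabled_wireK : involutive W.
Proof.
move=> [[[i g] a]|[d [p|p]]].
- rewrite -{1}(grid_posK a g); case: (unliftP ord0 (grid_depth a g)) => [q|] e.
    have qq : grid_depth a g = (inord q : 'I_n).+1 :> nat.
      by rewrite e /= inordK // (leq_trans (ltn_ord q)).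
    by rewrite (cabled_wire_in _ _ _ qq) (cabled_wire_out _ _ _ qq) grid_posK.
  by rewrite e cabled_wire_border /= -e grid_posK.
- by case: d => i a; rewrite [W (inr _)]/= cabled_wire_border.
- by rewrite /= edgeK rev_ordK.
Qed.

Lemma cabled_wire_neq z : W z != z.
Proof.
case: z => [[[i g] a]|[d [p|p]]] /=.
- case: ifP => // _; apply/eqP => -[_ /(congr1 val)].
  by case: a => -[|[|[|[|]]]].
- by [].
- by apply/eqP => -[/eqP]; rewrite (negbTE (edge_neq d)).
Qed.

Variable f : skein (tl_points n).
Hypotheses (fT : in_TL f) (fcap : kills_caps f) (f1 : f (tl_idp n) = 1).

Let fK u : f u != 0 -> involutive u. Proof. by move=> /fT[]. Qed.

Lemma kills_top (p p' : 'I_n) : p' = p.+1 :> nat ->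
  cap_off (inl p) (inl p') f = 0.
Proof. by move=> /fcap[]. Qed.

Lemma kills_bottom (p p' : 'I_n) : p' = p.+1 :> nat ->
  cap_off (inr p) (inr p') f = 0.
Proof. by move=> /fcap[]. Qed.

Lemma rev_succ (p p' : 'I_n) : p' = p.+1 :> nat -> rev_ord p = (rev_ord p').+1 :> nat.
Proof. by move=> pp /=; have := ltn_ord p'; rewrite pp; lia. Qed.

Implicit Types (x : 'I_k * ('I_n * 'I_n) -> skein 'I_4) (b : dart k -> skein (tl_points n)).

(** In the layer of cells next to the end [a], a left turn on one strand and a right turn on its
    successor form a cap on the box of that end. *)
Lemma kill_corner x b i a (p p' : 'I_n) : inv_weights x -> inv_weights b ->
  b (i, a) = f -> p' = p.+1 :> nat ->
  (forall u, x (i, grid_pos a p ord0) u != 0 -> u = turn_left a) ->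
  (forall u, x (i, grid_pos a p' ord0) u != 0 -> u = turn_right a) ->
  netsum W x b = 0.
Proof.
move=> xK bK ba pp xp xp'.
have [L0 _ _ _] := turn_leftE a; have [_ R3 _ _] := turn_rightE a.
apply: (netsum_kill cabled_wireK xK bK (d := (i, a)) (p := inl p) (q := inl p')).
- by apply/eqP => -[e]; move: pp; rewrite e => /n_Sn.
- by left; rewrite ba; apply: kills_top.
have e1 := cabled_wireK (inr ((i, a), inl p)).
have w1 : W (inr ((i, a), inl p)) = inl ((i, grid_pos a p ord0), a) by [].
have w3 : W (inl ((i, grid_pos a p' ord0), a)) = inr ((i, a), inl p') by apply: cabled_wire_border.
have w2 := cabled_wire_side i a ord0 pp.
apply: (ArcS (v := inl ((i, grid_pos a p ord0), a + 1))).
  rewrite w1 /forced; split; [exact: erefl|exact: isT|].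
  by move=> u /xp->.
rewrite -w3; apply: (ArcS (v := inl ((i, grid_pos a p' ord0), a))); last exact: Arc1.
rewrite w2 /forced; split; [exact: erefl|exact: isT|].
by move=> u /xp'->.
Qed.

Definition strand_at i a p (j : nat) : 'I_k * ('I_n * 'I_n) := (i, grid_pos a p (inord j)).

Definition strand_end i a p (j : nat) : pt :=
  if (j < n)%N then inl (strand_at i a p j, a) else inr ((i, a + 1 + 1), inl (rev_ord p)).

(* A cup entering the grid from the end [a] at depth [j] slides to the opposite end. *)
Lemma kill_ladder x b i a (p p' : 'I_n) (j : nat) s : inv_weights x -> inv_weights b ->
  b (i, a + 1 + 1) = f -> p' = p.+1 :> nat -> (j <= n)%N ->
  (forall l, (j <= l < n)%N -> x (strand_at i a p l) = crossing /\ x (strand_at i a p' l) = crossing) ->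
  arc W x b (ladder_above (strand_at i a p) (strand_at i a p') n (i, a + 1 + 1) j) s
     (strand_end i a p j) (strand_end i a p' j) -> netsum W x b = 0.
Proof.
move=> xK bK ba pp jn xc.
have inj (r r' : 'I_n) l l' : (l < n)%N -> (l' < n)%N -> strand_at i a r l = strand_at i a r' l' ->
    r = r' /\ l = l'.
  move=> ln ln' [/grid_pos_inj[-> /(congr1 val)]]; by rewrite /= !inordK.
have npp : p != p' by apply/eqP => e; move: pp; rewrite e => /n_Sn.
have Wst r l : (l < n)%N -> W (inl (strand_at i a r l, a + 1 + 1)) = strand_end i a r l.+1.
  move=> ln; rewrite /strand_end; case: ltnP => ln'.
    by apply: cabled_wire_out; rewrite !inordK.
  have -> : strand_at i a r l = (i, grid_pos a r ord_max).
    by congr (_, grid_pos _ _ _); apply: val_inj; rewrite /= inordK //; lia.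
  exact: cabled_wire_border_out.
apply: (netsum_ladder cabled_wireK (eps := a)) => //.
- by move=> l l' ln ln' /inj[].
- by move=> l l' ln ln' /inj[].
- by move=> l l' ln ln' /inj[] // e; rewrite e eqxx in npp.
- by move=> l ln; apply: cabled_wire_side.
- by move=> l ln; apply: Wst.
- by move=> l ln; apply: Wst.
- by rewrite (inj_eq (@inl_inj _ _)) (inj_eq rev_ord_inj).
- right; rewrite ba; apply: kills_top; exact: rev_succ.
Qed.

End CabledNet.

(** * Idempotents at every end of every crossing *)

Section CabledRelations.
Variables (L : link_diagram) (m : nat).
Local Notation n := m.+1.
Local Notation k := (crossings L).
Local Notation W := (@cabled_wire L m).
Variable f : skein (tl_points n).
Hypotheses (fT : in_TL f) (fcap : kills_caps f) (f1 : f (tl_idp n) = 1).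
Implicit Types (x : 'I_k * ('I_n * 'I_n) -> skein 'I_4) (b : dart k -> skein (tl_points n)).

Definition boxes (F : pred (dart k)) : dart k -> skein (tl_points n) :=
  fun d => if F d then f else tl_id n.

Lemma boxes_inv F : inv_weights (boxes F).
Proof.
move=> d u; rewrite /boxes; case: (F d); first by move=> /fT[].
by move/basisP->; apply: tl_idpK.
Qed.

Lemma update_boxes (F : pred (dart k)) (d : dart k) : ~~ F d -> update (boxes [predU1 d & F]) d (tl_id n) =1 boxes F.
Proof.
move=> nF d'; rewrite /update /boxes /=.
by have [->|nd] := eqVneq d' d; rewrite ?(negbTE nF).
Qed.

Lemma crossing_weights_inv (T : Type) : inv_weights (fun _ : T => crossing).
Proof. by move=> t u /crossingK. Qed.

Lemma boxes_insert x (F : pred (dart k)) (d : dart k) : ~~ F d ->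
  (forall u, f u != 0 -> u != tl_idp n ->
     netsum W x (update (boxes [predU1 d & F]) d (basis u)) = 0) ->
  netsum W x (boxes F) = netsum W x (boxes [predU1 d & F]).
Proof.
move=> nF kill; rewrite (netsum_insert (d := d) f1 _ kill); last by rewrite /boxes /= eqxx.
by apply: eq_netsum => // d'; rewrite update_boxes.
Qed.

(** A cap at the bottom of the box of [edge d] runs along the edge straight into the [f] at [d]. *)
Lemma insert_edge x (F : pred (dart k)) (d : dart k) : inv_weights x -> F d -> ~~ F (edge d) ->
  netsum W x (boxes F) = netsum W x (boxes [predU1 edge d & F]).
Proof.
move=> xK Fd nF; apply: boxes_insert => // u fu nu.
have [uK _ _] := fT fu.
have [a [a' [aa ua]]] := tl_bottom_cap (fT fu) (elimN eqP nu).
set b := update _ _ _.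
have bd : b d = f by rewrite /b /update eq_sym (negbTE (edge_neq d)) /boxes /= -topredE /= Fd orbT.
have be : b (edge d) = basis u by rewrite /b /update eqxx.
apply: (netsum_kill (@cabled_wireK L m) xK (d := d) (p := inr (rev_ord a)) (q := inr (rev_ord a'))).
- by apply: inv_weights_update => //; apply: boxes_inv.
- by rewrite (inj_eq (@inr_inj _ _)) (inj_eq rev_ord_inj); apply/eqP => e; move: aa; rewrite e => /n_Sn.
- by right; rewrite bd; apply: kills_bottom; last exact: rev_succ.
have w1 : W (inr (d, inr (rev_ord a))) = inr (edge d, inr a) by rewrite /= rev_ordK.
have w2 : W (inr (edge d, inr a')) = inr (d, inr (rev_ord a')) by rewrite /= edgeK.
rewrite -w2; apply: (ArcS (v := inr (edge d, inr a'))); last exact: Arc1.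
rewrite w1 /forced; split; [exact: erefl| |by move=> u'; rewrite be => /basisP->].
by rewrite /= (inj_eq (@inr_inj _ _)) (negbTE (edge_neq d)).
Qed.

(** A cap at the top of the new box faces the grid; it slides through all of it, from depth 0, to
    the [f] at the opposite end. *)
Lemma insert_across (F : pred (dart k)) (d : dart k) : F d -> ~~ F (across d) ->
  netsum W (fun _ => crossing) (boxes F) =
  netsum W (fun _ => crossing) (boxes [predU1 across d & F]).
Proof.
move=> Fd nF; apply: boxes_insert => // u fu nu.
have [uK _ _] := fT fu.
have [a [a' [aa ua]]] := tl_top_cap (fT fu) (elimN eqP nu).
set b := update _ _ _.
case: d Fd nF @b => i c Fd nF b.
have nd : (i, c) != across (i, c) by apply: contraNneq nF => <-.
have bd : b (i, c) = f by rewrite /b /update (negbTE nd) /boxes /= -topredE /= Fd orbT.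
have be : b (across (i, c)) = basis u by rewrite /b /update eqxx.
have oppK : c + 1 + 1 + 1 + 1 = c by apply: ord4_opp.
pose c' := c + 1 + 1.
apply: (@kill_ladder L m f fcap _ b i c' a a' 0 _ (@crossing_weights_inv _)) => //.
- by apply: inv_weights_update => //; apply: boxes_inv.
- by rewrite /c' oppK.
have w1 z : W (strand_end i c' z 0) = inr ((i, c'), inl z).
  have -> : strand_end i c' z 0 = inl ((i, grid_pos c' z ord0), c').
    rewrite /strand_end /strand_at; congr (inl ((_, grid_pos _ _ _), _)).
    by apply: val_inj; rewrite /= inordK.
  exact: cabled_wire_border.
have w2 : W (inr ((i, c'), inl a')) = strand_end i c' a' 0.
  by rewrite -w1 cabled_wireK.
rewrite -w2; apply: (ArcS (v := inr ((i, c'), inl a'))); last exact: Arc1.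
rewrite w1 /forced; split; [exact: erefl| |by move=> u'; rewrite be => /basisP->].
by rewrite /= /c' oppK -/c' eq_sym.
Qed.

Lemma component_rel_sym : connect_sym (@component_rel L).
Proof.
apply: sym_connect_sym => d d'; rewrite /component_rel /=; congr (_ || _).
  by apply/eqP/eqP => ->; rewrite edgeK.
have acK e : across (across e) = e :> dart k.
  by case: e => i c; rewrite /across /= ord4_opp.
by apply/eqP/eqP => ->; rewrite acK.
Qed.

(** Edges and passages through crossings generate the components of the link, and each component
    carries an [f] at its root to start from. *)
Lemma boxes_everywhere (F : pred (dart k)) : {subset fingraph.roots (@component_rel L) <= F} ->
  netsum W (fun _ => crossing) (boxes F) = netsum W (fun _ => crossing) (fun _ => f).
Proof.
have [N] := ubnP #|[predC F]|; elim: N F => // N IH F cF rF.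
have [/existsP[d /existsP[d' /and3P[Fd nF dd']]]|/existsPn cl] :=
    boolP [exists d, exists d', [&& F d, ~~ F d' & component_rel d d']].
  have -> : netsum W (fun _ => crossing) (boxes F) =
            netsum W (fun _ => crossing) (boxes [predU1 d' & F]).
    case/orP: dd' nF => /eqP-> nF; first exact: insert_edge (@crossing_weights_inv _) Fd nF.
    exact: insert_across.
  apply: IH => [|r /rF]; last by rewrite !inE => ->; rewrite orbT.
  rewrite ltnS in cF; apply: leq_trans cF.
  apply: proper_card; apply/properP; split.
    by apply/subsetP => z; rewrite !inE negb_or => /andP[].
  by exists d'; rewrite !inE ?eqxx //= nF.
apply: eq_netsum => // d; rewrite /boxes; suff -> : F d by [].
have clF : closed (@component_rel L) F.
  apply: intro_closed; first exact: component_rel_sym.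
  move=> z z' zz' Fz; apply: contraT => nF.
  by have /existsPn/(_ z') := cl z; rewrite -[F z]/(z \in F) -[F z']/(z' \in F) Fz nF zz'.
have := closed_connect clF (connect_root (@component_rel L) d).
by rewrite -!topredE /= => ->; apply: rF; apply: roots_root; apply: component_rel_sym.
Qed.

End CabledRelations.

(** * Expanding a cabled crossing into its two colored smoothings *)

Definition smooth_weight (s : bool) : skein 'I_4 :=
  [ffun u => (if s then varA else varA^-1) * basis (smoothing s) u].

Lemma smooth_weightP s u : smooth_weight s u != 0 -> u = smoothing s.
Proof. by rewrite ffunE; apply: contraNeq => nu; rewrite ffunE (negbTE nu) mulr0. Qed.

Lemma crossing_smooth u : crossing u = smooth_weight true u + smooth_weight false u.
Proof. by rewrite !ffunE. Qed.

Section ColoredKauffman.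
Variables (L : link_diagram) (m : nat).
Local Notation n := m.+1.
Local Notation k := (crossings L).
Local Notation W := (@cabled_wire L m).
Variable f : skein (tl_points n).
Hypotheses (fT : in_TL f) (fcap : kills_caps f).

(* In the colored smoothing [s] the outer strands follow the bottom row of the grid and
   its left or right column, where all the crossings are smoothed as prescribed by [s]. *)
Definition fixed_cell (s : bool) (g : 'I_n * 'I_n) : bool :=
  (g.2 == ord0) || (g.1 == if s then ord0 else ord_max).

(* [None] stands for a crossing that is still to be expanded. *)
Definition state_weight (o : 'I_k -> option bool) (t : 'I_k * ('I_n * 'I_n)) : skein 'I_4 :=
  if o t.1 is Some s then if fixed_cell s t.2 then smooth_weight s else crossing
  else crossing.

Let Z x := netsum W x (fun=> f).

Section OneCrossing.
Variables (o : 'I_k -> option bool) (i : 'I_k).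
Hypothesis oi : o i = None.

Let X (S : pred ('I_n * 'I_n)) (s : bool) (t : 'I_k * ('I_n * 'I_n)) : skein 'I_4 :=
  if (t.1 == i) && S t.2 then smooth_weight s else state_weight o t.

Let X_inv S s : inv_weights (X S s).
Proof.
move=> t u; rewrite /X; case: ifP => _; first by move/smooth_weightP->; apply: smoothingK.
rewrite /state_weight; case: (o t.1) => [s'|]; last exact: crossingK.
by case: ifP => _; [move/smooth_weightP->; apply: smoothingK|apply: crossingK].
Qed.

Let X_out S s g : ~~ S g -> X S s (i, g) = crossing.
Proof. by move=> nS; rewrite /X /= eqxx (negbTE nS) /state_weight oi. Qed.

Let X_in (S : pred ('I_n * 'I_n)) s g : S g -> X S s (i, g) = smooth_weight s.
Proof. by move=> Sg; rewrite /X /= eqxx Sg. Qed.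

Let upd S s g s' := update (X S s) (i, g) (smooth_weight s').

Let upd_inv S s g s' : inv_weights (upd S s g s').
Proof.
move=> t u; rewrite /upd /update; case: (t =P _) => _; last exact: X_inv.
by move/smooth_weightP->; apply: smoothingK.
Qed.

Let upd_at S s g s' u : upd S s g s' (i, g) u != 0 -> u = smoothing s'.
Proof. by rewrite /upd /update eqxx => /smooth_weightP. Qed.

Let upd_in (S : pred ('I_n * 'I_n)) s g s' g' u : g' != g -> S g' -> upd S s g s' (i, g') u != 0 -> u = smoothing s.
Proof.
move=> ng Sg; rewrite /upd /update xpair_eqE (negbTE ng) andbF X_in //.
exact: smooth_weightP.
Qed.

Let fix_cell S s g : ~~ S g -> Z (upd S s g (~~ s)) = 0 -> Z (X S s) = Z (X [predU1 g & S] s).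
Proof.
move=> nS z0; rewrite /Z (@netsum_split1 _ _ _ _ (X S s) (upd S s g s) (upd S s g (~~ s)) _ (i, g)).
- rewrite -/(Z (upd S s g (~~ s))) z0 addr0; apply: eq_netsum => // -[j g'].
  rewrite /upd /update /X /= xpair_eqE; case: eqP => // _ /=.
  by case: (g' =P g).
- move=> u; rewrite X_out // /upd /update eqxx crossing_smooth.
  by case: s {z0}; rewrite // addrC.
- by move=> t nt; rewrite /upd /update (negbTE nt).
Qed.

Let eqX (S S' : pred ('I_n * 'I_n)) s : S =1 S' -> Z (X S s) = Z (X S' s).
Proof. by move=> SS; apply: eq_netsum => // t; rewrite /X SS. Qed.

Let row j : pred ('I_n * 'I_n) := fun g => (g.2 == ord0) && (g.1 < j)%N.

(** In the bottom row, A followed by B caps off the box below. B followed by A gives a cup opening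
    upwards, which slides from depth 1 to the box at the opposite end. *)
Let row_kill s (j j' : 'I_n) : j' = j.+1 :> nat -> Z (upd (row j') s (j', ord0) (~~ s)) = 0.
Proof.
move=> jj; have njj : (j, ord0) != (j', ord0) :> 'I_n * 'I_n.
  by apply/eqP => -[e]; move: jj; rewrite e => /n_Sn.
have Sj : row j' (j, ord0) by rewrite /row /= jj ltnS leqnn.
have bK : inv_weights (fun _ : dart k => f) by move=> d u /fT[].
case: s.
  apply: (@kill_corner _ _ _ fcap _ _ i ord0 j j') => // u; first exact: upd_in njj Sj.
  exact: upd_at.
set x := upd _ _ _ _.
have xP u : x (i, (j, ord0)) u != 0 -> u = smoothing false by exact: upd_in njj Sj.
have xQ u : x (i, (j', ord0)) u != 0 -> u = smoothing true by exact: upd_at.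
have pos p : grid_pos ord0 p ord0 = (p, ord0) :> 'I_n * 'I_n by [].
have dead p : ~~ ladder_above (@strand_at L m i ord0 j) (@strand_at L m i ord0 j') n
    (i, ord0 + 1 + 1) 1 (inl (i, (p, ord0))).
  apply/existsP => -[l /andP[l1]]; rewrite /strand_at /grid_pos /= !xpair_eqE !eqxx /=.
  by case/orP=> /andP[_ /eqP/(congr1 val)]; rewrite /= inordK // => e; rewrite -e in l1.
have Wout p : W (inl ((i, grid_pos ord0 p ord0), ord0 + 1 + 1)) = strand_end i ord0 p 1.
  rewrite /strand_end; case: ltnP => n1.
    by apply: cabled_wire_out; rewrite inordK.
  have -> : ord0 = ord_max :> 'I_n by apply: val_inj; rewrite /=; lia.
  by rewrite cabled_wire_border_out.
apply: (@kill_ladder _ _ _ fcap x _ i ord0 j j' 1 _ (upd_inv (s:=_) (s':=_)) bK) => //.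
  move=> l /andP[l1 ln]; rewrite /x /upd /update.
  have lne p : strand_at i ord0 p l == (i, (j', ord0)) = false.
    rewrite /strand_at /grid_pos /= !xpair_eqE eqxx /=.
    by apply/negP => /andP[_ /eqP/(congr1 val)]; rewrite /= inordK // => e; rewrite e in l1.
  have nrow p : ~~ row j' (p, inord l).
    rewrite /row /= negb_and; apply/orP; left; apply/negP => /eqP/(congr1 val).
    by rewrite /= inordK // => e; rewrite e in l1.
  by rewrite !lne !X_out //; apply: nrow.
have W1 : W (strand_end i ord0 j 1) = inl ((i, grid_pos ord0 j ord0), ord0 + 1 + 1).
  by rewrite -Wout cabled_wireK.
apply: (ArcS (v := inl ((i, grid_pos ord0 j ord0), ord0 + 1))).
  rewrite W1 /forced pos; split; [exact: erefl|exact: dead|].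
  by move=> u /xP->; rewrite ffunE; apply: val_inj.
apply: (ArcS (v := inl ((i, grid_pos ord0 j' ord0), ord0 + 1 + 1))).
  rewrite (cabled_wire_side i ord0 ord0 jj) /forced pos; split; [exact: erefl|exact: dead|].
  by move=> u /xQ->; rewrite ffunE; apply: val_inj.
by rewrite -Wout; apply: Arc1.
Qed.

Let column s j : pred ('I_n * 'I_n) :=
  fun g => (g.2 == ord0) || (g.1 == if s then ord0 else ord_max) && (g.2 < j)%N.

(** This is why A uses the left column and B the right one: with this choice a change of smoothing
    along the column caps off the adjacent box directly. *)
Let column_kill s (j j' : 'I_n) : j' = j.+1 :> nat ->
  Z (upd (column s j') s (if s then ord0 else ord_max, j') (~~ s)) = 0.
Proof.
move=> jj; set c := if s then _ else _.
have njj : (c, j) != (c, j') :> 'I_n * 'I_n.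
  by apply/eqP => -[e]; move: jj; rewrite e => /n_Sn.
have Sj : column s j' (c, j) by rewrite /column /= jj ltnS leqnn eqxx orbT.
have bK : inv_weights (fun _ : dart k => f) by move=> d u /fT[].
rewrite /c in njj Sj *; case: s @c njj Sj => c njj Sj.
  apply: (@kill_corner _ _ _ fcap _ _ i ord_max (rev_ord j') (rev_ord j)) => //.
  - exact: rev_succ.
  - by move=> u; rewrite /grid_pos /= rev_ordK; apply: upd_at.
  - by move=> u; rewrite /grid_pos /= rev_ordK; apply: upd_in.
have rev0 : rev_ord ord0 = ord_max :> 'I_n by apply: val_inj; rewrite /= subn1.
apply: (@kill_corner _ _ _ fcap _ _ i 1 j j') => // u; rewrite /grid_pos /= rev0.
  exact: upd_in.
exact: upd_at.
Qed.

Lemma netsum_split_crossing :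
  Z (state_weight o) = Z (state_weight (update o i (Some true))) +
                       Z (state_weight (update o i (Some false))).
Proof.
have predU1E (S : pred ('I_n * 'I_n)) g g' : [predU1 g & S] g' = (g' == g) || S g' by [].
(* Only the corner cell gives two terms; its smoothing propagates along the bottom row and then up
   the column. *)
have rows (j : 'I_n) : Z (state_weight o) = Z (X (row j.+1) true) + Z (X (row j.+1) false).
  case: j => j; elim: j => [|j IH] jn.
    rewrite /Z (@netsum_split1 _ _ _ _ _ (X (row 1) true) (X (row 1) false) _ (i, (ord0, ord0))) //.
      move=> u; rewrite !X_in // -crossing_smooth /state_weight /= oi //.
    move=> [i' [y z]] nt; have E : (i' == i) && row 1 (y, z) = false.
      apply: contraNF nt => /andP[/eqP-> /andP[/= /eqP-> y0]].
      by rewrite !xpair_eqE !eqxx /= andbT -val_eqE /= -leqn0 -ltnS.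
    by rewrite /X E.
  rewrite (IH (ltnW jn)); have jj := row_kill (j := Ordinal (ltnW jn)) (j' := Ordinal jn) _ erefl.
  have ext s : Z (X (row j.+1) s) = Z (X (row j.+2) s).
    have nS : ~~ row j.+1 (Ordinal jn, ord0) by rewrite /row /= ltnn.
    rewrite (fix_cell nS (jj s)).
    apply: eqX => -[y z]; rewrite predU1E /row /= xpair_eqE -!val_eqE /=.
    by case: (val z == 0)%N; rewrite ?andbF ?andbT //= -leq_eqVlt.
  by rewrite !ext.
have cols s (j : 'I_n) : Z (X (row n) s) = Z (X (column s j.+1) s).
  case: j => j; elim: j => [|j IH] jn.
    apply: eqX => -[y z]; rewrite /row /column /= ltn_ord andbT.
    by rewrite ltnS leqn0 -!val_eqE /=; case: (val z == 0)%N; rewrite ?andbF.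
  rewrite (IH (ltnW jn)); have jj := column_kill (j := Ordinal (ltnW jn)) (j' := Ordinal jn) _ erefl.
  have nS : ~~ column s j.+1 (if s then ord0 else ord_max, Ordinal jn).
    by rewrite /column /= ltnn andbF.
  rewrite (fix_cell nS (jj s)).
  apply: eqX => -[y z]; rewrite predU1E /column /= xpair_eqE -!val_eqE /=.
  by case: (val y == _)%N; case: (val z == 0)%N; rewrite ?andbF ?orbT //= -leq_eqVlt.
have full s : Z (X (row n) s) = Z (state_weight (update o i (Some s))).
  rewrite (cols s ord_max); apply: eq_netsum => // -[i' g].
  rewrite /X /state_weight /update /=; case: eqP => [->|_] //=.
  by rewrite /column /= /fixed_cell ltn_ord andbT oi; case: ifP.
by rewrite (rows ord_max) !full.
Qed.

End OneCrossing.

End ColoredKauffman.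

Local Close Scope ring_scope.

(** * Component counts under changes of smoothing *)

Section Flips.
Variables (T : finType) (c : (T -> bool) -> nat).
Hypothesis c_ext : forall s s', s =1 s' -> c s = c s'.
Hypothesis c_flip : forall s t, c s <= (c (update s t (~~ s t))).+1.
Hypothesis c_first : forall t, (c (update (fun=> false) t true)).+1 <= c (fun=> false).

Lemma flips_le (s s' : T -> bool) : c s <= c s' + #|[pred t | s t != s' t]|.
Proof.
have [N] := ubnP #|[pred t | s t != s' t]|; elim: N s => // N IH s sN.
have [t dt|same] := pickP [pred t | s t != s' t]; last first.
  by rewrite (c_ext (s' := s')) ?leq_addr // => t; apply/eqP/negbFE/same.
have {}dt : s t != s' t := dt.
pose s1 := update s t (~~ s t).
have e1 : #|[pred t | s t != s' t]| = #|[pred t | s1 t != s' t]|.+1.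
  rewrite (cardD1 t) inE dt add1n; congr _.+1; apply: eq_card => u; rewrite !inE /s1 /update.
  have [->|//] := eqVneq u t; move: dt => /=; by case: (s t); case: (s' t).
have e2 : c s <= (c s1).+1 by apply: c_flip.
by apply: leq_trans e2 _; rewrite e1 addnS ltnS; apply: IH; rewrite e1 in sN.
Qed.

(** The first flip loses a component where [flips_le] would allow one to be gained, hence the 2. *)
Lemma flips_none (s : T -> bool) : (exists t, s t) -> c s + 2 <= c (fun=> false) + #|[pred t | s t]|.
Proof.
move=> [t st]; pose s1 := update (fun=> false) t true.
have h := flips_le s s1; have h1 := c_first t; rewrite -/s1 in h1.
suff e : #|[pred t | s t]| = #|[pred t | s t != s1 t]|.+1 by lia.
rewrite (cardD1 t) inE st add1n; congr _.+1; apply: eq_card => u; rewrite !inE /s1 /update.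
by have [->|nu] := eqVneq u t; rewrite ?st //; case: (s u).
Qed.

End Flips.

Local Open Scope ring_scope.

Definition e0 : 'I_4 := Ordinal (isT : (0 < 4)%N).
Definition e1 : 'I_4 := Ordinal (isT : (1 < 4)%N).
Definition e2 : 'I_4 := Ordinal (isT : (2 < 4)%N).
Definition e3 : 'I_4 := Ordinal (isT : (3 < 4)%N).

Lemma smoothingE : [/\ smoothing true e0 = e1, smoothing true e1 = e0, smoothing true e2 = e3 &
  smoothing true e3 = e2] /\ [/\ smoothing false e0 = e3, smoothing false e1 = e2,
  smoothing false e2 = e1 & smoothing false e3 = e0].
Proof. by split; split; rewrite ffunE; apply: val_inj. Qed.

Lemma ord4P (P : 'I_4 -> Prop) : P e0 -> P e1 -> P e2 -> P e3 -> forall a, P a.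
Proof.
move=> h0 h1 h2 h3 a; case: a => -[|[|[|[|]]]] // i.
- by rewrite (_ : Ordinal i = e0) //; apply: val_inj.
- by rewrite (_ : Ordinal i = e1) //; apply: val_inj.
- by rewrite (_ : Ordinal i = e2) //; apply: val_inj.
- by rewrite (_ : Ordinal i = e3) //; apply: val_inj.
Qed.

Lemma smoothing_neq s a : smoothing s a != a.
Proof.
have [[h0 h1 h2 h3] [g0 g1 g2 g3]] := smoothingE.
by case: s; elim/ord4P: a; rewrite ?h0 ?h1 ?h2 ?h3 ?g0 ?g1 ?g2 ?g3.
Qed.

Lemma smoothing_parity s a : odd (smoothing s a) = ~~ odd a.
Proof.
have [[h0 h1 h2 h3] [g0 g1 g2 g3]] := smoothingE.
by case: s; elim/ord4P: a; rewrite ?h0 ?h1 ?h2 ?h3 ?g0 ?g1 ?g2 ?g3.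
Qed.

(** The two smoothings pair the four ends of a crossing in ways that differ by a surgery. *)
Lemma swap_le (V : finType) (W : V -> V) (g g1 : V -> V) (v : 'I_4 -> V) (s : bool) :
  injective v -> (forall a, g (v a) = v (smoothing s a)) ->
  (forall a, g1 (v a) = v (smoothing (~~ s) a)) ->
  (forall z, (forall a, z != v a) -> g z = g1 z) ->
  (ncomp (fun z z' => (z' == W z) || (z' == g z)) <=
    (ncomp (fun z z' => (z' == W z) || (z' == g1 z))).+1)%N.
Proof.
have [[h0 h1 h2 h3] [k0 k1 k2 k3]] := smoothingE.
move=> vi gv g1v gg1.
have out a b c d : (forall x : 'I_4, x \in [:: a; b; c; d]) ->
    forall z, z \notin [:: v a; v b; v c; v d] -> g z = g1 z.
  move=> all4 z nz; apply: gg1 => x; apply: contraNneq nz => ->.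
  by rewrite -[_ :: _]/(map v [:: a; b; c; d]) mem_map.
case: s gv g1v => gv g1v.
  apply: (@surgery_le V W g g1 (v e0) (v e1) (v e3) (v e2)); rewrite ?gv ?g1v ?h0 ?h1 ?h2 ?h3 ?k0 ?k1 ?k2 ?k3 //.
  by apply: out; elim/ord4P.
apply: (@surgery_le V W g g1 (v e0) (v e3) (v e1) (v e2)); rewrite ?gv ?g1v ?h0 ?h1 ?h2 ?h3 ?k0 ?k1 ?k2 ?k3 //.
by apply: out; elim/ord4P.
Qed.

Lemma swap_merge (V : finType) (W : V -> V) (g g1 : V -> V) (v : 'I_4 -> V) :
  injective v -> (forall a, g (v a) = v (smoothing true a)) ->
  (forall a, g1 (v a) = v (smoothing false a)) ->
  (forall z, (forall a, z != v a) -> g z = g1 z) ->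
  involutive W -> (forall z, W z != z) -> involutive g1 -> (forall z, g1 z != z) ->
  ~~ linked (fun z z' => (z' == W z) || (z' == g1 z)) (v e0) (v e1) ->
  (ncomp (fun z z' => (z' == W z) || (z' == g z))).+1 =
    ncomp (fun z z' => (z' == W z) || (z' == g1 z)).
Proof.
have [[h0 h1 h2 h3] [k0 k1 k2 k3]] := smoothingE.
move=> vi gv g1v gg1 WK WN g1K g1N nl.
apply: (@surgery_merge V W g g1 (v e0) (v e1) (v e3) (v e2)); rewrite ?gv ?g1v ?h0 ?h1 ?h2 ?h3 ?k0 ?k1 ?k2 ?k3 //.
move=> z nz; apply: gg1 => x; apply: contraNneq nz => ->.
by rewrite -[_ :: _]/(map v [:: e0; e1; e3; e2]) mem_map //; elim/ord4P: x.
Qed.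

(** * The all-B state and its collapse *)

Section BState.
Variables (L : link_diagram) (m : nat).
Local Notation n := m.+1.
Local Notation k := (crossings L).
Local Notation W := (@cabled_wire L m).
Local Notation cell := ('I_k * ('I_n * 'I_n))%type.
Local Notation pt := (cell * 'I_4 + dart k * tl_points n)%type.
Local Notation bpt := (dart k * tl_points n)%type.

Definition kstate (tau : cell -> bool) : {ffun cell -> pairing 'I_4} :=
  [ffun t => smoothing (tau t)].

Definition kgraph (tau : cell -> bool) : rel pt :=
  net_graph W (kstate tau) (all_id (dart k) n).

Lemma kstateK tau t : involutive (kstate tau t).
Proof. by rewrite ffunE; apply: smoothingK. Qed.

Lemma kstateN tau t a : kstate tau t a != a.
Proof. by rewrite ffunE smoothing_neq. Qed.

(** The value of [outer_strand] for A. Among the nested arcs of the B-smoothing it is the strand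
    nearest to the centre of the crossing. *)
Definition innermost (a : 'I_4) : 'I_n := if odd a then ord0 else ord_max.

Definition bwire (z : bpt) : bpt := (z.1, tl_idp n z.2).

(* What is left of the states once the grids are collapsed: at a crossing of type [s]
   only the innermost strands follow the smoothing [s], the other ones follow the
   B-smoothing. *)
Definition bstep (s : 'I_k -> bool) (z : bpt) : bpt :=
  match z.2 with
  | inl p => ((z.1.1, smoothing (s z.1.1 && (p == innermost z.1.2)) z.1.2), inl (rev_ord p))
  | inr p => (@edge L z.1, inr (rev_ord p))
  end.

Definition bgraph s : rel bpt := fun z z' => (z' == bwire z) || (z' == bstep s z).

Lemma rev_innermost (a a' : 'I_4) : odd a' = ~~ odd a -> rev_ord (innermost a) = innermost a'.
Proof.
rewrite /innermost => ->; case: (odd a) => /=; apply: val_inj; rewrite /= ?subn1 //.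
by rewrite subSS subnn.
Qed.

Lemma innermost_rev s (a : 'I_4) p :
  (rev_ord p == innermost (smoothing s a)) = (p == innermost a).
Proof.
by rewrite -(@rev_innermost a) ?smoothing_parity // (inj_eq rev_ord_inj).
Qed.

Lemma bwireK : involutive bwire.
Proof. by move=> [d u]; rewrite /bwire /= tl_idpK. Qed.

Lemma bwireN z : bwire z != z.
Proof.
by case: z => d u; rewrite /bwire /= xpair_eqE eqxx /= ffunE; case: u.
Qed.

Lemma bstepK s : involutive (bstep s).
Proof.
move=> [[i a] [p|p]]; rewrite /bstep /= ?innermost_rev ?smoothingK ?rev_ordK //.
by rewrite edgeK.
Qed.

Lemma bstepN s z : bstep s z != z.
Proof.
case: z => [[i a] [p|p]]; rewrite /bstep /=.
  by apply/eqP => -[/eqP]; rewrite (negbTE (smoothing_neq _ _)).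
by apply/eqP => -[e _]; have := @edge_neq L (i, a); rewrite e eqxx.
Qed.

Definition blabel_index (d : dart k) (p : 'I_n) : 'I_n := if odd d.2 then rev_ord p else p.

(** The region along which a B-smoothed strand at [d] runs: it precedes an even end and follows an
    odd one, whence the [turn]. The number [blabel_index] is the depth counted from that region. *)
Definition face (d : dart k) : dart k :=
  fingraph.root (frel (@turn k \o @edge L)) (if odd d.2 then turn d else d).

Definition blabel (z : bpt) : dart k * 'I_n :=
  (face z.1, blabel_index z.1 match z.2 with inl p | inr p => p end).

Lemma face_sym : connect_sym (frel (@turn k \o @edge L)).
Proof.
apply: fconnect_sym; apply: inj_comp; last exact: (inv_inj (@edgeK L)).
by move=> [i a] [j b] e; have /= -> := congr1 fst e; have /addIr/= -> := congr1 snd e.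
Qed.

Hypotheses (halt : alternating L) (hred : reduced L).

Lemma odd_edge d : odd (@edge L d).2 = ~~ odd d.2.
Proof. by have := halt d; case: (odd _); case: (odd _). Qed.

(** The edges of an alternating diagram join even ends to odd ones, so a B-smoothed strand keeps its
    region and its depth both at crossings and along edges. *)
Lemma blabel_inv z z' : linked (bgraph (fun=> false)) z z' -> blabel z = blabel z'.
Proof.
apply: linked_inv => {z z'} [[d u]] z' /orP[]/eqP->.
  by rewrite /blabel /bwire /=; case: u => p; rewrite ffunE.
rewrite /blabel /bstep /=; case: u => p /=.
  congr (_, _); last by rewrite /blabel_index /= smoothing_parity; case: odd; rewrite //= rev_ordK.
  rewrite /face /= smoothing_parity; case: d => i a /=; rewrite ffunE /follows.
  by case: (odd a) => //=; rewrite /turn /= subrK.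
congr (_, _); last by rewrite /blabel_index /= odd_edge; case: odd; rewrite //= rev_ordK.
rewrite /face odd_edge; case: ifP => od /=; apply/eqP; rewrite (root_connect face_sym).
  by rewrite face_sym; apply: connect1; rewrite /= edgeK.
by apply: connect1; rewrite /= .
Qed.

(** These regions lie at opposite corners of the crossing, which is not nugatory. *)
Lemma face_distinct i : face (i, e0) != face (i, e1).
Proof.
have := hred (i, e0); rewrite (_ : across _ = turn (i, e1)); last by congr (_, _); apply: val_inj.
by rewrite /face [odd _]/= [odd (_, e1).2]/= -(root_connect face_sym).
Qed.

Lemma blabel_crossing i : blabel ((i, e0), inl ord_max) != blabel ((i, e1), inl ord0).
Proof. by rewrite /blabel xpair_eqE (negbTE (face_distinct i)). Qed.

(* The strands of the B-smoothed grid are staircases; they start either at the end 0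
   or at the end 1. *)
Definition staircase (g : 'I_n * 'I_n) (a : 'I_4) : nat := g.1 + g.2 + ((a == e1) || (a == e2)).

(** A staircase of level below [n] is moved to the strand of that number at the end 0, one of level
    [n] or more to the strand [level - n] at the end 1. *)
Definition retract (z : pt) : bpt :=
  match z with
  | inl ((i, g), a) =>
      if (staircase g a < n)%N then ((i, e0), inl (inord (staircase g a)))
      else ((i, e1), inl (inord (staircase g a - n)))
  | inr z => z
  end.

Let ext_inord (p : 'I_n) (j : nat) : j = p -> inord j = p.
Proof. by move=> ->; rewrite inord_val. Qed.

Lemma staircase_in a (p q q' : 'I_n) : q = q'.+1 :> nat ->
  staircase (grid_pos a p q) a = staircase (grid_pos a p q') (a + 1 + 1).
Proof.
move=> qq; have hq := ltn_ord q; elim/ord4P: a; rewrite /staircase /grid_pos /=; lia.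
Qed.

Lemma retract_border i a (p : 'I_n) :
  linked (bgraph (fun=> false)) (retract (inl ((i, grid_pos a p ord0), a))) ((i, a), inl p).
Proof.
have [_ [B0 B1 B2 B3]] := smoothingE.
have bs j c r : linked (bgraph (fun=> false)) ((j, smoothing false c), inl (rev_ord r)) ((j, c), inl r).
  by apply: linked1r; rewrite /bgraph /bstep /= eqxx orbT.
have hp := ltn_ord p.
rewrite /retract; set c := staircase _ _.
have : c = staircase (grid_pos a p ord0) a by [].
rewrite /staircase /grid_pos; elim/ord4P: a @c => c /= cE.
- rewrite (_ : (c < n)%N = true); last by lia.
  by rewrite (@ext_inord p); [exact: linked0 | lia].
- rewrite (_ : (c < n)%N = false); last by lia.
  by rewrite (@ext_inord p); [exact: linked0 | lia].
- rewrite (_ : (c < n)%N = false); last by lia.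
  rewrite (@ext_inord (rev_ord p)); last by rewrite /=; lia.
  by rewrite -B2; apply: bs.
rewrite (_ : (c < n)%N = true); last by lia.
rewrite (@ext_inord (rev_ord p)); last by rewrite /=; lia.
by rewrite -B3; apply: bs.
Qed.

Lemma retract_edge z z' : kgraph (fun=> false) z z' ->
  linked (bgraph (fun=> false)) (retract z) (retract z').
Proof.
have [_ [B0 B1 B2 B3]] := smoothingE.
have bs i a p : linked (bgraph (fun=> false)) ((i, a), inl p) ((i, smoothing false a), inl (rev_ord p)).
  by apply: linked1; rewrite /bgraph /bstep /= eqxx orbT.
case/orP=> /eqP->; last first.
  case: z => [[[i g] a]|[d u]] /=; last first.
    by rewrite ffunE; apply: linked1; rewrite /bgraph eqxx.
  rewrite ffunE; suff -> : staircase g (smoothing false a) = staircase g a by [].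
  by rewrite /staircase; elim/ord4P: a; rewrite ?B0 ?B1 ?B2 ?B3.
case: z => [[[i g] a]|[d [p|p]]]; last first.
- by apply: linked1; rewrite /bgraph /bstep /= eqxx orbT.
- by case: d => i a; rewrite linkedC; apply: retract_border.
rewrite -(grid_posK a g); case: (unliftP ord0 (grid_depth a g)) => [q|] e.
  have qq : grid_depth a g = (inord q : 'I_n).+1 :> nat.
    by rewrite e /= inordK // (leq_trans (ltn_ord q)).
  rewrite (cabled_wire_in _ _ _ qq) /retract (staircase_in _ _ qq).
  exact: linked0.
by rewrite e cabled_wire_border; apply: retract_border.
Qed.

End BState.

(** * Paths through a smoothed grid *)

Section GridPaths.
Variables (L : link_diagram) (m : nat).
Local Notation n := m.+1.
Local Notation k := (crossings L).
Local Notation W := (@cabled_wire L m).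
Local Notation cell := ('I_k * ('I_n * 'I_n))%type.
Local Notation pt := (cell * 'I_4 + dart k * tl_points n)%type.
Local Notation bpt := (dart k * tl_points n)%type.

Variables (tau : cell -> bool) (i : 'I_k).
Local Notation cell_at x y := ((i, (inord x, inord y)) : cell).
Local Notation P x y a := (inl (cell_at x y, a) : pt).
Local Notation Q a p := (inr ((i, a), inl (inord p)) : pt).
Local Notation "u ~~> v" := (linked (kgraph tau) u v) (at level 70).

Lemma kgraph_wire u v : W u = v -> u ~~> v.
Proof. by move=> <-; apply: linked_W. Qed.

Lemma kgraph_smoothing t a : inl (t, a) ~~> inl (t, smoothing (tau t) a).
Proof.
apply: linked1; rewrite /kgraph /net_graph (_ : step _ _ _ = inl (t, smoothing (tau t) a)) ?eqxx ?orbT //.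
by rewrite /step ffunE.
Qed.

Lemma kgraph_B x y : tau (cell_at x y) = false -> P x y e0 ~~> P x y e3 /\ P x y e1 ~~> P x y e2.
Proof.
move=> e; have [_ [B0 B1 _ _]] := smoothingE.
by have := kgraph_smoothing (cell_at x y) e0; have := kgraph_smoothing (cell_at x y) e1; rewrite e B0 B1.
Qed.

Lemma kgraph_A x y : tau (cell_at x y) -> P x y e0 ~~> P x y e1 /\ P x y e2 ~~> P x y e3.
Proof.
move=> e; have [[A0 _ A2 _] _] := smoothingE.
by have := kgraph_smoothing (cell_at x y) e0; have := kgraph_smoothing (cell_at x y) e2; rewrite e A0 A2.
Qed.

Lemma kgraph_east x y : (x < m)%N -> (y <= m)%N -> P x y e1 ~~> P x.+1 y e3.
Proof.
move=> xm ym; apply: kgraph_wire; rewrite /= /grid_depth /= inordK; last by lia.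
case: ifP => [/eqP|_]; first by lia.
congr (inl (_, (_, _), _)); apply: val_inj => //=.
by rewrite !inordK; lia.
Qed.

Lemma kgraph_north x y : (x <= m)%N -> (y < m)%N -> P x y e2 ~~> P x y.+1 e0.
Proof.
move=> xm ym; apply: kgraph_wire; rewrite /= /grid_depth /= inordK; last by lia.
case: ifP => [/eqP|_]; first by lia.
congr (inl (_, (_, _), _)); apply: val_inj => //=; rewrite !inordK; lia.
Qed.

Lemma kgraph_south_border x : P x 0%N e0 ~~> Q e0 x.
Proof. by apply: kgraph_wire; rewrite /= /grid_depth /= inordK. Qed.

Lemma kgraph_east_border y : P m y e1 ~~> Q e1 y.
Proof. by apply: kgraph_wire; rewrite /= /grid_depth /= inordK // subSS subnn. Qed.

Lemma kgraph_north_border x : (x <= m)%N -> P x m e2 ~~> Q e2 (m - x).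
Proof.
move=> xm; apply: kgraph_wire; rewrite /= /grid_depth /= inordK // subSS subnn /=.
by congr (inr (_, inl _)); apply: val_inj; rewrite /= !inordK; lia.
Qed.

Lemma kgraph_west_border y : (y <= m)%N -> P 0%N y e3 ~~> Q e3 (m - y).
Proof.
move=> ym; apply: kgraph_wire; rewrite /= /grid_depth /= inordK //=.
by congr (inr (_, inl _)); apply: val_inj; rewrite /= !inordK; lia.
Qed.

Local Notation trans := (linked_trans).
Local Notation sym := (linkedC (kgraph tau)).

Definition leaves (v : pt) : Prop := exists z, v ~~> inr z.

Lemma leaves_trans u v : u ~~> v -> leaves v -> leaves u.
Proof. by move=> uv [z vz]; exists z; apply: trans uv vz. Qed.

Lemma leavesr u v : v ~~> u -> leaves v -> leaves u.
Proof. by rewrite sym; apply: leaves_trans. Qed.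

(** No circle is trapped inside a grid, so the points of the boxes meet all components, as
    [kcount_fixed] requires. *)
Lemma leaves_grid (s : bool) :
  (forall g, tau (i, g) = s && fixed_cell true g) -> forall g a, leaves (inl ((i, g), a)).
Proof.
move=> tE.
have tE' x y : (x <= m)%N -> (y <= m)%N -> tau (cell_at x y) = s && ((y == 0%N) || (x == 0%N)).
  by move=> xm ym; rewrite tE /fixed_cell /= -!val_eqE /= !inordK.
have lS x : leaves (P x 0%N e0) by eexists; apply: kgraph_south_border.
have lN x : (x <= m)%N -> leaves (P x m e2) by move=> xm; eexists; apply: kgraph_north_border.
have lW y : (y <= m)%N -> leaves (P 0%N y e3) by move=> ym; eexists; apply: kgraph_west_border.
suff all_x x : (x <= m)%N -> forall y, (y <= m)%N -> forall a, leaves (P x y a).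
  move=> [x y] a; have := all_x x (ltnSE (ltn_ord x)) y (ltnSE (ltn_ord y)) a.
  by rewrite !inord_val.
elim: x => [|x IH] xm.
- case es : s.
  + have up y : (y <= m)%N -> leaves (P 0%N y e2).
      move=> ym; have [|_ h] := @kgraph_A 0 y; first by rewrite tE' // es eqxx orbT.
      exact: leaves_trans h (lW _ ym).
    move=> y ym; have [|h01 h23] := @kgraph_A 0 y; first by rewrite tE' // es eqxx orbT.
    have l0 : leaves (P 0%N y e0).
      case: y ym h01 {h23} => [|y] ym h01; first exact: lS.
      have h := @kgraph_north 0 y (leq0n m) ym; exact: leavesr h (up y (ltnW ym)).
    by elim/ord4P; [|exact: leavesr h01 l0|exact: up|exact: lW].
  have l0 y : (y <= m)%N -> leaves (P 0%N y e0).
    move=> ym; have [|h _] := @kgraph_B 0 y; first by rewrite tE' // es.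
    exact: leaves_trans h (lW _ ym).
  move=> y ym; have [|h03 h12] := @kgraph_B 0 y; first by rewrite tE' // es.
  have l2 : leaves (P 0%N y e2).
    have [ylt|yge] := ltnP y m; last by rewrite (_ : y = m); [exact: lN | by lia].
    by apply: leaves_trans (l0 y.+1 ylt); apply: kgraph_north; lia.
  by elim/ord4P; [exact: l0|exact: leaves_trans h12 l2| |exact: lW].
have lw y : (y <= m)%N -> leaves (P x.+1 y e3).
  by move=> ym; apply: leavesr (IH _ _ ym e1); [apply: kgraph_east | lia].
have l0 y : (y <= m)%N -> leaves (P x.+1 y e0).
  case: y => [|y] ym; first exact: lS.
  have [|h _] := @kgraph_B x.+1 y.+1; first by rewrite tE' // andbF.
  exact: leaves_trans h (lw _ ym).
have l2 y : (y <= m)%N -> leaves (P x.+1 y e2).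
  move=> ym; have [ylt|yge] := ltnP y m; last by rewrite (_ : y = m); [exact: lN | by lia].
  by apply: leaves_trans (l0 y.+1 ylt); apply: kgraph_north; lia.
move=> y ym; elim/ord4P; [exact: l0| |exact: l2|exact: lw].
case e : (tau (cell_at x.+1 y)).
  by have [h _] := kgraph_A e; apply: leavesr h (l0 _ ym).
by have [_ h] := kgraph_B e; apply: leaves_trans h (l2 _ ym).
Qed.

(** A staircase alternates between two antidiagonals of neighbouring level. Those in the lower left
    half join the ends 0 and 3, those in the upper right half the ends 1 and 2. *)
Lemma grid_paths_B : (forall g, tau (i, g) = false) ->
  forall a (p : 'I_n), inr ((i, a), inl p) ~~> inr ((i, smoothing false a), inl (rev_ord p)).
Proof.
move=> tE; have [_ [B0 B1 B2 B3]] := smoothingE.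
have lowl x : forall y, (x + y <= m)%N -> P x y e0 ~~> Q e3 (m - (x + y)).
  elim: x => [|x IH] y xy.
    have [h0 _] := kgraph_B (tE (inord 0, inord y)).
    by apply: trans h0 _; apply: kgraph_west_border; lia.
  have [h _] := kgraph_B (tE (inord x.+1, inord y)).
  apply: trans h _; rewrite sym; apply: trans (kgraph_east _ _); [|lia..].
  rewrite sym; have [_ h12] := kgraph_B (tE (inord x, inord y)).
  apply: trans h12 _; apply: trans (kgraph_north _ _) _; [lia..|].
  by rewrite addSnnS; apply: IH; rewrite -addSnnS.
have low (p : 'I_n) : Q e0 p ~~> Q e3 (rev_ord p).
  have hp := ltn_ord p.
  rewrite sym; apply: trans (kgraph_south_border _); rewrite sym.
  rewrite /= subSS -{2}(addn0 p); apply: lowl; lia.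
have uppl y : forall x, (m <= x + y)%N -> (x <= m)%N -> (y <= m)%N -> P x y e2 ~~> Q e1 (x + y - m).
  elim: y => [|y IH] x xy xm ym; rewrite sym.
    have [_ h12] := kgraph_B (tE (inord x, inord 0)); apply: trans h12; rewrite sym.
    rewrite (_ : x = m) ?addnK ?addn0 ?subnn //; [exact: kgraph_east_border | lia].
  have [_ h12] := kgraph_B (tE (inord x, inord y.+1)); apply: trans h12.
  have [xlt|xge] := ltnP x m; last first.
    rewrite (_ : x = m) ?addKn; last by lia.
    by rewrite sym; apply: kgraph_east_border.
  rewrite sym; apply: trans (kgraph_east _ _) _ => //.
  have [h03 _] := kgraph_B (tE (inord x.+1, inord y.+1)).
  rewrite sym; apply: trans h03; rewrite sym; rewrite sym; apply: trans (kgraph_north _ _); [|lia..].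
  by rewrite sym -addSnnS; apply: IH; lia.
have upp (p : 'I_n) : Q e1 p ~~> Q e2 (rev_ord p).
  have hp := ltn_ord p; rewrite sym; rewrite sym.
  have h1 : P p m e2 ~~> Q e2 (rev_ord p) by rewrite /= subSS; apply: kgraph_north_border; lia.
  by apply: trans h1; rewrite sym; have := @uppl m p; rewrite addnK; apply; lia.
move=> a p; have lo (r : 'I_n) := low r; have up (r : 'I_n) := upp r.
elim/ord4P: a; rewrite ?B0 ?B1 ?B2 ?B3.
- by have := lo p; rewrite !inord_val.
- by have := up p; rewrite !inord_val.
- by have := up (rev_ord p); rewrite !inord_val rev_ordK sym.
by have := lo (rev_ord p); rewrite !inord_val rev_ordK sym.
Qed.

(** The bottom row moves a strand coming from the south one column to the east, and the left column
    moves it one row down before it leaves to the west, so it still follows the B-smoothing. The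
    last strand is pushed out to the east and follows A. The strands of the opposite ends behave
    likewise. *)
Lemma grid_paths_A : (forall g, tau (i, g) = fixed_cell true g) ->
  forall a (p : 'I_n),
    inr ((i, a), inl p) ~~> inr ((i, smoothing (p == innermost m a) a), inl (rev_ord p)).
Proof.
move=> tE; have [[A0 A1 A2 A3] [B0 B1 B2 B3]] := smoothingE.
have tE' x y : (x <= m)%N -> (y <= m)%N -> tau (cell_at x y) = (y == 0%N) || (x == 0%N).
  by move=> xm ym; rewrite tE /fixed_cell /= -!val_eqE /= !inordK.
have kB x y : (0 < x <= m)%N -> (0 < y <= m)%N -> P x y e0 ~~> P x y e3 /\ P x y e1 ~~> P x y e2.
  by move=> hx hy; apply: kgraph_B; rewrite tE'; lia.
have kA x y : (x <= m)%N -> (y <= m)%N -> (y == 0%N) || (x == 0%N) ->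
    P x y e0 ~~> P x y e1 /\ P x y e2 ~~> P x y e3.
  by move=> hx hy h; apply: kgraph_A; rewrite tE'.
have lowl x : forall y, (0 < y)%N -> (x.+1 + y <= n)%N -> P x.+1 y e0 ~~> Q e3 (m - (x + y.-1)).
  elim: x => [|x IH] y y0 xy.
    have [|| h _] := kB 1%N y; [lia..|]; apply: trans h _.
    rewrite sym; apply: trans (kgraph_east _ _); [|lia..].
    have [|||h01 h23] := kA 0%N y; [lia..|]; apply: trans h01; rewrite sym.
    have -> : y = y.-1.+1 by lia.
    rewrite sym; apply: trans (kgraph_north _ _); [|lia..]; rewrite sym.
    have [|||h01' h23'] := kA 0%N y.-1; [lia..|]; apply: trans h23' _; rewrite add0n.
    by apply: kgraph_west_border; lia.
  have [|| h _] := kB x.+2 y; [lia..|]; apply: trans h _.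
  rewrite sym; apply: trans (kgraph_east _ _); [|lia..]; rewrite sym.
  have [|| _ h] := kB x.+1 y; [lia..|]; apply: trans h _.
  apply: trans (kgraph_north _ _) _; [lia..|].
  by rewrite (_ : x.+1 + y.-1 = x + y.+1.-1)%N; [apply: IH; lia | lia].
have low (p : 'I_n) : (p < m)%N -> Q e0 p ~~> Q e3 (rev_ord p).
  move=> pm; rewrite sym; apply: trans (kgraph_south_border _); rewrite sym.
  have [|||h01 _] := kA p 0%N; [lia..|]; apply: trans h01 _.
  apply: trans (kgraph_east _ _) _; [lia..|].
  have [|||_ h23] := kA p.+1 0%N; [lia..|]; rewrite sym; apply: trans h23; rewrite sym.
  apply: trans (kgraph_north _ _) _; [lia..|].
  have -> : (rev_ord p = m - (p + 1.-1) :> nat)%N by rewrite /=; lia.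
  by apply: lowl; lia.
have uppl y : forall x, (m < x + y)%N -> (x <= m)%N -> (y <= m)%N -> P x y e2 ~~> Q e1 (x + y - m).
  elim: y => [|y IH] x xy xm ym; first by lia.
  have [|| _ h12] := kB x y.+1; [lia..|]; rewrite sym; apply: trans h12.
  have [xlt|xge] := ltnP x m; last first.
    rewrite (_ : x = m) ?addKn; last by lia.
    by rewrite sym; apply: kgraph_east_border.
  rewrite sym; apply: trans (kgraph_east _ _) _ => //.
  have [|| h03 _] := kB x.+1 y.+1; [lia..|].
  rewrite sym; apply: trans h03; apply: trans (kgraph_north _ _); [|lia..].
  by rewrite sym -addSnnS; apply: IH; lia.
have upp (p : 'I_n) : (0 < p)%N -> Q e1 p ~~> Q e2 (rev_ord p).
  move=> p0; have hp := ltn_ord p.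
  have h1 : P p m e2 ~~> Q e2 (rev_ord p) by rewrite /= subSS; apply: kgraph_north_border; lia.
  by apply: trans h1; rewrite sym; have := @uppl m p; rewrite addnK; apply; lia.
have inn0 : Q e0 m ~~> Q e1 0.
  rewrite sym; apply: trans (kgraph_south_border _); rewrite sym.
  have [|||h01 _] := kA m 0%N; [lia..|]; apply: trans h01 _; exact: kgraph_east_border.
have inn2 : Q e2 m ~~> Q e3 0.
  have h1 := @kgraph_north_border 0 (leq0n m); rewrite subn0 in h1.
  rewrite sym; apply: trans h1; have := @kgraph_west_border m (leqnn m); rewrite subnn => h2.
  rewrite sym; apply: trans h2.
  by have [|||_ h23] := kA 0%N m; [lia..|].
have im : inord m = ord_max :> 'I_n by apply: val_inj; rewrite /= inordK.
have i0 : inord 0 = ord0 :> 'I_n by apply: val_inj; rewrite /= inordK.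
have r0 : rev_ord ord_max = ord0 :> 'I_n by apply: val_inj; rewrite /= subnn.
have rm : rev_ord ord0 = ord_max :> 'I_n by apply: val_inj; rewrite /= subn1.
rewrite im i0 in inn0 inn2 => a p.
have p_max : (p != ord_max) -> (p < m)%N by have := ltn_ord p; rewrite -val_eqE /=; lia.
have p_0 : (p != ord0) -> (0 < p)%N by rewrite -val_eqE /=; lia.
elim/ord4P: a; rewrite /innermost /=; case: eqP => [->|/eqP pN]; rewrite ?B0 ?B1 ?B2 ?B3 ?A0 ?A1 ?A2 ?A3 ?r0 ?rm //.
- by have := low p (p_max pN); rewrite !inord_val.
- by rewrite sym.
- by have := upp p (p_0 pN); rewrite !inord_val.
- rewrite sym; have := upp (rev_ord p) _; rewrite !inord_val rev_ordK; apply; rewrite /= subSS subn_gt0; exact: p_max.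
- by rewrite sym.
rewrite sym; have := low (rev_ord p) _; rewrite !inord_val rev_ordK; apply; rewrite /= subSS; have := p_0 pN; have := ltn_ord p; lia.
Qed.

End GridPaths.

(** * Component counts of grid states *)

Section StateComponents.
Variables (L : link_diagram) (m : nat).
Local Notation n := m.+1.
Local Notation k := (crossings L).
Local Notation cell := ('I_k * ('I_n * 'I_n))%type.
Hypotheses (halt : alternating L) (hred : reduced L).

Definition bcount (s : 'I_k -> bool) : nat := ncomp (@bgraph L m s).
Definition kcount (tau : cell -> bool) : nat := ncomp (kgraph tau).

Lemma eq_bcount s s' : s =1 s' -> bcount s = bcount s'.
Proof.
move=> ss; have e z : @bstep L m s z = bstep s' z by case: z => [d [p|p]]; rewrite /bstep //= ss.
by apply: eq_ncomp => x y h; apply: linked1; move: h; rewrite /bgraph e.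
Qed.

Lemma eq_kcount tau tau' : tau =1 tau' -> kcount tau = kcount tau'.
Proof.
move=> tt; rewrite /kcount /kgraph (_ : kstate tau = kstate tau') //.
by apply/ffunP => t; rewrite !ffunE tt.
Qed.

Let v_inj (t : 'I_k) : injective (fun a : 'I_4 => ((t, a), inl (innermost m a)) : dart k * tl_points n).
Proof. by move=> a b []. Qed.

Let bstep_v s t a b : s t = b ->
  bstep s ((t, a), inl (innermost m a)) = ((t, smoothing b a), inl (innermost m (smoothing b a))) :> (dart k * tl_points n).
Proof. by move=> st; rewrite /bstep /= st eqxx andbT (rev_innermost _ (smoothing_parity b a)). Qed.

Let bstep_other s t b (z : dart k * tl_points n) :
  (forall a, z != ((t, a), inl (innermost m a))) -> bstep s z = bstep (update s t b) z.
Proof.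
case: z => [[j a] [p|p]] h; rewrite /bstep //= /update.
case: (j =P t) => // e; have := h a; rewrite e; case: (p =P innermost m a) => [->|_ _]; first by rewrite eqxx.
by rewrite !andbF.
Qed.

Lemma bcount_flip s t : (bcount s <= (bcount (update s t (~~ s t))).+1)%N.
Proof.
apply: (@swap_le _ (@bwire L m) (bstep s) (bstep (update s t (~~ s t))) _ (s t) (@v_inj t)) => [a|a|z h].
- exact: bstep_v.
- by apply: bstep_v; rewrite /update eqxx.
exact: bstep_other.
Qed.

Lemma bcount_first t : ((bcount (update (fun=> false) t true)).+1 <= bcount (fun=> false))%N.
Proof.
rewrite leq_eqVlt; apply/orP; left; apply/eqP.
apply: (@swap_merge _ (@bwire L m) (bstep (update (fun=> false) t true)) (bstep (fun=> false)) _ (@v_inj t)) => [a|a|z h|||||].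
- by apply: bstep_v; rewrite /update eqxx.
- exact: bstep_v.
- by symmetry; apply: bstep_other.
- exact: bwireK.
- exact: bwireN.
- exact: bstepK.
- exact: bstepN.
by apply: contra (blabel_crossing m hred t) => /(blabel_inv halt)->.
Qed.

Let u_inj (t : cell) : injective (fun a : 'I_4 => inl (t, a) : cell * 'I_4 + dart k * tl_points n).
Proof. by move=> a b []. Qed.

Lemma kcount_flip tau t : (kcount tau <= (kcount (update tau t (~~ tau t))).+1)%N.
Proof.
apply: (@swap_le _ (@cabled_wire L m) (step (kstate tau) (all_id (dart k) n))
  (step (kstate (update tau t (~~ tau t))) (all_id (dart k) n)) _ (tau t) (@u_inj t)) => [a|a|[[t' a]|z] h].
- by rewrite /step ffunE.
- by rewrite /step ffunE /update eqxx.
- rewrite /step !ffunE /update; case: (t' =P t) => // e; have := h a; by rewrite e eqxx.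
exact: erefl.
Qed.

Lemma staircase_eq i g g' a a' :
  linked (@kgraph L m (fun=> false)) (inl ((i, g), a)) (inl ((i, g'), a')) ->
  staircase g a = staircase g' a'.
Proof.
move=> /(linked_map (@retract_edge L m))/(blabel_inv halt).
have b h c : (@staircase m h c <= m + n)%N.
  by rewrite /staircase; case: h => x y /=; have := ltn_ord x; have := ltn_ord y; case: orb => /=; lia.
have := b g a; have := b g' a'; rewrite /retract; set c := staircase g a; set c' := staircase g' a' => h' h.
have fd := face_distinct hred i.
case: ifP => lc; case: ifP => lc' /eqP; rewrite /blabel xpair_eqE /=.
- by case/andP=> _ /eqP/(congr1 val); rewrite /blabel_index /= !inordK.
- by rewrite (negbTE fd).
- by rewrite eq_sym (negbTE fd).
by case/andP=> _ /eqP/rev_ord_inj/(congr1 val); rewrite /= !inordK; lia.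
Qed.

(** The ends 0 and 1 of a cell lie on staircases of consecutive levels, which are different
    components of the all-B state. *)
Lemma kcount_first t : ((kcount (update (fun=> false) t true)).+1 <= kcount (fun=> false))%N.
Proof.
rewrite leq_eqVlt; apply/orP; left; apply/eqP.
apply: (@swap_merge _ (@cabled_wire L m) (step (kstate (update (fun=> false) t true)) (all_id (dart k) n))
  (step (kstate (fun=> false)) (all_id (dart k) n)) _ (@u_inj t)) => [a|a|[[t' a]|z] h|||||].
- by rewrite /step ffunE /update eqxx.
- by rewrite /step ffunE.
- rewrite /step !ffunE /update; case: (t' =P t) => // e; have := h a; by rewrite e eqxx.
- exact: erefl.
- exact: cabled_wireK.
- exact: cabled_wire_neq.
- by move=> [[t' a]|[d z]]; rewrite /step ?kstateK ?all_idK.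
- move=> [[t' a]|[d z]]; rewrite /step.
    by apply/eqP => -[/eqP]; apply/negP; apply: kstateN.
  by apply/eqP => -[/eqP]; apply/negP; apply: all_idN.
case: t => i g; apply/negP => /staircase_eq; rewrite /staircase /=; lia.
Qed.

Lemma bcount_le_kcount : (bcount (fun=> false) <= kcount (fun=> false))%N.
Proof.
apply: (ncomp_le (h := @retract L m)); last exact: retract_edge.
by move=> z; exists (inr z); apply: linked0.
Qed.

Definition fixed_state (s : 'I_k -> bool) (t : cell) : bool := s t.1 && fixed_cell true t.2.

(** The crux of the estimate: for the count of components, the 2n-1 A-smoothings of a row and a
    column act as a single one in the collapsed graph. *)
Lemma kcount_fixed s : (kcount (fixed_state s) <= bcount s)%N.
Proof.
apply: (ncomp_le (h := inr)).
  move=> [[[i g] a]|z]; last by exists z; apply: linked0.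
  have := @leaves_grid L m (fixed_state s) i (s i) (fun _ => erefl) g a.
  by case=> z h; exists z.
move=> [d u] z /orP[]/eqP->.
  by apply: linked1; apply/orP; right; apply/eqP; rewrite /step ffunE.
case: u => p; last first.
  by apply: kgraph_wire; rewrite /= .
rewrite /bstep /=; case: d => i a /=; case e : (s i).
  by apply: grid_paths_A => g; rewrite /fixed_state /= e.
by apply: grid_paths_B => g; rewrite /fixed_state /= e.
Qed.

Lemma kcount_state (tau : cell -> bool) : (exists t, tau t) ->
  (kcount tau + 2 <= kcount (fun=> false) + #|[pred t | tau t]|)%N.
Proof.
move=> te; exact: (@flips_none _ kcount eq_kcount kcount_flip kcount_first tau te).
Qed.

(** Pass through [fixed_state s]: every cell where [tau] differs from it gains at most one
    component, and the rest of the way is made in the collapsed graph, with one flip for each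
    crossing of type A. *)
Lemma kcount_mixed (tau : cell -> bool) (s : 'I_k -> bool) : (exists i, s i) ->
  (kcount tau + 2 <= kcount (fun=> false) + #|[pred i | s i]| +
     #|[pred t | tau t != fixed_state s t]|)%N.
Proof.
move=> si; have := @flips_none _ bcount eq_bcount bcount_flip bcount_first s si.
have := @flips_le _ kcount eq_kcount kcount_flip tau (fixed_state s).
have := kcount_fixed s; have := bcount_le_kcount.
set D := #|_|; set p := #|_|; set c0 := kcount (fun=> false); set b0 := bcount (fun=> false).
move: (kcount tau) (kcount _) (bcount s) => ct cf bs; lia.
Qed.

End StateComponents.

(** * Orders of the colored states *)

Section StateOrders.
Variables (L : link_diagram) (m : nat).
Local Notation n := m.+1.
Local Notation k := (crossings L).
Local Notation W := (@cabled_wire L m).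
Local Notation cell := ('I_k * ('I_n * 'I_n))%type.
Hypotheses (halt : alternating L) (hred : reduced L).
Variable f : skein (tl_points n).
Hypotheses (fT : in_TL f) (fcap : kills_caps f) (f1 : f (tl_idp n) = 1).

Local Notation Z x := (netsum W x (fun=> f)).
Local Notation none := ((fun=> false) : cell -> bool).

Definition box_sum (sg : {ffun cell -> pairing 'I_4}) : QA :=
  fsum (fun _ : dart k => (f : pairing (tl_points n) -> QA)) (fun M => delta ^+ ncomp (net_graph W sg M)).

Lemma all_id_weight : \prod_d f (all_id (dart k) n d) = 1.
Proof. by rewrite big1 // => d _; rewrite ffunE f1. Qed.

Lemma vge_box_sum tau : vge (- ((kcount tau)%:Z *+ 2)) (box_sum (kstate tau)).
Proof.
apply: vge_sum => M _; have hB : vge 0 (\prod_d f (all_id (dart k) n d)) by rewrite all_id_weight; apply: (vgeA 0).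
have h := vge_coef (@cabled_wireK L m) (@cabled_wire_neq L m) (kstateK tau) (kstateN tau) fT fcap hB M.
apply: vge_weak (vgeM h (vgeX (ncomp (net_graph W (kstate tau) M)) (vexact_vge vexact_delta))).
by rewrite -/(kgraph tau) -/(kcount tau); lia.
Qed.

(** Neighbouring strands at an end run along the same region at different depths. *)
Lemma adequate d (a b : 'I_n) : b = a.+1 :> nat ->
  ~~ linked (kgraph none) (inr (d, inl a)) (inr (d, inl b)).
Proof.
move=> ab; apply/negP => /(linked_map (@retract_edge L m))/(blabel_inv halt).
move=> /eqP; rewrite xpair_eqE /= => /andP[_ /eqP].
rewrite /blabel_index /=; case: ifP => _; last by move=> e; move: ab; rewrite e => /n_Sn.
by move/rev_ord_inj => e; move: ab; rewrite e => /n_Sn.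
Qed.

(** By adequacy the term with identities in all boxes is the only one of lowest order, so it cannot
    be cancelled. *)
Lemma vexact_box_sum : vexact (- ((kcount none)%:Z *+ 2)) (box_sum (kstate none)).
Proof.
have hB : vge 0 (\prod_d f (all_id (dart k) n d)) by rewrite all_id_weight; apply: (vgeA 0).
rewrite /box_sum /fsum (bigD1 (all_id (dart k) n)); last exact: isT.
apply: vexactD.
  rewrite all_id_weight mul1r -/(kgraph none) -/(kcount none).
  have := vexactX (kcount none) vexact_delta.
  by rewrite (_ : -2 *+ kcount none = - ((kcount none)%:Z *+ 2)) //; lia.
apply: vge_sum => M nM.
have h := vge_coef_strict (@cabled_wireK L m) (@cabled_wire_neq L m) (kstateK none) (kstateN none) fT fcap hB
  adequate nM.
apply: vge_weak (vgeM h (vgeX (ncomp (net_graph W (kstate none) M)) (vexact_vge vexact_delta))).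
by rewrite -/(kgraph none) -/(kcount none); lia.
Qed.

Definition letter (s : bool) : int := if s then 1 else -1.

Lemma smoothing_tf : smoothing true != smoothing false.
Proof. by apply/eqP => /ffunP/(_ e0); rewrite !ffunE => /eqP. Qed.

Lemma smooth_weightE s : smooth_weight s (smoothing s) = varA ^ letter s.
Proof. by rewrite !ffunE eqxx mulr1; case: s; rewrite ?expr1z // exprN1. Qed.

Lemma crossingE s : crossing (smoothing s) = varA ^ letter s.
Proof.
rewrite !ffunE; have := smoothing_tf; case: s => h.
  by rewrite eqxx (negbTE h) mulr1 mulr0 addr0 expr1z.
by rewrite eq_sym (negbTE h) eqxx mulr1 mulr0 add0r exprN1.
Qed.

Lemma state_weight_supp (o : 'I_k -> option bool) (sg : {ffun cell -> pairing 'I_4}) :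
  (forall t, state_weight o t (sg t) != 0) -> exists tau : cell -> bool,
  [/\ sg = kstate tau,
      forall t s, o t.1 = Some s -> fixed_cell s t.2 -> tau t = s &
      \prod_t state_weight o t (sg t) =
        varA ^ ((#|[pred t | tau t]|)%:Z *+ 2 - (#|{: cell}|)%:Z)].
Proof.
move=> h; pose tau t := sg t == smoothing true; exists tau.
have sgE t : sg t = smoothing (tau t).
  rewrite /tau; have := h t; rewrite /state_weight; case: (o t.1) => [s|]; last first.
    by case/crossing_supp=> ->; rewrite ?eqxx // eq_sym (negbTE smoothing_tf).
  case: ifP => _.
    by move/smooth_weightP->; case: s; rewrite ?eqxx // eq_sym (negbTE smoothing_tf).
  by case/crossing_supp=> ->; rewrite ?eqxx // eq_sym (negbTE smoothing_tf).
have tauE t s : o t.1 = Some s -> fixed_cell s t.2 -> tau t = s.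
  move=> os fs; have := h t; rewrite /state_weight os fs => /smooth_weightP; rewrite /tau => ->.
  by case: s {os fs}; rewrite ?eqxx // eq_sym; apply/negbTE/smoothing_tf.
split=> //; first by apply/ffunP => t; rewrite ffunE -sgE.
rewrite (eq_bigr (fun t => varA ^ letter (tau t))); last first.
  move=> t _; rewrite sgE /state_weight; case os : (o t.1) => [s|]; last exact: crossingE.
  by case: ifP => fs; [rewrite (tauE _ _ os fs) smooth_weightE|exact: crossingE].
have pr (S : pred cell) s : \prod_(t | S t) varA ^ letter s = varA ^ (letter s * (#|S|)%:Z) :> QA.
  by rewrite prodr_const exprnP exprz_exp.
rewrite (bigID tau) /= (eq_bigr (fun=> varA ^ letter true)); last by move=> t ->.
rewrite [X in _ * X](eq_bigr (fun=> varA ^ letter false)); last by move=> t /negbTE->.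
rewrite !pr -varA_expD; congr (_ ^ _).
have c1 : #|[pred t | tau t]| = #|tau| by apply: eq_card.
have c2 : #|[predC tau]| = #|fun t => ~~ tau t| by apply: eq_card.
rewrite -(cardC tau) c1 c2 /letter mul1r mulN1r.
by move: #|tau| #|fun t => ~~ tau t| => A B; lia.
Qed.

(** The order of the all-B term with identities in the boxes: -1 for each cell and -2 for each
    circle. *)
Definition lowest_order : int := - (#|{: cell}|)%:Z - (kcount none)%:Z *+ 2.

Lemma fixed_card (s : 'I_k -> bool) :
  #|[pred t : cell | fixed_state s t]| = (#|[pred i | s i]| * (m + n))%N.
Proof.
rewrite (eq_card (B := [predX s & fixed_cell true])) ?cardX; last by case=> i g; rewrite !inE.
congr (_ * _)%N.
pose A := [predX ('I_n : pred 'I_n) & (pred1 (ord0 : 'I_n))].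
pose B := [predX (pred1 (ord0 : 'I_n)) & ('I_n : pred 'I_n)].
have cA : #|A| = n by rewrite cardX card1 card_ord muln1.
have cB : #|B| = n by rewrite cardX card1 card_ord mul1n.
have cU : #|[predU A & B]| = #|[pred g : 'I_n * 'I_n | fixed_cell true g]|.
  by apply: eq_card => -[x y]; rewrite !inE /= andbT.
have cI : #|[predI A & B]| = 1%N.
  by rewrite (eq_card (B := pred1 (ord0, ord0))) ?card1 // => -[x y]; rewrite !inE /= xpair_eqE andbT andbC.
have := cardUI A B; rewrite cA cB cU cI.
move=> e; transitivity #|[pred g : 'I_n * 'I_n | fixed_cell true g]|; first exact: eq_card.
by move: e; set c := #|_|; lia.
Qed.

Lemma split_true (tau : cell -> bool) (s : 'I_k -> bool) :
  (forall t, fixed_state s t -> tau t) ->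
  #|[pred t | tau t]| = (#|[pred i | s i]| * (m + n) + #|[pred t | tau t != fixed_state s t]|)%N.
Proof.
move=> ft; rewrite -fixed_card -(cardID (fixed_state s)); congr (_ + _)%N; apply: eq_card => t; rewrite !inE.
  by case e : (fixed_state s t); rewrite ?andbF // (ft t e).
have := ft t; rewrite [t \notin _]/(~~ fixed_state s t).
by case: (fixed_state s t) => [/(_ isT)->|_] //; case: (tau t).
Qed.

(** Let p be the number of crossings of type A and D that of the further A-smoothings. The excess
    over the lowest order is at least 2 (p (2n-1) + D) - 2 (p + D - 2) = 4 p (n-1) + 4; the D
    cancels, and p >= 1 gives 4n. *)
Lemma vge_state (s : 'I_k -> bool) : (exists i, s i) ->
  vge (lowest_order + (4 * n)%:Z) (Z (state_weight (fun i => Some (s i)))).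
Proof.
move=> [i si]; apply: vge_sum => sg _.
have [h|/forallPn[t]] := boolP [forall t, state_weight (fun i => Some (s i)) t (sg t) != 0]; last first.
  by rewrite negbK => /eqP t0; rewrite (bigD1 t) //= t0 !mul0r; apply: vge0.
have [tau [-> fixed ->]] := state_weight_supp (forallP h).
apply: vge_weak (vgeM (vgeA _) (vge_box_sum tau)).
have ft t : fixed_state s t -> tau t.
  by case/andP=> st ct; rewrite (fixed t true) // st.
rewrite (split_true ft) /lowest_order.
have := @kcount_mixed L m halt hred tau s (ex_intro _ i si).
have : (0 < #|[pred i | s i]|)%N by apply/card_gt0P; exists i.
set p := #|_|; set a := #|_|; set c0 := kcount _; set c1 := kcount tau; set N := #|_|.
move=> p0 hc; have : (m <= p * m)%N by rewrite leq_pmull.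
rewrite mulnDr mulnS; lia.
Qed.

Lemma vexact_state : vexact lowest_order (Z (state_weight (fun=> Some false))).
Proof.
have w1 : \prod_t state_weight (fun=> Some false) t (kstate none t) = varA ^ (- (#|{: cell}|)%:Z).
  rewrite (eq_bigr (fun=> varA ^ (-1))); last first.
    move=> t _; rewrite ffunE /state_weight; case: ifP => _; first exact: (smooth_weightE false).
    exact: (crossingE false).
  by rewrite prodr_const exprN1 exprVn -exprnN.
rewrite /netsum /fsum (bigD1 (kstate none)); last exact: isT.
apply: vexactD; first by rewrite w1; apply: vexactM (vexactA _) vexact_box_sum.
apply: vge_sum => sg nsg.
have [h|/forallPn[t]] := boolP [forall t, state_weight (fun=> Some false) t (sg t) != 0]; last first.
  by rewrite negbK => /eqP t0; rewrite (bigD1 t) //= t0 !mul0r; apply: vge0.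
have [tau [e _ ->]] := state_weight_supp (forallP h); rewrite e.
have [t tt] : exists t, tau t.
  have [t tt|tn] := pickP tau; first by exists t.
  by case/eqP: nsg; rewrite e; apply/ffunP => t; rewrite !ffunE tn.
apply: vge_weak (vgeM (vgeA _) (vge_box_sum tau)).
have := @kcount_state L m halt hred tau (ex_intro _ t tt); rewrite /lowest_order.
set a := #|_|; set c0 := kcount _; set c1 := kcount tau; set N := #|_|; lia.
Qed.

Let unexpanded (o : 'I_k -> option bool) := #|[pred i | o i == None]|.

Let unexpanded_update o i s : o i = None -> (unexpanded (update o i (Some s)) < unexpanded o)%N.
Proof.
move=> oi; apply: proper_card; apply/properP; split.
  by apply/subsetP => j; rewrite !inE /update; case: (j =P i).
by exists i; rewrite !inE ?oi // /update eqxx.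
Qed.

Lemma eq_state_weight o o' : o =1 o' -> Z (state_weight o) = Z (state_weight o').
Proof. by move=> oo; apply: eq_netsum => // t; rewrite /state_weight oo. Qed.

Lemma vge_partial_state o : (exists i, o i = Some true) ->
  vge (lowest_order + (4 * n)%:Z) (Z (state_weight o)).
Proof.
have [N] := ubnP (unexpanded o); elim: N o => // N IH o oN [i oi].
have [j|all] := pickP [pred j | o j == None].
  move=> /eqP oj; rewrite (netsum_split_crossing fT fcap oj).
  have ij : i != j by apply: contra_eq_neq oi => ->; rewrite oj.
  have u s := unexpanded_update s oj.
  by apply: vgeD; apply: IH; [have := u true; lia|exists i; rewrite /update (negbTE ij)
    |have := u false; lia|exists i; rewrite /update (negbTE ij)].
rewrite (@eq_state_weight o (fun i => Some (odflt false (o i)))).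
  by apply: vge_state; exists i; rewrite oi.
by move=> j; have := all j; rewrite /=; case: (o j).
Qed.

(** At each crossing the A-term goes into [R] at once, whatever is still unexpanded in it, by
    [vge_partial_state]; only the B-term is expanded further. *)
Lemma expand_states : exists2 R, vge (lowest_order + (4 * n)%:Z) R &
  Z (fun=> crossing) = Z (state_weight (fun=> Some false)) + R.
Proof.
suff h o : (forall i, o i != Some true) -> exists2 R, vge (lowest_order + (4 * n)%:Z) R &
    Z (state_weight o) = Z (state_weight (fun=> Some false)) + R.
  by apply: (h (fun=> None)).
have [N] := ubnP (unexpanded o); elim: N o => // N IH o oN onT.
have [j|all] := pickP [pred j | o j == None]; last first.
  exists 0; first exact: vge0.
  rewrite addr0; apply: eq_state_weight => j; have := all j; have := onT j; rewrite /=.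
  by case: (o j) => [[]|].
move=> /eqP oj; rewrite (netsum_split_crossing fT fcap oj).
have u := unexpanded_update false oj.
have [||R hR ->] := IH (update o j (Some false)); [exact: leq_trans u oN| |].
  by move=> i; rewrite /update; case: (i =P j).
exists (Z (state_weight (update o j (Some true))) + R); last by rewrite addrCA.
by apply: vgeD hR; apply: vge_partial_state; exists j; rewrite /update eqxx.
Qed.

End StateOrders.

(** * Flattening the cable of a diagram *)

Lemma sum_neq0 (I : finType) (P : pred I) (F : I -> QA) :
  \sum_(i | P i) F i != 0 -> exists2 i, P i & F i != 0.
Proof.
move=> nz; have [i /andP[Pi Fi]|F0] := pickP (fun i => P i && (F i != 0)); first by exists i.
case/eqP: nz; apply: big1 => i Pi; apply/eqP; have := F0 i; rewrite /= Pi /=.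
by move/negbT; rewrite negbK.
Qed.

Lemma juxt_supp (B C : finType) (x : skein B) (y : skein C) m : juxt x y m != 0 ->
  exists u v, [/\ m = juxt_pairing u v, x u != 0 & y v != 0].
Proof.
rewrite ffunE => /sum_neq0[[u v] /eqP<-] /=; rewrite mulf_eq0 negb_or => /andP[xu yv].
by exists u, v; split; [exact: erefl|exact: xu|exact: yv].
Qed.

Lemma family_supp (T B : finType) (x : T -> skein B) m : family x m != 0 ->
  exists2 mu, m = family_pairing mu & forall t, x t (mu t) != 0.
Proof.
rewrite ffunE => /sum_neq0[mu /eqP<- nz]; exists mu; [exact: erefl|move=> t].
by apply: contraNneq nz => xt; rewrite (bigD1 t) //= xt mul0r.
Qed.

Lemma glue_supp (I O : finType) (w : rel (I + O)) (x : skein I) m : glue w x m != 0 ->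
  exists2 u, m = glue_pairing w u & x u != 0.
Proof.
rewrite ffunE => /sum_neq0[u /eqP<-]; rewrite mulf_eq0 negb_or => /andP[xu _].
by exists u; [exact: erefl|exact: xu].
Qed.

Lemma juxt_pairing_inl (B C : finType) (u : pairing B) (v : pairing C) b :
  juxt_pairing u v (inl b) = inl (u b).
Proof. by rewrite ffunE. Qed.

Lemma juxt_pairing_inr (B C : finType) (u : pairing B) (v : pairing C) c :
  juxt_pairing u v (inr c) = inr (v c).
Proof. by rewrite ffunE. Qed.

Lemma family_pairingE (T B : finType) (mu : {ffun T -> pairing B}) t b :
  family_pairing mu (t, b) = (t, mu t b).
Proof. by rewrite ffunE. Qed.

Section CableFlat.
Variables (L : link_diagram) (n : nat) (f : skein (tl_points n)).
Local Notation k := (crossings L).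
Hypothesis fT : in_TL f.

Lemma cable_box_inv : inv_weights (cable_box (L := L) f).
Proof.
move=> d u; rewrite /cable_box; case: ifP => _; first by move=> /fT[].
by move/basisP->; apply: tl_idpK.
Qed.

Lemma cable_evalE (x : 'I_k -> skein ('I_4 * 'I_n)%type) : inv_weights x ->
  cable_eval f x = fsum (fun i => x i) (fun mu => fsum (fun d => cable_box (L := L) f d) (fun nu =>
    delta ^+ ncomp (closed_graph (@cable_wire L n) (juxt_pairing (family_pairing mu) (family_pairing nu)))))
    * tl_closure f ^+ circles L.
Proof.
move=> xK; rewrite /cable_eval bracketE; last first.
  move=> u /juxt_supp[v [v' [-> /family_supp[mu -> muP] /family_supp[nu -> nuP]]]].
  apply: juxt_pairingK; apply: family_pairingK => t; first exact: xK (muP t).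
  exact: cable_box_inv (nuP t).
by rewrite sum_juxt sum_family; congr (_ * _); apply: eq_fsum => // mu _; rewrite sum_family.
Qed.

Section Glued.
Variables (I : finType) (w : rel (I + 'I_4 * 'I_n)%type).
Hypotheses (w_fun : functional_wiring w) (w_out : forall o o', w (inr o) (inr o') = false).

(** The flattened cable with the ports of the crossings contracted: points inside a crossing are
    joined directly to the boxes. *)
Definition cable_graph (mu : {ffun 'I_k -> pairing I}) (nu : {ffun dart k -> pairing (tl_points n)}) :
    rel ('I_k * I + dart k * tl_points n)%type := fun u v =>
  match u, v with
  | inl (i, p), inl (i', p') => (i == i') && (w (inl p) (inl p') || (mu i p == p'))
  | inl (i, p), inr (d, inl q) =>
      (i == d.1) && (w (inl p) (inr (d.2, q)) || w (inr (d.2, q)) (inl p))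
  | inr (d, p), inr z' => (z' == (d, nu d p)) ||
      match p, z' with inr q, (d', inr q') => (d' == edge d) && (q' == rev_ord q) | _, _ => false end
  | _, _ => false
  end.

Let V := ('I_k * ('I_4 * 'I_n) + dart k * tl_points n)%type.

Let outside (nu : {ffun dart k -> pairing (tl_points n)}) : rel V := fun u v =>
  @cable_wire L n (inl u) (inl v) ||
  match u, v with inr (d, p), inr z => z == (d, nu d p) | _, _ => false end.

Let port (i : 'I_k) (o : 'I_4 * 'I_n) : V := inl (i, o).

Lemma ncomp_cable_graph (mu : {ffun 'I_k -> pairing I}) nu : (forall i, involutive (mu i)) ->
  (\sum_i glue_circles w (mu i) +
    ncomp (closed_graph (@cable_wire L n)
      (juxt_pairing (family_pairing [ffun i => glue_pairing w (mu i)]) (family_pairing nu))) =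
   ncomp (cable_graph mu nu))%N.
Proof.
move=> muK; have := ncomp_flat (outside nu) port w_fun w_out muK.
set H := flat_graph _ _ _ _.
have -> : ncomp (outer_graph w (outside nu) port mu) = ncomp (closed_graph (@cable_wire L n)
      (juxt_pairing (family_pairing [ffun i => glue_pairing w (mu i)]) (family_pairing nu))).
  apply: eq_ncomp => u v.
    case/orP=> [/orP[uv|]|].
    - by apply: linked1; rewrite /closed_graph uv.
    - case: u v => [//|[d p]] [//|z] /eqP->; apply: linked1; apply/orP; right; apply/eqP.
      by rewrite juxt_pairing_inr family_pairingE.
    - case/existsP=> i /existsP[o /andP[/eqP-> /eqP->]]; apply: linked1; apply/orP; right; apply/eqP.
      by rewrite juxt_pairing_inl family_pairingE [[ffun _ => _] _]ffunE.
  case/orP=> [uv|/eqP<-]; first by apply: linked1; rewrite /outer_graph /outside uv.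
  apply: linked1; case: u => [[i o]|[d p]].
    rewrite juxt_pairing_inl family_pairingE [[ffun _ => _] _]ffunE.
    by apply/orP; right; apply/existsP; exists i; apply/existsP; exists o; rewrite !eqxx.
  by rewrite juxt_pairing_inr family_pairingE /outer_graph /outside eqxx orbT.
rewrite addnC => <-.
pose h1 (z : V + 'I_k * I) : 'I_k * I + dart k * tl_points n :=
  match z with
  | inl (inl (i, (a, p))) => inr ((i, a), inl p) | inl (inr z) => inr z | inr z => inl z end.
pose h2 (z : 'I_k * I + dart k * tl_points n) : V + 'I_k * I :=
  match z with inl z => inr z | inr z => inl (inr z) end.
have port_box i a p : linked H (inl (inl (i, (a, p)))) (inl (inr ((i, a), inl p))).
  by apply: linked1; rewrite /H /flat_graph /outside /= !eqxx.
apply/eqP; rewrite eqn_leq; apply/andP; split.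
  apply: (ncomp_le (h := h2)).
    move=> [[[i [a p]]|z]|z]; first by exists (inr ((i, a), inl p)); apply: port_box.
      by exists (inr z); apply: linked0.
    by exists (inl z); apply: linked0.
  move=> [[i p]|[d p]] [[i' p']|[d' [q|q]]] //=.
  - by move=> e; apply: linked1.
  - case/andP=> /eqP-> e; rewrite linkedC; apply: linked_trans (linked1r (e := H) (x := inl (inr (d', inl q))) (y := inl (inl (d'.1, (d'.2, q)))) _) _.
      by rewrite /H /flat_graph /outside /= -surjective_pairing !eqxx.
    by apply: linked1r; apply/existsP; exists (d'.2, q); rewrite e eqxx.
  - case/orP=> [/eqP[-> ->]|]; last by case: p.
    by apply: linked1; rewrite /H /flat_graph /outside /= eqxx orbT.
  case/orP=> [/eqP[-> ->]|].
    by apply: linked1; rewrite /H /flat_graph /outside /= eqxx orbT.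
  by case: p => // p e; apply: linked1; rewrite /H /flat_graph /outside /= e.
apply: (ncomp_le (h := h1)).
  move=> [z|z]; first by exists (inr z); apply: linked0.
  by exists (inl (inr z)); apply: linked0.
move=> [[[i [a p]]|[d p]]|[i p]] [[[i' [a' p']]|[d' p']]|[i' p']] //=.
- rewrite /outside orbF /=; case: p' => // q /andP[/eqP<- /eqP->]; exact: linked0.
- by rewrite /outside /=; case: p.
- rewrite /outside /= => /orP[e|/eqP[-> ->]]; apply: linked1; rewrite /cable_graph ?eqxx //.
  by case: p p' e => // p [] // q ->; rewrite orbT.
- case/existsP=> -[b q] /andP[e /eqP[-> -> ->]]; apply: linked1.
  by rewrite /cable_graph eqxx.
- by case/existsP=> o; rewrite andbF.
by move=> e; apply: linked1.
Qed.

Lemma cable_eval_glue (y : 'I_k -> skein I) : inv_weights y ->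
  cable_eval f (fun i => glue w (y i)) =
  fsum (fun i => y i) (fun mu => fsum (fun d => cable_box (L := L) f d) (fun nu =>
    delta ^+ ncomp (cable_graph mu nu))) * tl_closure f ^+ circles L.
Proof.
move=> yK; rewrite cable_evalE; last first.
  by move=> i u /glue_supp[v -> /yK vK]; apply: glue_pairingK.
rewrite fsum_glue; congr (_ * _); apply: eq_fsum => // mu muP.
rewrite fsumZ; apply: eq_fsum => // nu _.
rewrite -exprD ncomp_cable_graph // => i; exact: yK (muP i).
Qed.

End Glued.
End CableFlat.

Lemma grid_wire_out n o o' : @grid_wire n (inr o) (inr o') = false.
Proof. by case: o o' => [a p] []. Qed.

Lemma grid_wire_fun n : functional_wiring (@grid_wire n).
Proof.
have inner (x y x1 y1 x2 y2 : 'I_n) (a a1 a2 : 'I_4) :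
    symrel (@grid_wire n) (inl ((x, y), a)) (inl ((x1, y1), a1)) ->
    symrel (@grid_wire n) (inl ((x, y), a)) (inl ((x2, y2), a2)) ->
    [/\ x1 = x2, y1 = y2 & a1 = a2].
  rewrite /symrel /= -!val_eqE /= => h1 h2; split; apply: val_inj; rewrite /=; lia.
pose strand (x y : 'I_n) (a : 'I_4) : nat :=
  match val a with 0 => x | 1 => y | 2 => n - x.+1 | _ => n - y.+1 end%N.
have border (x y : 'I_n) (a b : 'I_4) (p : 'I_n) :
    symrel (@grid_wire n) (inl ((x, y), a)) (inr (b, p)) ->
    a = b /\ strand x y a = p /\ [\/ a = e0 /\ y = 0%N :> nat, a = e1 /\ x.+1 = n,
      a = e2 /\ y.+1 = n | a = e3 /\ x = 0%N :> nat].
  rewrite /symrel /= orbF => /andP[/eqP<-]; elim/ord4P: a => /= /andP[/eqP e /eqP c]; split=> //; rewrite /strand /= e /=;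
    have := ltn_ord p; split; try lia.
  - by constructor 1.
  - by constructor 2.
  - by constructor 3.
  by constructor 4.
have excl (x y x1 y1 : 'I_n) (a a1 b : 'I_4) p : symrel (@grid_wire n) (inl ((x, y), a)) (inl ((x1, y1), a1)) ->
    symrel (@grid_wire n) (inl ((x, y), a)) (inr (b, p)) -> False.
  rewrite {1}/symrel /= -!val_eqE /= => h /border[_ [_ c]].
  have := ltn_ord x1; have := ltn_ord y1; have := ltn_ord x; have := ltn_ord y.
  by case: c h => -[-> c] /= h; lia.
move=> u v v'; case: u => [[[x y] a]|[b p]].
  case: v => [[[x1 y1] a1]|[b1 p1]]; case: v' => [[[x2 y2] a2]|[b2 p2]].
  - by move=> h /(inner _ _ _ _ _ _ _ _ _ h)[-> -> ->].
  - by move=> h /(excl _ _ _ _ _ _ _ _ h).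
  - by move=> h h'; case: (excl _ _ _ _ _ _ _ _ h' h).
  case/border=> eb [ep _] /border[eb' [ep' _]].
  by congr (inr (_, _)); [rewrite -eb|apply: val_inj; rewrite /= -ep].
case: v => [[[x1 y1] a1]|[b1 p1]] //; case: v' => [[[x2 y2] a2]|[b2 p2]] //.
rewrite [symrel _ _ _]orbC => /border[e1' [s1 c1]]; rewrite [symrel _ _ _]orbC => /border[e2' [s2 c2]].
subst b a2; congr (inl (_, _)); rewrite -s2 in s1.
have := ltn_ord x1; have := ltn_ord y1; have := ltn_ord x2; have := ltn_ord y2.
case: c1 s1 c2 => -[-> h1]; rewrite /strand /= => s1 [] [] // _ h2 *; congr (_, _); apply: val_inj => /=; lia.
Qed.

Definition grid_port (k n : nat) (i : 'I_k) (v : ('I_n * 'I_n) * 'I_4 + 'I_4 * 'I_n) :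
    ('I_k * ('I_n * 'I_n)) * 'I_4 + dart k * tl_points n :=
  match v with inl (g, a) => inl ((i, g), a) | inr (b, p) => inr ((i, b), inl p) end.

Section JonesNet.
Variables (L : link_diagram) (m : nat).
Local Notation n := m.+1.
Local Notation k := (crossings L).
Local Notation W := (@cabled_wire L m).

Lemma grid_cabled i g a : exists2 v, symrel (@grid_wire n) (inl (g, a)) v &
  W (inl ((i, g), a)) = grid_port i v.
Proof.
rewrite -(grid_posK a g); case: (unliftP ord0 (grid_depth a g)) => [q|] ->.
  have qq : lift ord0 q = (inord q : 'I_n).+1 :> nat.
    by rewrite /= inordK // (leq_trans (ltn_ord q)).
  exists (inl (grid_pos a (grid_strand a g) (inord q), a + 1 + 1)); last exact: (cabled_wire_in _ _ _ qq).
  have hq := ltn_ord (lift ord0 q); move: (grid_strand a g) (inord q) (lift ord0 q) qq hq => p q1 q2 qq hq.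
  by elim/ord4P: a => {g}; rewrite /symrel /= -?val_eqE /=; lia.
exists (inr (a, grid_strand a g)); last exact: cabled_wire_border.
move: (grid_strand a g) => p.
by elim/ord4P: a => {g}; rewrite /symrel /= -?val_eqE /=; lia.
Qed.

Lemma cabled_grid i g a v : symrel (@grid_wire n) (inl (g, a)) v -> W (inl ((i, g), a)) = grid_port i v.
Proof. by have [v' h ->] := grid_cabled i g a => /(grid_wire_fun h)->. Qed.

Lemma ncomp_cabled (sg : {ffun 'I_k * ('I_n * 'I_n) -> pairing 'I_4}) (M : {ffun dart k -> pairing (tl_points n)}) :
  ncomp (cable_graph (@grid_wire n) [ffun i => family_pairing [ffun g => sg (i, g)]] M) =
  ncomp (net_graph W sg M).
Proof.
set C := cable_graph _ _ _; set N := net_graph _ _ _.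
pose h1 (z : 'I_k * (('I_n * 'I_n) * 'I_4) + dart k * tl_points n) :
    ('I_k * ('I_n * 'I_n)) * 'I_4 + dart k * tl_points n :=
  match z with inl (i, (g, a)) => inl ((i, g), a) | inr z => inr z end.
pose h2 (z : ('I_k * ('I_n * 'I_n)) * 'I_4 + dart k * tl_points n) :
    'I_k * (('I_n * 'I_n) * 'I_4) + dart k * tl_points n :=
  match z with inl ((i, g), a) => inl (i, (g, a)) | inr z => inr z end.
have Nw u v : W u = v -> linked N u v by move=> <-; apply: linked_W.
have port i g a : linked C (inl (i, (g, a))) (h2 (W (inl ((i, g), a)))).
  have [[[g' b]|[b p]] e ->] := grid_cabled i g a; rewrite /grid_port /h2.
    by case/orP: e => e; [apply: linked1|apply: linked1r]; rewrite /C /cable_graph e eqxx.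
  by apply: linked1; rewrite /C /cable_graph eqxx /=.
apply/eqP; rewrite eqn_leq; apply/andP; split.
  apply: (ncomp_le (h := h2)).
    by move=> [[i [g a]]|z]; [exists (inl ((i, g), a))|exists (inr z)]; apply: linked0.
  move=> z z' /orP[]/eqP->; last first.
    case: z => [[[i g] a]|[d p]]; apply: linked1; rewrite /C /cable_graph /=.
      by rewrite eqxx; apply/orP; right; apply/eqP; rewrite ffunE family_pairingE ffunE.
    by rewrite eqxx.
  case: z => [[[i g] a]|[d [p|p]]]; first exact: port.
    have := port d.1 (grid_pos d.2 p ord0) d.2; rewrite cabled_wire_border -surjective_pairing linkedC.
    exact.
  by apply: linked1; rewrite /C /cable_graph /= !eqxx orbT.
apply: (ncomp_le (h := h1)).
  by move=> [[[i g] a]|z]; [exists (inl (i, (g, a)))|exists (inr z)]; apply: linked0.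
move=> [[i [g a]]|[d p]] [[i' [g' a']]|[d' p']] //=; rewrite ?ffunE.
- case/andP=> /eqP<- /orP[w|/eqP[<- <-]].
    by apply: Nw; rewrite (@cabled_grid i g a (inl (g', a'))) //; apply/orP; left; exact: w.
  exact: (linked_step W sg M (inl ((i, g), a))).
- case: p' => // q /andP[/eqP-> w]; apply: Nw.
  by rewrite (@cabled_grid _ g a (inr (d'.2, q))) // /grid_port -surjective_pairing.
case/orP=> [/eqP->|]; first exact: (linked_step W sg M (inr (d, p))).
by case: p p' => // p [] // q /andP[/eqP-> /eqP->]; apply: Nw.
Qed.

Lemma colored_jones_net (f : skein (tl_points n)) : in_TL f ->
  colored_jones L f = netsum W (fun=> crossing) (cable_box (L := L) f) * tl_closure f ^+ circles L.
Proof.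
move=> fT; rewrite /colored_jones /cabled_crossing.
rewrite (cable_eval_glue fT (@grid_wire_fun n) (@grid_wire_out n)); last first.
  move=> i u /family_supp[mu -> muP]; apply: family_pairingK => t; exact: crossingK (muP t).
rewrite fsum_family /netsum; congr (_ * _); apply: eq_fsum => // mu _; apply: eq_fsum => // nu _.
by rewrite ncomp_cabled.
Qed.

End JonesNet.

(** * The colored B-state *)

Lemma fsum_basis (T B : finType) (v : T -> pairing B) (F : {ffun T -> pairing B} -> QA) :
  fsum (fun t => basis (v t)) F = F [ffun t => v t].
Proof.
rewrite /fsum (bigD1 [ffun t => v t]); last exact: isT.
rewrite big1 ?mul1r => [|t _]; last by rewrite !ffunE eqxx.
rewrite big1 => [|mu nmu]; first exact: addr0.
have [t nt|all] := pickP (fun t => mu t != v t).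
  by rewrite (bigD1 t) //= ffunE (negbTE nt) !mul0r.
by case/eqP: nmu; apply/ffunP => t; rewrite ffunE; exact/eqP/negbFE/all.
Qed.

Lemma fsum_bool (T X : finType) (x : T * bool -> X -> QA) (F : {ffun T * bool -> X} -> QA) :
  fsum x F = fsum (fun t => x (t, true)) (fun M => fsum (fun t => x (t, false)) (fun N =>
    F [ffun d => if d.2 then M d.1 else N d.1])).
Proof.
rewrite /fsum; under [RHS]eq_bigr do rewrite mulr_sumr.
pose h (p : {ffun T -> X} * {ffun T -> X}) : {ffun T * bool -> X} := [ffun d => if d.2 then p.1 d.1 else p.2 d.1].
rewrite pair_bigA /= (reindex h) /=; last first.
  exists (fun mu => ([ffun t => mu (t, true)], [ffun t => mu (t, false)])) => [[M N]|mu] _.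
    by congr (_, _); apply/ffunP => t; rewrite !ffunE.
  by apply/ffunP => -[t []]; rewrite !ffunE.
apply: eq_bigr => -[M N] _; rewrite mulrA -big_split; congr (_ * _).
rewrite (eq_bigr (fun t => \prod_b x (t, b) (h (M, N) (t, b)))); last first.
  by move=> t _; rewrite big_bool !ffunE.
by rewrite pair_bigA; apply: eq_bigr => -[].
Qed.

(** [h] embeds the free discs and [p] recognises them; the remaining discs have only the state [v],
    of weight [c], and contribute a power of [c]. *)
Lemma fsum_extend (S T B : finType) (h : S -> T) (p : T -> option S) (x : T -> skein B) (y : S -> skein B)
    (c : QA) (v : pairing B) (F : {ffun T -> pairing B} -> QA) :
  pcancel h p -> ocancel p h ->
  (forall t, x t =1 if p t is Some s then y s else fun u => c * basis v u) ->
  fsum x F = c ^+ #|[pred t | p t == None]| *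
    fsum y (fun nu => F [ffun t => if p t is Some s then nu s else v]).
Proof.
move=> hK pK xE; pose ext (nu : {ffun S -> pairing B}) : {ffun T -> pairing B} :=
  [ffun t => if p t is Some s then nu s else v].
pose res (mu : {ffun T -> pairing B}) : {ffun S -> pairing B} := [ffun s => mu (h s)].
have extK nu : res (ext nu) = nu by apply/ffunP => s; rewrite !ffunE hK.
rewrite /fsum (bigID (fun mu => ext (res mu) == mu)) /= [X in _ + X]big1 ?addr0 => [|mu nmu]; last first.
  have [t /andP[/eqP pt nt]|all] := pickP (fun t => (p t == None) && (mu t != v)).
    by rewrite (bigD1 t) //= xE pt !ffunE (negbTE nt) mulr0 !mul0r.
  case/eqP: nmu; apply/ffunP => t; rewrite ffunE; have := all t; have := pK t.
  by case: (p t) => [s <-|_ /negbFE/eqP->]; rewrite ?ffunE.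
rewrite (reindex_onto ext res) => [|mu /eqP//].
rewrite mulr_sumr; apply: eq_big => [nu|nu _]; first by rewrite !extK !eqxx.
rewrite mulrA; congr (_ * _); rewrite (bigID (fun t => p t == None)) /=; congr (_ * _).
  rewrite -prodr_const; apply: eq_big => [t|t /eqP pt]; first by rewrite inE.
  by rewrite xE pt !ffunE pt eqxx mulr1.
rewrite (reindex_omap h p) => [|t]; last by have := pK t; case: (p t) => //= s ->.
apply: eq_big => [s|s _]; first by rewrite hK eqxx.
by rewrite xE ffunE hK.
Qed.

Section InnerCells.
Variable m : nat.
Local Notation n := m.+1.

(** The cells left free by the B-colored smoothing: without its bottom row and right column the grid
    is that of the (n-1)-parallel. *)
Definition inner_cell (g : 'I_n * 'I_n) : option ('I_m * 'I_m) :=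
  if (unlift ord_max g.1, unlift ord0 g.2) is (Some x, Some y) then Some (x, y) else None.

Definition outer_cell (g : 'I_m * 'I_m) : 'I_n * 'I_n := (lift ord_max g.1, lift ord0 g.2).

Lemma outer_cellK : pcancel outer_cell inner_cell.
Proof. by case=> x y; rewrite /inner_cell /= !liftK. Qed.

Lemma inner_cellK : ocancel inner_cell outer_cell.
Proof.
case=> x y; rewrite /inner_cell /=.
by case: unliftP => [x' ->|_] //=; case: unliftP => [y' ->|_].
Qed.

Lemma inner_cell_fixed g : (inner_cell g == None) = fixed_cell false g.
Proof.
case: g => x y; rewrite /inner_cell /fixed_cell /=.
case: unliftP => [x' ->|->]; last by rewrite orbC !eqxx.
rewrite [_ == ord_max]eq_sym (negbTE (neq_lift _ _)) orbF.
by case: unliftP => [y' ->|->]; rewrite ?eqxx // eq_sym (negbTE (neq_lift _ _)).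
Qed.

End InnerCells.

Section DoubleBoxes.
Variables (L : link_diagram) (m : nat).
Local Notation n := m.+1.
Local Notation k := (crossings L).
Local Notation W := (@cabled_wire L m).
Local Notation pt := (('I_k * ('I_n * 'I_n)) * 'I_4 + dart k * tl_points n)%type.
Local Notation pt2 := (('I_k * ('I_n * 'I_n)) * 'I_4 + (dart k * bool) * tl_points n)%type.

(* Each end carries two boxes, [(d, true)] next to the crossing and [(d, false)] behind it. *)
Definition double_point (z : pt) : pt2 :=
  match z with inl c => inl c | inr (d, p) => inr ((d, true), p) end.

Definition double_wire (z : pt2) : pt2 :=
  match z with
  | inl c => double_point (W (inl c))
  | inr ((d, true), inl p) => double_point (W (inr (d, inl p)))
  | inr ((d, true), inr p) => inr ((d, false), inl p)
  | inr ((d, false), inl p) => inr ((d, true), inr p)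
  | inr ((d, false), inr p) => inr ((@edge L d, false), inr (rev_ord p))
  end.
Local Notation W2 := double_wire.

Lemma cabled_wire_inl c : (exists c', W (inl c) = inl c') \/ (exists d p, W (inl c) = inr (d, inl p)).
Proof.
case: c => -[i g] a; rewrite [W _]/=; case: ifP => _; first by right; do 2!eexists.
by left; eexists.
Qed.

Lemma double_wireK : involutive W2.
Proof.
move=> [c|[[d [|]] [p|p]]]; rewrite /double_wire //; last first.
- by rewrite edgeK rev_ordK.
- exact: (congr1 double_point (cabled_wireK (inr (d, inl p) : pt))).
have WK := cabled_wireK (inl c : pt).
by case: (cabled_wire_inl c) WK => [[c' ->]|[d [p ->]]] WK; exact: (congr1 double_point WK).
Qed.

Variable f : skein (tl_points n).
Hypotheses (fT : in_TL f) (fcap : kills_caps f) (f1 : f (tl_idp n) = 1).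

(** The box next to the crossing always carries [f], being part of the colored smoothing; the one
    behind it is the box of the cable, filled at the ends in [F] only. *)
Definition double_boxes (F : pred (dart k)) (d : dart k * bool) : skein (tl_points n) :=
  if d.2 || F d.1 then f else tl_id n.

Lemma double_boxes_inv F : inv_weights (double_boxes F).
Proof.
move=> d u; rewrite /double_boxes; case: ifP => _; first by move=> /fT[].
by move/basisP->; apply: tl_idpK.
Qed.

(** A cap at the top of the box behind meets the bottom of the [f] in front, which absorbs the
    second copy. *)
Lemma remove_box x (F : pred (dart k)) d : inv_weights x -> F d ->
  netsum W2 x (double_boxes F) = netsum W2 x (double_boxes [predD1 F & d]).
Proof.
move=> xK Fd; rewrite (netsum_insert (d := (d, false)) (f := f) f1); first last.
- move=> u fu nu; have [a [a' [aa ua]]] := tl_top_cap (fT fu) (elimN eqP nu).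
  have [uK _ _] := fT fu; set b := update _ _ _.
  have bd : b (d, true) = f by rewrite /b /update xpair_eqE andbF.
  have be : b (d, false) = basis u by rewrite /b /update eqxx.
  apply: (netsum_kill double_wireK xK (d := (d, true)) (p := inr a) (q := inr a')).
  + by apply: inv_weights_update => //; apply: double_boxes_inv.
  + by rewrite (inj_eq (@inr_inj _ _)); apply/eqP => e; move: aa; rewrite e => /n_Sn.
  + by left; rewrite bd; apply: kills_bottom.
  rewrite -[inr ((d, true), inr a')]/(W2 (inr ((d, false), inl a'))).
  apply: (ArcS (v := inr ((d, false), inl a'))); last exact: Arc1.
  rewrite /forced /=; split; [exact: erefl| |by move=> u'; rewrite be => /basisP->].
  by rewrite (inj_eq (@inr_inj _ _)) xpair_eqE andbF.
- by rewrite /double_boxes /= Fd.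
apply: eq_netsum => // -[d' s]; rewrite /update /double_boxes xpair_eqE /=.
by case: s; rewrite ?andbF //= andbT; case: (d' =P d).
Qed.

Lemma remove_boxes x (F : pred (dart k)) : inv_weights x ->
  netsum W2 x (double_boxes F) = netsum W2 x (double_boxes pred0).
Proof.
move=> xK; have [N] := ubnP #|F|; elim: N F => // N IH F cF.
have [d Fd|F0] := pickP F; last first.
  by apply: eq_netsum => // -[d s]; rewrite /double_boxes /= F0.
rewrite (remove_box xK Fd); apply: IH.
rewrite ltnS in cF; apply: leq_trans cF; rewrite (cardD1 d F) [d \in F]Fd add1n ltnS.
by apply: subset_leq_card; apply/subsetP => d'; rewrite !inE.
Qed.

Lemma collapse_boxes x : netsum W2 x (double_boxes pred0) = netsum W x (fun=> f).
Proof.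
apply: eq_fsum => // sg _.
rewrite fsum_bool; apply: eq_fsum => [//|M _]; rewrite (fsum_basis (fun=> tl_idp n)); congr (_ ^+ _).
set M2 := [ffun _ => _].
have M2t d : M2 (d, true) = M d by rewrite ffunE.
have M2f d : M2 (d, false) = tl_idp n by rewrite !ffunE /=; apply/ffunP => u; rewrite !ffunE.
pose h1 (z : pt) : pt2 := double_point z.
have w2 c : linked (net_graph W2 sg M2) (inl c) (double_point (W (inl c))) by apply: linked_W.
have w2' d p : linked (net_graph W2 sg M2) (inr ((d, true), inl p)) (double_point (W (inr (d, inl p)))).
  exact: linked_W.
have st d p : linked (net_graph W2 sg M2) (inr ((d, true), p)) (inr ((d, true), M d p)).
  by apply: linked1; rewrite /net_graph /step M2t eqxx orbT.
have pass d p : linked (net_graph W2 sg M2) (inr ((d, true), inr p)) (inr ((d, false), inr p)).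
  apply: (@linked_trans _ _ (inr ((d, false), inl p))); first exact: linked_W.
  by apply: linked1; rewrite /net_graph /step M2f ffunE eqxx orbT.
pose h2 (z : pt2) : pt := match z with
  | inl c => inl c | inr ((d, true), p) => inr (d, p)
  | inr ((d, false), inl p) | inr ((d, false), inr p) => inr (d, inr p) end.
have h2K z : h2 (double_point z) = z by case: z => [c|[d p]].
apply/eqP; rewrite eqn_leq; apply/andP; split.
  apply: (ncomp_le (h := double_point)).
    move=> [c|[[d [|]] [p|p]]].
    - by exists (inl c); apply: linked0.
    - by exists (inr (d, inl p)); apply: linked0.
    - by exists (inr (d, inr p)); apply: linked0.
    - by exists (inr (d, inr p)); apply: linked1r; rewrite /net_graph eqxx.
    by exists (inr (d, inr p)); rewrite linkedC; apply: pass.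
  move=> z z' /orP[]/eqP->; case: z => [c|[d p]].
  - exact: w2.
  - case: p => p; first exact: w2'.
    apply: linked_trans (pass d p) _; rewrite linkedC; apply: linked_trans (pass _ _) _.
    by apply: linked1r; rewrite /net_graph eqxx.
  - by case: c => t a; apply: linked1; rewrite /net_graph eqxx orbT.
  exact: st.
apply: (ncomp_le (h := h2)).
  by move=> z; exists (double_point z); rewrite h2K; apply: linked0.
move=> z z' /orP[]/eqP->.
  case: z => [c|[[d [|]] [p|p]]].
  - by have := linked_W W sg M (inl c); rewrite -[W (inl c)]h2K.
  - by have := linked_W W sg M (inr (d, inl p)); rewrite -[W (inr (d, inl p))]h2K.
  - exact: linked0.
  - exact: linked0.
  by apply: linked1; rewrite /net_graph eqxx.
case: z => [[t a]|[[d [|]] p]].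
- by apply: linked1; rewrite /net_graph eqxx orbT.
- by rewrite /step M2t; apply: linked1; rewrite /net_graph eqxx orbT.
by rewrite /step M2f ffunE; case: p => p; apply: linked0.
Qed.

End DoubleBoxes.

Lemma colored_wire_out n s o o' : @colored_wire n s (inr o) (inr o') = false.
Proof. by case: o o' => [a p] []. Qed.

Lemma colored_wire_fun n s : functional_wiring (@colored_wire n s).
Proof.
have dir u v v' : @colored_wire n s u v -> @colored_wire n s u v' -> v = v'.
  case: u => [[[a|[a q]]|[a [p|p]]]|[a p]] //;
  case: v => [[[b|[b r]]|[b [r|r]]]|[b r]] //; case: v' => [[[c|[c t]]|[c [t|t]]]|[c t]] //=
    => /andP[/eqP<- e] /andP[/eqP<- e'] //.
  - by have := neq_bump (outer_strand n s a) t; rewrite -(eqP e') (eqP e) eqxx.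
  - by have := neq_bump (outer_strand n s a) r; rewrite -(eqP e) (eqP e') eqxx.
  - congr (inl (inl (inr (_, _)))); apply/val_inj/(can_inj (bumpK (outer_strand n s a))).
    by rewrite -(eqP e) (eqP e').
  - by rewrite -(eqP e) (eqP e').
have inv u v v' : @colored_wire n s v u -> @colored_wire n s v' u -> v = v'.
  case: u => [[[a|[a q]]|[a [p|p]]]|[a p]] //;
  case: v => [[[b|[b r]]|[b [r|r]]]|[b r]] //; case: v' => [[[c|[c t]]|[c [t|t]]]|[c t]] //=
    => /andP[/eqP-> e] /andP[/eqP-> e'] //.
  - by congr (inl (inr (_, inl _))); apply: val_inj; rewrite /= (eqP e) (eqP e').
  - by congr (inl (inr (_, inl _))); apply: val_inj; rewrite /= (eqP e) (eqP e').
  - by rewrite (eqP e) (eqP e').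
have mix u v v' : @colored_wire n s u v -> @colored_wire n s v' u -> v = v'.
  by case: u => [[[a|[a q]]|[a [p|p]]]|[a p]]; case: v => [[[b|[b r]]|[b [r|r]]]|[b r]] //;
    case: v' => [[[c|[c t]]|[c [t|t]]]|[c t]].
move=> u v v' /orP[h|h] /orP[h'|h']; [exact: dir h h'|exact: mix h h'| |exact: inv h h'].
by symmetry; apply: mix h' h.
Qed.

(** * The colored smoothing compared with the smoothed grid *)

Section ColoredGraph.
Variables (L : link_diagram) (m : nat).
Local Notation n := m.+1.
Local Notation k := (crossings L).
Local Notation W := (@cabled_wire L m).
Local Notation W2 := (@double_wire L m).
Local Notation I := ('I_4 + 'I_4 * 'I_m + 'I_4 * tl_points n)%type.
Local Notation V := ('I_k * I + dart k * tl_points n)%type.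
Local Notation pt2 := (('I_k * ('I_n * 'I_n)) * 'I_4 + (dart k * bool) * tl_points n)%type.
Local Notation cw := (@colored_wire n false : rel (I + 'I_4 * 'I_n)%type).

Variables (sg : {ffun 'I_k * ('I_m * 'I_m) -> pairing 'I_4}) (M N : {ffun dart k -> pairing (tl_points n)}).
Variable mu : {ffun 'I_k -> pairing I}.
Hypothesis sgK : forall t, involutive (sg t).
Let fam i : pairing (('I_m * 'I_m) * 'I_4) := [ffun i => family_pairing [ffun g => sg (i, g)]] i.
Hypothesis mu_arc : forall i a, mu i (inl (inl a)) = inl (inl (smoothing false a)).
Hypothesis mu_port : forall i o, mu i (inl (inr o)) = inl (inr (glue_pairing (@grid_wire m) (fam i) o)).
Hypothesis mu_box : forall i a u, mu i (inr (a, u)) = inr (a, M (i, a) u).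

Let famE i g a : fam i (g, a) = (g, sg (i, g) a).
Proof. by rewrite /fam ffunE family_pairingE ffunE. Qed.

Let C : rel V := cable_graph cw mu N.
Let is_port (u : V) : bool := if u is inl (_, inl (inr _)) then true else false.
(** The edges between ports summarise the (n-1)-parallel. They are dropped here, to be replaced by
    its flattened grid in [F]. *)
Let around : rel V := fun u v => C u v && ~~ (is_port u && is_port v).
Let port (i : 'I_k) (o : 'I_4 * 'I_m) : V := inl (i, inl (inr o)).

Let outside_ports : ncomp (outer_graph (@grid_wire m) around port fam) = ncomp C.
Proof.
apply: eq_ncomp => u v.
  case/orP=> [/andP[uv _]|/existsP[i /existsP[o /andP[/eqP-> /eqP->]]]]; first exact: linked1.
  by apply: linked1; rewrite /C /cable_graph /port /= mu_port !eqxx.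
move=> uv; have [pp|np] := boolP (is_port u && is_port v); last first.
  by apply: linked1; rewrite /outer_graph /around uv np.
case: u v uv pp => [[i [[a|o]|u]]|[d u]] [[i' [[a'|o']|v]]|[d' v]] uv; rewrite /is_port ?andbF // => _.
move: uv; rewrite /C /cable_graph; case/andP=> /eqP<-; rewrite mu_port => /eqP e; have {e} e : glue_pairing (@grid_wire m) (fam i) o = o' by case: e.
by apply: linked1; apply/orP; right; apply/existsP; exists i; apply/existsP; exists o; rewrite e !eqxx.
Qed.

Let F : rel (V + 'I_k * (('I_m * 'I_m) * 'I_4))%type := flat_graph (@grid_wire m) around port fam.
Let extend : {ffun 'I_k * ('I_n * 'I_n) -> pairing 'I_4} :=
  [ffun t => if inner_cell t.2 is Some g then sg (t.1, g) else smoothing false].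
Let MN : {ffun dart k * bool -> pairing (tl_points n)} := [ffun d => if d.2 then M d.1 else N d.1].
Let G : rel pt2 := net_graph W2 extend MN.

Definition outermost (a : 'I_4) : 'I_n := if odd a then ord_max else ord0.

Lemma outermostE a : outermost a = outer_strand n false a :> nat.
Proof. by rewrite /outermost /outer_strand /follows; case: (odd a). Qed.

Local Notation arc_v i a := (inl (inl (i, inl (inl a)))).
Local Notation port_v i o := (inl (inl (i, inl (inr o)))).
Local Notation box_v i a u := (inl (inl (i, inr (a, u)))).

Let F_arc i a : linked F (box_v i a (inl (outermost a))) (arc_v i a).
Proof. by apply: linked1; rewrite /F /flat_graph /around /C /cable_graph /= outermostE !eqxx. Qed.

Let F_port i a q : linked F (box_v i a (inl (lift (outermost a) q))) (port_v i (a, q)).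
Proof. by apply: linked1; rewrite /F /flat_graph /around /C /cable_graph /= outermostE !eqxx. Qed.

Let F_arcs i a : linked F (box_v i a (inl (outermost a)))
  (box_v i (smoothing false a) (inl (outermost (smoothing false a)))).
Proof.
apply: linked_trans (F_arc i a) _; rewrite linkedC; apply: linked_trans (F_arc i _) _.
by apply: linked1r; rewrite /F /flat_graph /around /C /cable_graph mu_arc !eqxx orbT.
Qed.

Let F_inner i g a g' b : symrel (@grid_wire m) (inl (g, a)) (inl (g', b)) ->
  linked F (inr (i, (g, a))) (inr (i, (g', b))).
Proof.
by case/orP=> e; [apply: linked1|apply: linked1r]; rewrite /F /flat_graph eqxx e.
Qed.

Let F_border i g a b q : grid_wire (inl (g, a)) (inr (b, q)) ->
  linked F (inr (i, (g, a))) (box_v i b (inl (lift (outermost b) q))).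
Proof.
move=> e; rewrite linkedC; apply: linked_trans (F_port i b q) _.
by apply: linked1r; apply/existsP; exists (b, q); rewrite e eqxx.
Qed.

Let G_wire i g a v : symrel (@grid_wire n) (inl (g, a)) v ->
  linked G (inl ((i, g), a)) (double_point (grid_port i v)).
Proof. by move=> /(@cabled_grid L m i) <-; apply: linked_W. Qed.

Let G_fixed i g a : fixed_cell false g -> linked G (inl ((i, g), a)) (inl ((i, g), smoothing false a)).
Proof.
rewrite -inner_cell_fixed => /eqP e; apply: linked1; apply/orP; right; apply/eqP.
by rewrite /step /extend ffunE e.
Qed.

(** Each outer arc is carried by one corner cell: the south-west one for the ends 0 and 3, the
    north-east one for the ends 1 and 2. *)
Let G_arcs i a : linked G (inr (((i, a), true), inl (outermost a)))
  (inr (((i, smoothing false a), true), inl (outermost (smoothing false a)))).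
Proof.
have [_ [B0 B1 B2 B3]] := smoothingE.
have f0 : fixed_cell false ((ord0, ord0) : 'I_n * 'I_n) by rewrite /fixed_cell /= ?eqxx.
have fm : fixed_cell false ((ord_max, ord_max) : 'I_n * 'I_n) by rewrite /fixed_cell /= ?eqxx ?orbT.
have h0 : linked G (inr (((i, e0), true), inl ord0)) (inr (((i, e3), true), inl ord_max)).
  rewrite linkedC; apply: (@linked_trans _ _ (inl ((i, (ord0, ord0)), e0))).
    rewrite linkedC; apply: linked_trans (G_fixed i e0 f0) _; rewrite B0.
    apply: (@G_wire i (ord0, ord0) e3 (inr (e3, ord_max))); rewrite /symrel /= -?val_eqE /=; lia.
  apply: (@G_wire i (ord0, ord0) e0 (inr (e0, ord0))); rewrite /symrel /= -?val_eqE /=; lia.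
have h1 : linked G (inr (((i, e1), true), inl ord_max)) (inr (((i, e2), true), inl ord0)).
  rewrite linkedC; apply: (@linked_trans _ _ (inl ((i, (ord_max, ord_max)), e1))).
    rewrite linkedC; apply: linked_trans (G_fixed i e1 fm) _; rewrite B1.
    apply: (@G_wire i (ord_max, ord_max) e2 (inr (e2, ord0))); rewrite /symrel /= -?val_eqE /=; lia.
  apply: (@G_wire i (ord_max, ord_max) e1 (inr (e1, ord_max))); rewrite /symrel /= -?val_eqE /=; lia.
by elim/ord4P: a; rewrite ?B0 ?B1 ?B2 ?B3 //; rewrite linkedC.
Qed.

(** Strands of the inner grid leave directly to the north and west. To the south and east they cross
    the smoothed row or column, which shifts them by one and so makes room for the outer arcs;
    [lift] accounts for the numbering in all four cases. *)
Let G_border i g a b q : grid_wire (inl (g, a)) (inr (b, q)) ->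
  linked G (inl ((i, outer_cell g), a)) (inr (((i, b), true), inl (lift (outermost b) q))).
Proof.
have [_ [B0 B1 B2 B3]] := smoothingE.
case: g => x y; have := ltn_ord x; have := ltn_ord y; have := ltn_ord q => hq hy hx.
case/andP=> /eqP<-; elim/ord4P: a => /= /andP[/eqP ex /eqP ey]; rewrite /outer_cell /=.
- pose x1 : 'I_n := lift ord_max x; pose x2 : 'I_n := lift ord0 x.
  have f1 : fixed_cell false (x1, ord0) by rewrite /fixed_cell /= ?eqxx.
  have f2 : fixed_cell false (x2, ord0) by rewrite /fixed_cell /= ?eqxx.
  apply: linked_trans (@G_wire i (x1, lift ord0 y) e0 (inl ((x1, ord0), e2)) _) _.
    by rewrite /symrel /= -?val_eqE /= /bump; lia.
  apply: linked_trans (G_fixed i e2 f1) _; rewrite B2.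
  apply: linked_trans (@G_wire i (x1, ord0) e1 (inl ((x2, ord0), e3)) _) _.
    by rewrite /symrel /= -?val_eqE /= /bump; lia.
  apply: linked_trans (G_fixed i e3 f2) _; rewrite B3 -ex.
  by apply: (@G_wire i (x2, ord0) e0 (inr (e0, x2))); rewrite /symrel /= -?val_eqE /=; lia.
- pose y1 : 'I_n := lift ord_max y; pose y2 : 'I_n := lift ord0 y.
  have f1 : fixed_cell false (ord_max, y1) by rewrite /fixed_cell /= ?eqxx ?orbT.
  have f2 : fixed_cell false (ord_max, y2) by rewrite /fixed_cell /= ?eqxx ?orbT.
  apply: linked_trans (@G_wire i (lift ord_max x, y2) e1 (inl ((ord_max, y2), e3)) _) _.
    by rewrite /symrel /= -?val_eqE /= /bump; lia.
  apply: linked_trans (G_fixed i e3 f2) _; rewrite B3.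
  apply: linked_trans (@G_wire i (ord_max, y2) e0 (inl ((ord_max, y1), e2)) _) _.
    by rewrite /symrel /= -?val_eqE /= /bump; lia.
  apply: linked_trans (G_fixed i e2 f1) _; rewrite B2 -ex.
  by apply: (@G_wire i (ord_max, y1) e1 (inr (e1, y1))); rewrite /symrel /= -?val_eqE /=; lia.
- apply: (@G_wire i (lift ord_max x, lift ord0 y) e2 (inr (e2, lift ord0 q))).
  by move: ex => /(congr1 val); rewrite /symrel /= -?val_eqE /= /bump; lia.
apply: (@G_wire i (lift ord_max x, lift ord0 y) e3 (inr (e3, lift ord_max q))).
by move: ex => /(congr1 val); rewrite /symrel /= -?val_eqE /= /bump; lia.
Qed.

Let G_leaves i g a : fixed_cell false g -> exists u : tl_points n, exists b, linked G (inl ((i, g), a)) (inr (((i, b), true), u)).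
Proof.
have [_ [B0 B1 B2 B3]] := smoothingE; case: g => x y fg.
have hx := ltn_ord x; have hy := ltn_ord y.
have via b : (exists u : tl_points n, exists b', linked G (inl ((i, (x, y)), smoothing false b)) (inr (((i, b'), true), u))) ->
    exists u : tl_points n, exists b', linked G (inl ((i, (x, y)), b)) (inr (((i, b'), true), u)).
  by case=> u [b' h]; exists u, b'; apply: linked_trans (G_fixed i b fg) h.
have end0 x' : exists u : tl_points n, exists b', linked G (inl ((i, (x', ord0)), e0)) (inr (((i, b'), true), u)).
  exists (inl x'), e0; apply: (@G_wire i (x', ord0) e0 (inr (e0, x'))).
  by rewrite /symrel /= -?val_eqE /=; lia.
have end1 y' : exists u : tl_points n, exists b', linked G (inl ((i, (ord_max, y')), e1)) (inr (((i, b'), true), u)).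
  exists (inl y'), e1; apply: (@G_wire i (ord_max, y') e1 (inr (e1, y'))).
  by rewrite /symrel /= -?val_eqE /=; lia.
have h0 : exists u : tl_points n, exists b', linked G (inl ((i, (x, y)), e0)) (inr (((i, b'), true), u)).
  case: (unliftP ord0 y) fg => [y' ye|-> //]; rewrite /fixed_cell /= [y == _]eq_sym ye (negbTE (neq_lift _ _)).
  move=> /eqP xe; have [u [b' h]] := end1 (lift ord_max y'); exists u, b'.
  rewrite xe; apply: linked_trans (@G_wire i (ord_max, lift ord0 y') e0 (inl ((ord_max, lift ord_max y'), e2)) _) _.
    by have := ltn_ord y'; rewrite /symrel /= -?val_eqE /= /bump; lia.
  have f1 : fixed_cell false (ord_max, lift ord_max y') by rewrite /fixed_cell /= ?eqxx ?orbT.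
  by apply: linked_trans (G_fixed i e2 f1) _; rewrite B2.
have h1 : exists u : tl_points n, exists b', linked G (inl ((i, (x, y)), e1)) (inr (((i, b'), true), u)).
  case: (unliftP ord_max x) fg => [x' xe|-> //]; rewrite /fixed_cell /= [x == _]eq_sym xe (negbTE (neq_lift _ _)) orbF.
  move=> /eqP ye; have [u [b' h]] := end0 (lift ord0 x'); exists u, b'.
  rewrite ye; apply: linked_trans (@G_wire i (lift ord_max x', ord0) e1 (inl ((lift ord0 x', ord0), e3)) _) _.
    by have := ltn_ord x'; rewrite /symrel /= -?val_eqE /= /bump; lia.
  have f1 : fixed_cell false (lift ord0 x', ord0 : 'I_n) by rewrite /fixed_cell /= ?eqxx.
  by apply: linked_trans (G_fixed i e3 f1) _; rewrite B3.
by elim/ord4P: a; [exact: h0|exact: h1|apply: via; rewrite B2|apply: via; rewrite B3].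
Qed.

Let to_net (z : V + 'I_k * (('I_m * 'I_m) * 'I_4)) : pt2 :=
  match z with
  | arc_v i a => inr (((i, a), true), inl (outermost a))
  | port_v i (a, q) => inr (((i, a), true), inl (lift (outermost a) q))
  | box_v i a u => inr (((i, a), true), u)
  | inl (inr (d, u)) => inr ((d, false), u)
  | inr (i, (g, a)) => inl ((i, outer_cell g), a)
  end.

Let box_of (z : dart k * tl_points n) : V + 'I_k * (('I_m * 'I_m) * 'I_4) := box_v z.1.1 z.1.2 z.2.

(* The fixed cells are collapsed onto the boxes, along the staircases. *)
Let of_net (z : pt2) : V + 'I_k * (('I_m * 'I_m) * 'I_4) :=
  match z with
  | inl ((i, g), a) =>
      if inner_cell g is Some g' then inr (i, (g', a)) else box_of (retract (inl ((i, g), a)))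
  | inr ((d, true), u) => box_of (d, u)
  | inr ((d, false), u) => inl (inr (d, u))
  end.

Let of_inner i x y a : of_net (inl ((i, (lift ord_max x, lift ord0 y)), a)) = inr (i, ((x, y), a)).
Proof. by rewrite /of_net (outer_cellK (x, y)). Qed.

Let of_fixed i g a : fixed_cell false g -> of_net (inl ((i, g), a)) = box_of (retract (inl ((i, g), a))).
Proof. by rewrite -inner_cell_fixed /of_net => /eqP->. Qed.

Let of_low i g a (p : 'I_n) : fixed_cell false g -> staircase g a = p ->
  of_net (inl ((i, g), a)) = box_v i e0 (inl p).
Proof. by move=> fg e; rewrite of_fixed // /retract e ltn_ord inord_val. Qed.

Let of_high i g a (p : 'I_n) : fixed_cell false g -> staircase g a = (n + p)%N ->
  of_net (inl ((i, g), a)) = box_v i e1 (inl p).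
Proof. by move=> fg e; rewrite of_fixed // /retract e ltnNge leq_addr addKn inord_val. Qed.

Let of_same i g g' a a' : fixed_cell false g -> fixed_cell false g' -> staircase g a = staircase g' a' ->
  linked F (of_net (inl ((i, g), a))) (of_net (inl ((i, g'), a'))).
Proof. by move=> fg fg' e; rewrite !of_fixed // /retract e; apply: linked0. Qed.

Let of_wire i g a v : grid_wire (inl (g, a)) v ->
  linked F (of_net (inl ((i, g), a))) (of_net (double_point (grid_port i v))).
Proof.
have f0 (x : 'I_n) : fixed_cell false (x, ord0) by rewrite /fixed_cell /= ?eqxx.
have fm (y : 'I_n) : fixed_cell false (ord_max, y) by rewrite /fixed_cell /= ?eqxx ?orbT.
have [_ [B0 B1 B2 B3]] := smoothingE.
case: g v => x y [[[x' y'] b]|[b p]]; rewrite [grid_wire _ _]/=.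
  case/orP=> /and4P[/eqP ea /eqP eb /eqP e1' /eqP e2'].
    have -> : a = e2 by apply: val_inj.
    have -> : b = e0 by apply: val_inj.
    rewrite -[double_point _]/(inl ((i, (x', y')), e0)).
    case: (unliftP ord0 y') e2' => [y1 ->|->] // e2'; subst x'.
    case: (unliftP ord_max x) => [x1|] ->; last first.
      by apply: of_same => //; move: e2'; rewrite /staircase /= /bump; lia.
    case: (unliftP ord0 y) e2' => [y2 ->|->] e2'; rewrite of_inner.
      by rewrite of_inner; apply: F_inner; move: e2'; rewrite /symrel /= -?val_eqE /= /bump; lia.
    rewrite (@of_low i (lift ord_max x1, ord0) e2 (lift ord0 x1) (f0 _)); last first.
      by have := ltn_ord x1; rewrite /staircase /= /bump; lia.
    rewrite linkedC; apply: (@F_border i (x1, y1) e0 e0 x1).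
    by move: e2'; rewrite /= -?val_eqE /= /bump; lia.
  have -> : a = e1 by apply: val_inj.
  have -> : b = e3 by apply: val_inj.
  rewrite -[double_point _]/(inl ((i, (x', y')), e3)).
  have hx' := ltn_ord x'; subst y'.
  case: (unliftP ord0 y) => [y1|] ->; last first.
    by apply: of_same => //; move: e2'; rewrite /staircase /=; lia.
  case: (unliftP ord_max x) e2' => [x1 ->|->] e2'; last by move: e2' hx'; rewrite /=; lia.
  have hx1 : (@nat_of_ord m x1 < m)%N := ltn_ord x1; have hx1' := ltn_ord x1; rewrite of_inner.
  case: (unliftP ord_max x') e2' => [x2 ->|->] e2'.
    have hx2 : (@nat_of_ord m x2 < m)%N := ltn_ord x2; have hx2' := ltn_ord x2.
    by rewrite of_inner; apply: F_inner; move: e2'; rewrite /symrel /= -?val_eqE /= /bump; lia.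
  have hy1 : (@nat_of_ord m y1 < m)%N := ltn_ord y1; have hy1' := ltn_ord y1.
  rewrite (@of_high i (ord_max, lift ord0 y1) e3 (lift ord_max y1) (fm _)); last first.
    by rewrite /staircase /= /bump leq0n leqNgt hy1 addn0 addSnnS.
  apply: (@F_border i (x1, y1) e1 e1 y1).
  by move: e2'; rewrite /= -?val_eqE /= /bump; lia.
case/andP=> /eqP<-; elim/ord4P: a; case/andP=> /eqP e1' /eqP e2';
  have hx := ltn_ord x; have hy := ltn_ord y; have hp := ltn_ord p.
- have y0 : y = ord0 by apply: val_inj.
  rewrite -[double_point _]/(inr (((i, e0), true), inl p)) y0 (@of_low i (x, ord0) e0 p).
  - exact: linked0.
  - exact: f0.
  by rewrite /staircase /= e1'; lia.
- have xm : x = ord_max by apply: val_inj; rewrite /=; lia.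
  rewrite -[double_point _]/(inr (((i, e1), true), inl p)) xm (@of_high i (ord_max, y) e1 p).
  - exact: linked0.
  - exact: fm.
  by rewrite /staircase /= e1'; lia.
- have ym : y = ord_max by apply: val_inj; rewrite /=; lia.
  rewrite -[double_point _]/(inr (((i, e2), true), inl p)).
  case: (unliftP ord0 p) e1' => [q ->|->] e1'; last first.
    have xm : x = ord_max by rewrite e1'; apply: val_inj; rewrite /= subn1.
    rewrite xm ym (@of_high i (ord_max, ord_max) e2 ord_max (fm _)); last by rewrite /staircase /=; lia.
    by have := F_arcs i e1; rewrite B1.
  have hq : (@nat_of_ord m q < m)%N := ltn_ord q; have hq' := ltn_ord q.
  have {}e1' := congr1 val e1'; have {}ym := congr1 val ym.
  case: (unliftP ord_max x) e1' => [x1 ->|->] e1'; last by move: e1'; rewrite /= /bump; lia.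
  case: (unliftP ord0 y) ym => [y1 ->|->] ym; last by move: ym; rewrite /=; lia.
  have hx1 : (@nat_of_ord m x1 < m)%N := ltn_ord x1; have hx1' := ltn_ord x1; rewrite of_inner; apply: (@F_border i (x1, y1) e2 e2 q).
  by move: e1' ym; rewrite /= -?val_eqE /= /bump; lia.
rewrite -[double_point _]/(inr (((i, e3), true), inl p)).
case: (unliftP ord_max p) e1' => [q ->|->] e1'; last first.
  have y0 : y = ord0 by rewrite e1'; apply: val_inj; rewrite /= subnn.
  have x0 : x = ord0 by apply: val_inj.
  rewrite x0 y0 (@of_low i (ord0, ord0) e3 ord0 (f0 _) erefl).
  by have := F_arcs i e0; rewrite B0.
have hq : (@nat_of_ord m q < m)%N := ltn_ord q; have hq' := ltn_ord q.
have {}e1' := congr1 val e1'.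
case: (unliftP ord0 y) e1' => [y1 ->|->] e1'; last by move: e1'; rewrite /= /bump; lia.
case: (unliftP ord_max x) e2' => [x1 ->|->] e2'; last by move: e2'; rewrite /=; lia.
have hx1 : (@nat_of_ord m x1 < m)%N := ltn_ord x1; have hx1' := ltn_ord x1; rewrite of_inner; apply: (@F_border i (x1, y1) e3 e3 q).
by move: e1' e2'; rewrite /= -?val_eqE /= /bump; lia.
Qed.

Let of_symwire i g a v : symrel (@grid_wire n) (inl (g, a)) v ->
  linked F (of_net (inl ((i, g), a))) (of_net (double_point (grid_port i v))).
Proof.
case/orP=> [|h]; first exact: of_wire.
by case: v h => [[g' b]|[b p]] h; [rewrite linkedC; apply: of_wire h | case: g h].
Qed.

Lemma net_to_flat : (ncomp F <= ncomp G)%N.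
Proof.
apply: (ncomp_le (h := of_net)).
  move=> [[[i [[a|[a q]]|[a u]]]|[d u]]|[i [[x y] a]]].
  - by exists (inr (((i, a), true), inl (outermost a))); rewrite linkedC; apply: F_arc.
  - by exists (inr (((i, a), true), inl (lift (outermost a) q))); rewrite linkedC; apply: F_port.
  - by exists (inr (((i, a), true), u)); apply: linked0.
  - by exists (inr ((d, false), u)); apply: linked0.
  by exists (inl ((i, (lift ord_max x, lift ord0 y)), a)); rewrite of_inner; apply: linked0.
have cell_wire i g a : linked F (of_net (inl ((i, g), a))) (of_net (double_point (W (inl ((i, g), a))))).
  by have [v h ->] := @grid_cabled L m i g a; apply: of_symwire.
move=> z z' /orP[]/eqP->.
  case: z => [[[i g] a]|[[[i a] [|]] [p|p]]].
  - exact: cell_wire.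
  - have := cell_wire i (grid_pos a p ord0) a; rewrite cabled_wire_border linkedC; exact.
  - apply: linked1; rewrite /F /flat_graph /around /C /cable_graph /= ?eqxx ?orbT ?andbT //.
  - apply: linked1r; rewrite /F /flat_graph /around /C /cable_graph /= ?eqxx ?orbT ?andbT //.
  by apply: linked1; rewrite /F /flat_graph /around /C /cable_graph /= ?eqxx ?orbT ?andbT.
case: z => [[[i [x y]] a]|[[[i a] [|]] p]]; rewrite /step.
- have ext : extend (i, (x, y)) = if inner_cell (x, y) is Some g then sg (i, g) else smoothing false.
    by rewrite /extend ffunE.
  rewrite ext; case e : (inner_cell (x, y)) => [[x1 y1]|].
    have [ex ey] : outer_cell (x1, y1) = (x, y) by have := inner_cellK (x, y); rewrite e.
    rewrite -ex -ey !of_inner.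
    by apply: linked1; rewrite /F /flat_graph eqxx famE eqxx orbT.
  have fx : fixed_cell false (x, y) by rewrite -inner_cell_fixed e.
  have [_ [B0 B1 B2 B3]] := smoothingE.
  by apply: of_same => //; elim/ord4P: a; rewrite ?B0 ?B1 ?B2 ?B3.
- rewrite /MN ffunE; apply: linked1; rewrite /F /flat_graph /around /C /cable_graph.
  by rewrite /of_net /box_of mu_box !eqxx orbT.
by rewrite /MN ffunE; apply: linked1; rewrite /F /flat_graph /around /C /cable_graph /= eqxx ?andbT.
Qed.

Lemma flat_to_net : (ncomp G <= ncomp F)%N.
Proof.
apply: (ncomp_le (h := to_net)).
  move=> [[[i g] a]|[[[i a] [|]] u]].
  - case e : (inner_cell g) => [g'|].
      by exists (inr (i, (g', a))); have := inner_cellK g; rewrite e /= => ->; apply: linked0.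
    have fx : fixed_cell false g by rewrite -inner_cell_fixed e.
    by have [u [b h]] := G_leaves i a fx; exists (box_v i b u).
  - by exists (box_v i a u); apply: linked0.
  by exists (inl (inr ((i, a), u))); apply: linked0.
have stepG z : linked G z (step extend MN z) by apply: linked_step.
have wireG z : linked G z (W2 z) by apply: linked_W.
move=> [u|[i [[x y] a]]] [v|[i' [[x' y'] a']]].
- case/andP=> uv np; case: u uv np => [[i [[a|[a q]]|[a u]]]|[d u]]; case: v => [[i' [[a'|[a' q']]|[a' u']]]|[d' u']].
  + case/andP=> /eqP<-; rewrite mu_arc => /eqP[<-] _; exact: G_arcs.
  + by case/andP=> _; rewrite mu_arc => /eqP.
  + by case/andP=> _; rewrite mu_arc => /eqP.
  + by case: u' => r; rewrite /C /cable_graph /= ?andbF.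
  + by case/andP=> _; rewrite mu_port => /eqP.
  + by [].
  + by case/andP=> _; rewrite mu_port => /eqP.
  + by case: u' => r; rewrite /C /cable_graph /= ?andbF.
  + case/andP=> /eqP<-; rewrite mu_box => /orP[|/eqP//]; case: u => r; last by [].
    case/andP=> /eqP<- /eqP e _; have -> : r = outermost a by apply: val_inj; rewrite /= outermostE.
    exact: linked0.
  + case/andP=> /eqP<-; rewrite mu_box => /orP[|/eqP//]; case: u => r; last by [].
    case/andP=> /eqP<- /eqP e _.
    have -> : r = lift (outermost a) q' by apply: val_inj; rewrite /= outermostE.
    exact: linked0.
  + case/andP=> /eqP<-; rewrite mu_box => /orP[|/eqP[<- <-] _]; first by case: u.
    by have := stepG (inr (((i, a), true), u)); rewrite /step /MN ffunE.
  + case: u' => r; last by rewrite /C /cable_graph /=.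
    case/andP=> /eqP-> /orP[|]; first by case: u.
    case: u => p; first by [].
    case/andP=> /eqP<- /eqP-> _; have := wireG (inr ((d', true), inr p)).
    by case: d' => j b.
  + by case: u.
  + by case: u.
  + by case: u.
  case/orP=> [/eqP[-> ->] _|].
    by have := stepG (inr ((d, false), u)); rewrite /step /MN ffunE.
  case: u u' => p [] r; [by []|by []|by []|].
  case/andP=> /eqP-> /eqP-> _; exact: (wireG (inr ((d, false), inr p))).
- by [].
- case/existsP=> -[b q] /andP[w /eqP]; rewrite /port => -> ; case/orP: w; last by case: b q.
  exact: G_border.
case/andP=> /eqP<- /orP[w|]; last first.
  rewrite famE => /eqP[<- <- <-]; have := stepG (inl ((i, outer_cell (x, y)), a)).
  by rewrite /step /extend ffunE outer_cellK.
apply: (@G_wire i (outer_cell (x, y)) a (inl (outer_cell (x', y'), a'))).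
have := ltn_ord x; have := ltn_ord x'; move: w; rewrite /symrel /= -?val_eqE /= /bump; lia.
Qed.

Lemma ncomp_colored : (\sum_i glue_circles (@grid_wire m) (fam i) + ncomp C = ncomp G)%N.
Proof.
have famK i : involutive (fam i) by rewrite /fam ffunE; apply: family_pairingK => g; rewrite ffunE.
have h := ncomp_flat around port (@grid_wire_fun m) (@grid_wire_out m) famK.
rewrite outside_ports in h; rewrite addnC -h.
by apply/eqP; rewrite eqn_leq net_to_flat flat_to_net.
Qed.

End ColoredGraph.

Section ColoredState.
Variables (L : link_diagram) (m : nat).
Local Notation n := m.+1.
Local Notation k := (crossings L).
Local Notation W := (@cabled_wire L m).
Local Notation W2 := (@double_wire L m).
Variable f : skein (tl_points n).
Hypothesis fT : in_TL f.

Local Notation roots := (fun d => d \in fingraph.roots (@component_rel L)).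

Definition b_extend (sg : {ffun 'I_k * ('I_m * 'I_m) -> pairing 'I_4}) :
    {ffun 'I_k * ('I_n * 'I_n) -> pairing 'I_4} :=
  [ffun t => if inner_cell t.2 is Some g then sg (t.1, g) else smoothing false].

Definition b_state_sum : QA :=
  fsum (fun _ : 'I_k * ('I_m * 'I_m) => (crossing : pairing 'I_4 -> QA)) (fun sg =>
    fsum (fun d => (double_boxes (L := L) f roots d : pairing (tl_points n) -> QA)) (fun M2 =>
      delta ^+ ncomp (net_graph W2 (b_extend sg) M2))).

Lemma cabled_crossing_inv u : cabled_crossing m u != 0 -> involutive u.
Proof.
case/glue_supp=> v -> /family_supp[mu -> muP].
apply: glue_pairingK; first exact: grid_wire_fun.
by apply: family_pairingK => t; apply: crossingK (muP t).
Qed.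

Lemma colored_state_net : colored_state f (state_minus L) = b_state_sum * tl_closure f ^+ circles L.
Proof.
rewrite /colored_state /colored_smoothing.
rewrite (cable_eval_glue fT (@colored_wire_fun n false) (@colored_wire_out n false)); last first.
  move=> i u /juxt_supp[u1 [u2 [-> /juxt_supp[v1 [v2 [-> /basisP-> /cabled_crossing_inv v2K]]]
    /family_supp[mu -> muP]]]].
  apply: juxt_pairingK; first by apply: juxt_pairingK => //; apply: smoothingK.
  by apply: family_pairingK => t; have [] := fT (muP t).
congr (_ * _); rewrite fsum_juxt fsum_juxt fsum_basis fsum_glue fsum_family.
apply: eq_fsum => // sg sgP; rewrite fsum_family fsumZ fsum_bool.
apply: eq_fsum => // M MP; rewrite fsumZ; apply: eq_fsum => // N NP.
rewrite -exprD; congr (_ ^+ _).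
set mu := (X in cable_graph _ X).
have muE i : mu i = juxt_pairing (juxt_pairing (smoothing false)
    (glue_pairing (@grid_wire m) ([ffun t => family_pairing [ffun g => sg (t, g)]] i)))
    (family_pairing [ffun g => M (i, g)]).
  rewrite /mu ffunE; congr juxt_pairing; last by rewrite ffunE.
  rewrite [LHS]ffunE [X in juxt_pairing X _ = _]ffunE [X in juxt_pairing _ X = _]ffunE.
  exact: erefl.
apply: (@ncomp_colored L m sg M N mu) => [t|i a|i o|i a u]; first exact: crossingK (sgP t).
- by rewrite muE !juxt_pairing_inl.
- by rewrite muE juxt_pairing_inl juxt_pairing_inr.
by rewrite muE juxt_pairing_inr family_pairingE ffunE.
Qed.

Hypotheses (fcap : kills_caps f) (f1 : f (tl_idp n) = 1).

Lemma state_weight_inv o : inv_weights (@state_weight L m o).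
Proof.
move=> t u; rewrite /state_weight; case: (o t.1) => [s|]; last exact: crossingK.
by case: ifP => _; [move/smooth_weightP->; apply: smoothingK|apply: crossingK].
Qed.

(** [c] is the number of fixed cells, each contributing the factor A^-1 of its B-smoothing. A power
    of A is invisible to [doteq]. *)
Lemma state_weight_net : exists c : nat,
  netsum W (state_weight (fun=> Some false)) (fun=> f) = varA^-1 ^+ c * b_state_sum.
Proof.
exists #|[pred t : 'I_k * ('I_n * 'I_n) | omap (pair t.1) (inner_cell t.2) == None]|.
rewrite -collapse_boxes -(remove_boxes fT fcap f1 roots (@state_weight_inv _)).
rewrite /netsum (@fsum_extend _ _ _ (fun s => (s.1, outer_cell s.2)) (fun t => omap (pair t.1) (inner_cell t.2))
  _ (fun=> crossing) varA^-1 (smoothing false)).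
- apply: (congr1 (fun z => _ * z)); apply: eq_fsum => [t u|sg _]; first exact: erefl.
  apply: eq_fsum => [t u|M _]; first exact: erefl.
  suff -> : b_extend sg = [ffun t => if omap (pair t.1) (inner_cell t.2) is Some s then sg s else smoothing false] by exact: erefl.
  apply/ffunP => t; rewrite [LHS]ffunE [RHS]ffunE.
  by case: (inner_cell t.2).
- by case=> i g /=; rewrite outer_cellK.
- by case=> i g /=; have := inner_cellK g; case: (inner_cell g) => //= g' ->.
case=> i g u; rewrite /state_weight /= -inner_cell_fixed.
by case: (inner_cell g) => [g'|] /=; rewrite ?eqxx // ffunE.
Qed.

End ColoredState.

Lemma doteq_colored_state (L : link_diagram) (m : nat) (f : skein (tl_points m.+1)) :
  alternating L -> reduced L -> jones_wenzl f ->
  doteq (4 * m.+1)%N (colored_jones L f) (colored_state f (state_minus L)).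
Proof.
move=> halt hred hf.
have [fT _ _ fcap] := hf; have f1 := jw_id hf.
have [c Zc] := @state_weight_net L m f fT fcap f1.
have [R Rv J] := expand_states halt hred fT fcap f1.
(* Components without crossings contribute the same power of the trace of [f] to both sides; being
   nonzero, it only shifts the lowest order. *)
have [q qv] := vexact_exists (tl_closure_neq0 hf).
have Zs := vexact_state halt hred fT fcap f1.
have cq := vexactX (circles L) qv.
have AK : varA ^ c * varA^-1 ^+ c = 1.
  by rewrite -exprnP -exprMn divff ?varA_neq0 // expr1n.
have U : b_state_sum L f = varA ^ c * netsum (@cabled_wire L m) (state_weight (fun=> Some false)) (fun=> f).
  by rewrite Zc mulrA AK mul1r.
apply: (@doteq_vexact (4 * m.+1) (- c%:Z) (c%:Z + lowest_order L m + q *+ circles L) _ _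
  (varA ^ c * R * tl_closure f ^+ circles L)); first by [].
- by rewrite (colored_state_net L fT) U; apply: vexactM cq; apply: vexactM Zs; apply: vexactA.
- rewrite addrAC -[c%:Z + _ + _]addrA; apply: vgeM (vexact_vge cq).
  by apply: vgeM Rv; apply: vgeA.
rewrite (colored_jones_net L fT) (colored_state_net L fT) U.
have -> : netsum (@cabled_wire L m) (fun=> crossing) (cable_box (L := L) f) =
    netsum (@cabled_wire L m) (fun=> crossing) (fun=> f).
  exact: (boxes_everywhere fT fcap f1 (F := fun d => d \in fingraph.roots (@component_rel L))).
by rewrite J -mulrDl -mulrDr !mulrA -varA_expD addNr expr0z mul1r.
Qed.

Local Close Scope ring_scope.

Theorem theorem4p1 (L : link_diagram) (n : nat) (f : skein (tl_points n))
    (hn : (1 <= n)%N) (halt : alternating L) (hred : reduced L)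
    (hf : jones_wenzl f) :
  doteq (4 * n) (colored_jones L f) (colored_state f (state_minus L)).
Proof.
case: n f hn hf => [f|m f _ hf]; first by [].
exact: doteq_colored_state halt hred hf.
Qed.
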